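(* Let $M=M^n$ be a Wintgen ideal submanifold of dimension $n\ge 4$ and codimension $m\ge 1$ in a real space form $\mathbb{R}^{n+m}(\widetilde{k})$. Then the tensors $C\cdot R$ and $Q(g,C)$ are linearly dependent if and only if $M$ is totally umbilical in $\mathbb{R}^{n+m}(\widetilde{k})$. In this case, $M$ is conformally flat.
   Context: Manifolds are connected, Riemannian and of class $C^\infty$. $\mathbb{R}^{n+m}(\widetilde{k})$ is a real space form: a Riemannian manifold of dimension $n+m$ and constant curvature $\widetilde{k}$, with metric $\widetilde{g}$. The submanifold $M$ carries the induced metric $g$ with Levi-Civita connection $\nabla$; $h$ is its second fundamental form and the shape operator $A_\xi$ for a normal field $\xi$ is given by $g(A_\xi X,Y)=\widetilde{g}(\xi,h(X,Y))$. $\{E_i\}_{i=1}^n$ is any local orthonormal tangent frame and $\{\xi_\alpha\}_{\alpha=1}^m$ any local orthonormal normal frame; $A_\alpha=A_{\xi_\alpha}$. The mean curvature vector is $\vec{H}=\frac1n\sum_i h(E_i,E_i)$ and $H=\|\vec{H}\|$. $M$ is totally umbilical if $h(X,Y)=g(X,Y)\vec{H}$. For a symmetric $(0,2)$-tensor $A$: $(X\wedge_A Y)Z=A(Y,Z)X-A(X,Z)Y$. $\mathcal{R}(X,Y)Z=\nabla_X\nabla_YZ-\nabla_Y\nabla_XZ-\nabla_{[X,Y]}Z$, $R(X,Y,Z,W)=g(\mathcal{R}(X,Y)Z,W)$, $\mathrm{Ricc}(X,Y)=\mathrm{tr}\{Z\mapsto\mathcal{R}(Z,X)Y\}$, $g(\mathcal{S}X,Y)=\mathrm{Ricc}(X,Y)$,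 $\kappa=\mathrm{tr}\,\mathcal{S}$, and the Weyl tensor is $C(X,Y,Z,W)=g(\mathcal{C}(X,Y)Z,W)$ with $\mathcal{C}(X,Y)=\mathcal{R}(X,Y)-\frac1{n-2}\left(X\wedge_g\mathcal{S}Y+\mathcal{S}X\wedge_gY-\frac{\kappa}{n-1}X\wedge_gY\right)$. For a skew family of endomorphisms $\mathcal{B}(X,Y)$ and a $(0,k)$-tensor $T$ put $(\mathcal{B}(X,Y)\cdot T)(X_1,\dots,X_k)=-\sum_{j=1}^k T(X_1,\dots,\mathcal{B}(X,Y)X_j,\dots,X_k)$. The $(0,k+2)$-tensors $R\cdot T$, $C\cdot T$, $Q(A,T)$ are defined by $(X_1,\dots,X_k;X,Y)\mapsto(\mathcal{B}(X,Y)\cdot T)(X_1,\dots,X_k)$ with $\mathcal{B}(X,Y)=\mathcal{R}(X,Y)$, $\mathcal{C}(X,Y)$, $X\wedge_AY$ respectively. Two tensors $T_1,T_2$ are called linearly dependent (on $M$) if they are linearly dependent at every point of $M$; on the set where $T_2\neq0$ this means $T_1=L\,T_2$ for some function $L$. Normalized scalar curvature: $\rho=\frac{2}{n(n-1)}\sum_{i<j}R(E_i,E_j,E_j,E_i)$. Normal curvature: $R^\perp(X,Y;\xi,\eta)=g([A_\xi,A_\eta]X,Y)$, and $\rho^\perp=\frac{2}{n(n-1)}\sqrt{\sum_{i<j}\sum_{\alpha<\beta}R^\perp(E_i,E_j;\xi_\alpha,\xi_\beta)^2}$. $M$ is a Wintgen ideal submanifold if $\rho=H^2-\rho^\perp+\widetilde{k}$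 everywhere on $M$ (equality in the Wintgen inequality $\rho\le H^2-\rho^\perp+\widetilde{k}$). *)

(* Defs.v *)
From HB Require Import structures.
From mathcomp Require Import all_boot all_order all_algebra.
From mathcomp Require Import all_classical all_reals all_analysis.
Set Implicit Arguments.
Unset Strict Implicit.
Unset Printing Implicit Defensive.
Import Order.TTheory GRing.Theory Num.Theory.
Import numFieldNormedType.Exports.
Local Open Scope classical_set_scope.
Local Open Scope ring_scope.

(* For an open set [U] of a finite-dimensional space this is the usual class
   C^k: [f] is C^(k+1) iff it is differentiable with C^k derivatives. *)
Fixpoint Ck (R : realType) (V W : normedModType R) (k : nat) (U : set V)
    (f : V -> W) : Prop :=
  match k with
  | 0 => forall x, U x -> {for x, continuous f}
  | k'.+1 => (forall x, U x -> differentiable f x) /\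
             (forall v : V, Ck k' U (fun x => 'D_v f x))
  end.

Definition smooth_on (R : realType) (V W : normedModType R) (U : set V)
    (f : V -> W) : Prop := forall k, Ck k U f.

(** * Riemannian geometry of a metric in coordinates

    Points and tangent vectors are row vectors of R^n; [G x] is the matrix
    (g_ij(x)) of the metric at [x]. *)

Section MetricInCoordinates.
Variables (R : realType) (n : nat).
Local Notation V := 'rV[R]_n.
Local Notation basis_vec k := (delta_mx ord0 k : V).
Variable G : V -> 'M[R]_n.

Definition inner (x u v : V) : R := (u *m G x *m v^T) ord0 ord0.

(* The vector representing the linear form [w], i.e. the [v] such that
   [inner x v u = w u] for all [u]. *)
Definition sharp (x : V) (w : V -> R) : V :=
  (\row_k w (basis_vec k)) *m invmx (G x).

(* Koszul formula for coordinate fields; the k-th coordinate of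
   [christoffel x u v] is Gamma^k_ij u^i v^j. *)
Definition christoffel (x u v : V) : V :=
  sharp x (fun w => 2^-1 * ('D_u (fun y => inner y v w : R^o) x
                          + 'D_v (fun y => inner y u w : R^o) x
                          - 'D_w (fun y => inner y u v : R^o) x)).

(* Levi-Civita connection on vector fields. *)
Definition nabla (X Y : V -> V) : V -> V :=
  fun x => 'D_(X x) Y x + christoffel x (X x) (Y x).

Definition lie_bracket (X Y : V -> V) : V -> V :=
  fun x => 'D_(X x) Y x - 'D_(Y x) X x.

Definition curvature (X Y Z : V -> V) : V -> V :=
  fun x => nabla X (nabla Y Z) x - nabla Y (nabla X Z) x
           - nabla (lie_bracket X Y) Z x.

(* Tangent vectors are extended to fields with constant coordinates. *)
Definition curv_op (x u v w : V) : V :=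
  curvature (fun=> u) (fun=> v) (fun=> w) x.

Definition Riem (x u v w z : V) : R := inner x (curv_op x u v w) z.

Definition Ricc (x u v : V) : R := \tr (lin1_mx (fun z => curv_op x z u v)).

Definition ricci_op (x u : V) : V := sharp x (Ricc x u).

Definition scal (x : V) : R := \tr (lin1_mx (ricci_op x)).

Definition wedge (A : V -> V -> R) (u v w : V) : V := A v w *: u - A u w *: v.

Definition weyl_op (x u v w : V) : V :=
  curv_op x u v w
  - (n%:R - 2)^-1 *:
    (wedge (inner x) u (ricci_op x v) w + wedge (inner x) (ricci_op x u) v w
     - (scal x / (n%:R - 1)) *: wedge (inner x) u v w).

Definition Weyl (x u v w z : V) : R := inner x (weyl_op x u v w) z.

(* (B(u,v) . T)(x1,x2,x3,x4), with the arguments in the order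
   (x1,x2,x3,x4;u,v). *)
Definition act4 (B : V -> V -> V -> V) (T : V -> V -> V -> V -> R)
    (x1 x2 x3 x4 u v : V) : R :=
  - (T (B u v x1) x2 x3 x4 + T x1 (B u v x2) x3 x4
     + T x1 x2 (B u v x3) x4 + T x1 x2 x3 (B u v x4)).

Definition C_dot_R (x : V) := act4 (weyl_op x) (Riem x).

Definition Q_g_C (x : V) := act4 (wedge (inner x)) (Weyl x).

Definition lin_dep6 (T1 T2 : V -> V -> V -> V -> V -> V -> R) : Prop :=
  exists a b : R, (a != 0) || (b != 0) /\
    forall x1 x2 x3 x4 u v,
      a * T1 x1 x2 x3 x4 u v + b * T2 x1 x2 x3 x4 u v = 0.

Definition area2 (x u v : V) : R :=
  inner x u u * inner x v v - inner x u v ^+ 2.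

(* [area2 x u v != 0] says that [u] and [v] span a plane. *)
Definition sectional_curvature (x u v : V) : R :=
  Riem x u v v u / area2 x u v.

Definition orthonormal_frame (x : V) (E : 'I_n -> V) : Prop :=
  forall i j, inner x (E i) (E j) = (i == j)%:R.

Definition normalized_scal (x : V) (E : 'I_n -> V) : R :=
  2 / (n%:R * (n%:R - 1)) *
  \sum_(i < n) \sum_(j < n | (i < j)%N) Riem x (E i) (E j) (E j) (E i).

End MetricInCoordinates.

(** * A submanifold in coordinates

    [F] is the coordinate expression of the immersion, [G] and [Gt] are the
    coordinate expressions of the metrics of the submanifold and of the ambient
    space; the differential of [F] at [x] is [fun u => 'D_u F x]. *)

Section SubmanifoldInCoordinates.
Variables (R : realType) (n m : nat).
Local Notation V := 'rV[R]_n.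
Local Notation W := 'rV[R]_(n + m).
Variables (G : V -> 'M[R]_n) (Gt : W -> 'M[R]_(n + m)) (F : V -> W).

(* Gauss formula: h(u,v) is the ambient covariant derivative, in the direction
   [u], of the field [dF(v)] along [F], minus [dF] of the intrinsic covariant
   derivative of the coordinate-constant field [v]. *)
Definition second_ff (x u v : V) : W :=
  'D_u (fun y => 'D_v F y) x
  + christoffel Gt (F x) ('D_u F x) ('D_v F x)
  - 'D_(christoffel G x u v) F x.

Definition shape_op (x : V) (xi : W) (u : V) : V :=
  sharp G x (fun v => inner Gt (F x) xi (second_ff x u v)).

Definition orthonormal_normal_frame (x : V) (xi : 'I_m -> W) : Prop :=
  (forall a b, inner Gt (F x) (xi a) (xi b) = (a == b)%:R) /\
  (forall a u, inner Gt (F x) (xi a) ('D_u F x) = 0).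

Definition mean_curvature_vector (x : V) (E : 'I_n -> V) : W :=
  n%:R^-1 *: \sum_(i < n) second_ff x (E i) (E i).

Definition mean_curvature (x : V) (E : 'I_n -> V) : R :=
  Num.sqrt (inner Gt (F x) (mean_curvature_vector x E)
                           (mean_curvature_vector x E)).

Definition normal_curvature (x u v : V) (xi eta : W) : R :=
  inner G x (shape_op x xi (shape_op x eta u)
             - shape_op x eta (shape_op x xi u)) v.

Definition normalized_normal_curvature (x : V) (E : 'I_n -> V)
    (xi : 'I_m -> W) : R :=
  2 / (n%:R * (n%:R - 1)) *
  Num.sqrt (\sum_(i < n) \sum_(j < n | (i < j)%N)
            \sum_(a < m) \sum_(b < m | (a < b)%N)
              normal_curvature x (E i) (E j) (xi a) (xi b) ^+ 2).

(* Neither of the next two conditions depends on the orthonormal frames. *)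
Definition wintgen_ideal_at (k : R) (x : V) : Prop :=
  forall (E : 'I_n -> V) (xi : 'I_m -> W),
    orthonormal_frame G x E -> orthonormal_normal_frame x xi ->
    normalized_scal G x E
    = mean_curvature x E ^+ 2 - normalized_normal_curvature x E xi + k.

Definition umbilical_at (x : V) : Prop :=
  forall E : 'I_n -> V, orthonormal_frame G x E ->
  forall u v, second_ff x u v = inner G x u v *: mean_curvature_vector x E.

End SubmanifoldInCoordinates.

(** * Manifolds *)

(* [chart_fun] and [chart_inv] are total; their values outside [chart_dom] and
   [chart_codom] are irrelevant. *)
Record chart (R : realType) (T : topologicalType) (n : nat) := Chart {
  chart_dom : set T;
  chart_fun : T -> 'rV[R]_n;
  chart_inv : 'rV[R]_n -> T;
  chart_dom_open : open chart_dom;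
  chart_codom_open : open (chart_fun @` chart_dom);
  chart_funK : forall p, chart_dom p -> chart_inv (chart_fun p) = p;
  chart_fun_continuous :
    forall p, chart_dom p -> {for p, continuous chart_fun};
  chart_inv_continuous :
    forall p, chart_dom p -> {for chart_fun p, continuous chart_inv}
}.

Definition chart_codom (R : realType) (T : topologicalType) (n : nat)
  (c : chart R T n) : set 'rV[R]_n := chart_fun c @` chart_dom c.

Definition transition (R : realType) (T : topologicalType) (n : nat)
  (c c' : chart R T n) : 'rV[R]_n -> 'rV[R]_n := chart_fun c' \o chart_inv c.

(* Connected Riemannian manifolds of class C^oo, given by an atlas (not
   necessarily maximal) indexed by [atlas_index]. *)
Record riemannian_manifold (R : realType) (n : nat) := RiemannianManifold {
  carrier :> topologicalType;
  carrier_hausdorff : hausdorff_space carrier;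
  carrier_second_countable : @second_countable carrier;
  carrier_connected : connected [set: carrier];
  atlas_index : Type;
  atlas : atlas_index -> chart R carrier n;
  atlas_cover : forall p : carrier, exists i, chart_dom (atlas i) p;
  atlas_smooth : forall i j,
    smooth_on (chart_fun (atlas i) @`
                 (chart_dom (atlas i) `&` chart_dom (atlas j)))
              (transition (atlas i) (atlas j));
  metric : atlas_index -> 'rV[R]_n -> 'M[R]_n;
  metric_smooth : forall i u v,
    smooth_on (chart_codom (atlas i)) (fun x => inner (metric i) x u v : R^o);
  metric_sym : forall i x u v, chart_codom (atlas i) x ->
    inner (metric i) x u v = inner (metric i) x v u;
  metric_pos : forall i x u, chart_codom (atlas i) x -> u != 0 ->
    0 < inner (metric i) x u u;
  metric_compat : forall i j x u v,
    (chart_fun (atlas i) @`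
       (chart_dom (atlas i) `&` chart_dom (atlas j))) x ->
    let t := transition (atlas i) (atlas j) in
    inner (metric i) x u v = inner (metric j) (t x) ('D_u t x) ('D_v t x)
}.

Section Intrinsic.
Variables (R : realType) (n : nat) (M : riemannian_manifold R n).

Definition constant_curvature (k : R) : Prop :=
  forall (p : M) (i : atlas_index M), chart_dom (atlas i) p ->
  let x := chart_fun (atlas i) p in
  forall u v, area2 (metric i) x u v != 0 ->
    sectional_curvature (metric i) x u v = k.

Definition CR_QgC_linearly_dependent : Prop :=
  forall (p : M) (i : atlas_index M), chart_dom (atlas i) p ->
  let x := chart_fun (atlas i) p in
  lin_dep6 (C_dot_R (metric i) x) (Q_g_C (metric i) x).

(* Around each point the metric is conformal to a flat metric. *)
Definition conformally_flat : Prop :=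
  forall (p : M) (i : atlas_index M), chart_dom (atlas i) p ->
  exists (U : set 'rV[R]_n) (phi : 'rV[R]_n -> R),
    [/\ open U, U (chart_fun (atlas i) p), U `<=` chart_codom (atlas i),
        smooth_on U (phi : 'rV[R]_n -> R^o) &
        forall x, U x -> 0 < phi x /\
          forall u v w,
            curv_op (fun y => phi y *: metric i y) x u v w = 0].

End Intrinsic.

Section Submanifolds.
Variables (R : realType) (n m : nat).
Variables (M : riemannian_manifold R n) (N : riemannian_manifold R (n + m)).
Variable f : M -> N.

Definition local_expr (i : atlas_index M) (j : atlas_index N) :
    'rV[R]_n -> 'rV[R]_(n + m) :=
  chart_fun (atlas j) \o f \o chart_inv (atlas i).

Definition smooth_map : Prop :=
  continuous f /\
  forall (i : atlas_index M) (j : atlas_index N),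
    smooth_on (chart_fun (atlas i) @`
                 (chart_dom (atlas i) `&` f @^-1` chart_dom (atlas j)))
              (local_expr i j).

(* [M], with its metric, is a submanifold of [N] carrying the induced metric. *)
Definition isometric_immersion : Prop :=
  smooth_map /\
  forall (p : M) (i : atlas_index M) (j : atlas_index N),
    chart_dom (atlas i) p -> chart_dom (atlas j) (f p) ->
    let x := chart_fun (atlas i) p in
    let F := local_expr i j in
    injective (fun u => 'D_u F x) /\
    forall u v, inner (metric i) x u v
                = inner (metric j) (F x) ('D_u F x) ('D_v F x).

Definition wintgen_ideal (k : R) : Prop :=
  forall (p : M) (i : atlas_index M) (j : atlas_index N),
    chart_dom (atlas i) p -> chart_dom (atlas j) (f p) ->
    wintgen_ideal_at (metric i) (metric j) (local_expr i j) k
      (chart_fun (atlas i) p).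

Definition totally_umbilical : Prop :=
  forall (p : M) (i : atlas_index M) (j : atlas_index N),
    chart_dom (atlas i) p -> chart_dom (atlas j) (f p) ->
    umbilical_at (metric i) (metric j) (local_expr i j)
      (chart_fun (atlas i) p).

End Submanifolds.

(* Main.v *)
Require Import Defs.
From HB Require Import structures.
From mathcomp Require Import all_boot all_order all_algebra.
From mathcomp Require Import all_classical all_reals all_analysis.
From mathcomp Require Import complex ring lra.
Set Implicit Arguments.
Unset Strict Implicit.
Unset Printing Implicit Defensive.
Import Order.TTheory GRing.Theory Num.Theory.
Import numFieldNormedType.Exports.
Local Open Scope ring_scope.

(** Everything but the last claim is decided at one point. Let [B a] be the traceless part of the
    matrix of the second fundamental form along the unit normal [xi a], in an orthonormal tangent
    frame. Tracing the Gauss equation gives rho = k + H^2 - (sum of |B_a|^2) / (n (n - 1)), while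
    rho^perp is the square root of the sum of all |[B_a, B_b]|^2, divided by the same n (n - 1). So
    the Wintgen equality says that the family [B] attains equality in the DDVV inequality: sum
    |[B_a, B_b]|^2 <= (sum |B_a|^2)^2 ([ddvv_equality]).

    The equality case is [commutator_equality]: either all [B a] vanish, or in suitable frames only
    two survive, mu (e1 e1 - e2 e2) and mu (e1 e2 + e2 e1). After an orthogonal change of the normal
    frame the matrices are mutually orthogonal, and everything reduces to a bound for one unit
    matrix against an orthonormal family: the positive parts of |[b, b_d]|^2 - 1 add up to at most 1
    ([excess_row_le1]). In an eigenbasis of b this follows from Bessel's inequality and an
    elementary fact on n real numbers with square sum 1 ([excess_sum]). Writing the differences as
    sums of nonnegative terms lets the equality case be read off.

    At a nonumbilical point the Gauss equation then gives the whole curvature tensor in terms of mu,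
    of two tangent directions f1, f2 and of the components of the mean curvature vector
    ([shape_curv]). Its Weyl part is explicit ([wintgen_weyl_op]), and evaluating C.R and Q(g,C) on
    f1, f2 and two further directions, which exist because n >= 4, yields three linear equations
    with only the zero solution ([wintgen_independent]). At an umbilical point the curvature has the
    constant curvature form, the Weyl tensor vanishes and C.R = 0 ([dependence_of_umbilical]).

    For conformal flatness an actual conformal factor has to be produced. By Codazzi, |H|^2 is
    locally constant ([dd_normH]), so the metric has constant curvature c near each point. The
    overdetermined equation Hess f = - c f g is then integrable, and a Frobenius theorem for flat
    linear systems ([frobenius]), proved by solving linear differential equations along rays,
    provides the solution with f = 1/2 and df = 0 at the point. The quantity |df|^2 + c f^2 is
    constant, and g / (f + 1/2)^2 is flat ([conformal_riem]): this is stereographic projection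
    without coordinates. *)

(** * Spectral theorem for real symmetric matrices *)

(*%%A1*)
Section RealSpectral.
Variable R : rcfType.

Definition dotv n (u v : 'rV[R]_n) : R := (u *m v^T) 0 0.

Lemma dotvE n (u v : 'rV[R]_n) : dotv u v = \sum_i u 0 i * v 0 i.
Proof. by rewrite /dotv mxE; apply: eq_bigr => i _; rewrite mxE. Qed.

Lemma dotvC n (u v : 'rV[R]_n) : dotv u v = dotv v u.
Proof. by rewrite !dotvE; apply: eq_bigr => i _; rewrite mulrC. Qed.

Lemma dotvZl n a (u v : 'rV[R]_n) : dotv (a *: u) v = a * dotv u v.
Proof. by rewrite /dotv -scalemxAl mxE. Qed.

Lemma dotvDl n (u v w : 'rV[R]_n) : dotv (u + v) w = dotv u w + dotv v w.
Proof. by rewrite /dotv mulmxDl mxE. Qed.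

Lemma dotvBl n (u v w : 'rV[R]_n) : dotv (u - v) w = dotv u w - dotv v w.
Proof. by rewrite /dotv mulmxBl !mxE. Qed.

Lemma dotv_ge0 n (u : 'rV[R]_n) : 0 <= dotv u u.
Proof. by rewrite dotvE sumr_ge0 // => i _; rewrite -expr2 sqr_ge0. Qed.

Lemma dotv_eq0 n (u : 'rV[R]_n) : dotv u u = 0 -> u = 0.
Proof.
move=> /eqP; rewrite dotvE psumr_eq0 => [/allP h|i _]; last first.
  by rewrite -expr2 sqr_ge0.
by apply/rowP => i; rewrite mxE; have := h i (mem_index_enum i);
  rewrite mulf_eq0 orbb => /eqP.
Qed.

(** Over the complexification an eigenvector x + iy with eigenvalue r + is exists. Symmetry of [A]
    gives s (|x|^2 + |y|^2) = 0, so s = 0 and whichever of x, y is nonzero is a real eigenvector. *)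
Lemma symmetric_eigenvalue n (A : 'M[R]_n) : (0 < n)%N -> A^T = A ->
  exists2 r, exists2 v : 'rV[R]_n, v *m A = r *: v & dotv v v = 1 & True.
Proof.
move=> n0 sA.
have [a /eigenvalueP[w wA w0]] :=
  eigenvalue_closed (map_mx (real_complex R) A) n0.
pose x : 'rV[R]_n := map_mx (@complex.Re R) w.
pose y : 'rV[R]_n := map_mx (@complex.Im R) w.
pose r := complex.Re a; pose s := complex.Im a.
have wE i : w 0 i = (x 0 i +i* y 0 i)%C by rewrite !mxE; case: (w 0 i).
have aE : a = (r +i* s)%C by rewrite /r /s; case: (a).
have xyA : x *m A = r *: x - s *: y /\ y *m A = s *: x + r *: y.
  have h i : (w *m map_mx (real_complex R) A) 0 i
     = ((x *m A) 0 i +i* (y *m A) 0 i)%C.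
    rewrite !mxE.
    rewrite (eq_bigr (fun j => (x 0 j * A j i +i* (y 0 j * A j i))%C)); last first.
      move=> j _; rewrite wE !mxE /=.
      by apply/eqP; rewrite eq_complex /= !mulr0 subr0 add0r !eqxx.
    elim/big_rec3: _ => // j u v t _ ->.
    by apply/eqP; rewrite eq_complex /= !eqxx.
  have h' i := congr1 (fun M : 'rV_n => M 0 i) wA.
  split; apply/rowP => i; move: (h' i); rewrite h !mxE wE aE => -[] /=.
    by rewrite !mxE => -> _.
  by rewrite !mxE => _ ->; rewrite addrC.
case: xyA => xA yA.
have sym : dotv (x *m A) y = dotv x (y *m A).
  by rewrite /dotv trmx_mul sA mulmxA.
have s0 : s = 0.
  have : s * (dotv x x + dotv y y) = 0.
    move: sym; rewrite xA yA (dotvC x) dotvBl dotvDl !dotvZl (dotvC y x).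
    by lra.
  move/eqP; rewrite mulf_eq0 => /orP[/eqP//|].
  rewrite paddr_eq0 ?dotv_ge0 // => /andP[/eqP/dotv_eq0 x0 /eqP/dotv_eq0 y0].
  case/eqP: w0; apply/rowP => i; rewrite wE x0 y0 !mxE.
  by apply/eqP; rewrite eq_complex /= !eqxx.
have [z z0 zA] : exists2 z : 'rV[R]_n, z != 0 & z *m A = r *: z.
  have [x0|x0] := eqVneq x 0; last by exists x; rewrite // xA s0 scale0r subr0.
  exists y; last by rewrite yA s0 scale0r add0r.
  apply/eqP => y0; case/eqP: w0; apply/rowP => i; rewrite wE x0 y0 !mxE.
  by apply/eqP; rewrite eq_complex /= !eqxx.
have zz : 0 < dotv z z.
  rewrite lt_def dotv_ge0 andbT; apply: contra z0 => /eqP/dotv_eq0 ->.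
  by rewrite eqxx.
exists r => //; exists ((Num.sqrt (dotv z z))^-1 *: z).
  by rewrite -scalemxAl zA !scalerA mulrC.
rewrite dotvZl dotvC dotvZl mulrA.
rewrite -invfM -expr2 sqr_sqrtr ?dotv_ge0 // mulVf //.
by rewrite gt_eqF.
Qed.

(** The reflection in the hyperplane orthogonal to v - e exchanges the unit vectors e and v. It
    serves to complete v to an orthonormal basis. *)
Lemma householder n (v : 'rV[R]_(1 + n)) : dotv v v = 1 ->
  exists2 P : 'M[R]_(1 + n), P *m P^T = 1%:M & row 0 P = v.
Proof.
move=> vv; pose e : 'rV[R]_(1 + n) := delta_mx 0 0; pose w := v - e.
have [w0|w0] := eqVneq w 0.
  exists 1%:M; first by rewrite trmx1 mulmx1.
  move/eqP: w0; rewrite subr_eq0 => /eqP ->.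
  by rewrite rowE mulmx1.
pose c := 2 / dotv w w.
have ww : dotv w w != 0 by apply: contra w0 => /eqP/dotv_eq0 ->; rewrite eqxx.
have wwM : w *m w^T = (dotv w w)%:M by rewrite [LHS]mx11_scalar.
pose P := 1%:M - c *: (w^T *m w).
have PT : P^T = P.
  by rewrite /P linearB /= linearZ /= trmx1 trmx_mul trmxK.
exists P.
  rewrite PT /P; set X := w^T *m w.
  have XX : X *m X = dotv w w *: X.
    by rewrite /X -mulmxA (mulmxA w) wwM mul_scalar_mx -scalemxAr.
  rewrite mulmxBl !mulmxBr !mul1mx mulmx1 -scalemxAl -scalemxAr XX.
  by apply/matrixP => i j; rewrite !mxE /c; field.
rewrite rowE -/e /P mulmxBr mulmx1 -scalemxAr mulmxA.
have ew : e *m w^T = (dotv e w)%:M by rewrite [LHS]mx11_scalar.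
rewrite ew mul_scalar_mx scalerA.
have ee : dotv e e = 1.
  by rewrite /dotv /e trmx_delta mul_delta_mx mxE !eqxx.
have ewE : dotv e w = dotv e v - 1.
  by rewrite dotvC dotvBl ee (dotvC v).
have wwE : dotv w w = 2 - 2 * dotv e v.
  have -> : dotv w w = dotv v v + dotv e e - dotv v e - dotv e v.
    by rewrite dotvBl !(dotvC _ w) !dotvBl (dotvC e v); ring.
  by rewrite vv ee (dotvC v); ring.
have -> : c * dotv e w = -1.
  by rewrite /c ewE; move: ww; rewrite wwE => ww; field.
by rewrite scaleN1r opprK /w addrC subrK.
Qed.

(** Deflation: in an orthonormal basis starting with a unit eigenvector, symmetry clears the rest of
    the first row and column, and induction treats the remaining block. *)
Theorem symmetric_diagonalization n (A : 'M[R]_n) : A^T = A ->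
  exists (P : 'M[R]_n) (d : 'rV[R]_n),
    P *m P^T = 1%:M /\ P *m A *m P^T = diag_mx d.
Proof.
elim: n A => [|n IH] A sA.
  by exists 1%:M, 0; split; apply/matrixP => -[].
have [r [v vA vv] _] := symmetric_eigenvalue (ltn0Sn n) sA.
have [P PP Pv] := householder vv.
have [B BD] : {B : 'M[R]_(1 + n) | B = P *m A *m P^T} by eexists.
have sB : B^T = B by rewrite BD !trmx_mul trmxK sA mulmxA.
have B0 : row 0 B = r *: delta_mx 0 0.
  rewrite BD !row_mul Pv vA -scalemxAl -Pv rowE -mulmxA PP mulmx1.
  by [].
have B0j j : B 0 j = r * (j == 0)%:R.
  by have := congr1 (fun M : 'rV_(1 + n) => M 0 j) B0; rewrite !mxE.
have BE : B = block_mx r%:M 0 0 (drsubmx B).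
  rewrite -[LHS]submxK; congr block_mx; apply/matrixP => i j.
  - rewrite !mxE !ord1 /= (_ : lshift n 0 = 0); last exact/val_inj.
    by rewrite B0j mulr1n mulr1.
  - rewrite !mxE !ord1 (_ : lshift n 0 = 0); last exact/val_inj.
    by rewrite B0j (_ : (_ == 0) = false) ?mulr0.
  - rewrite !mxE !ord1 (_ : lshift n 0 = 0); last exact/val_inj.
    by rewrite -sB mxE B0j (_ : (_ == 0) = false) ?mulr0.
have sD : (drsubmx B)^T = drsubmx B by rewrite trmx_drsub sB.
have [Q [d [QQ QD]]] := IH _ sD.
pose Q' : 'M[R]_(1 + n) := block_mx 1%:M 0 0 Q.
have Q'T : Q'^T = block_mx 1%:M 0 0 Q^T.
  by rewrite /Q' tr_block_mx !trmx0 trmx1.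
exists (Q' *m P), (row_mx r%:M d : 'rV_(1 + n)); split.
  rewrite trmx_mul mulmxA -(mulmxA Q') PP mulmx1.
  have : Q' *m Q'^T = 1%:M :> 'M[R]_(1 + n).
    rewrite Q'T /Q' mulmx_block.
    by rewrite !(mulmx0, mul0mx, mulmx1, addr0, add0r) QQ -scalar_mx_block.
  by [].
rewrite trmx_mul -!mulmxA (mulmxA P) (mulmxA (P *m A)) -BD.
have : Q' *m (B *m Q'^T) = diag_mx (row_mx r%:M d : 'rV_(1 + n)) :> 'M[R]_(1 + n).
  rewrite BE Q'T /Q'.
  rewrite !mulmx_block !(mulmx0, mul0mx, mulmx1, mul1mx, addr0, add0r).
  rewrite mulmxA QD; apply/esym; rewrite diag_mx_row; congr block_mx.
  by apply/matrixP => i j; rewrite !mxE !ord1 eqxx.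
by [].
Qed.

End RealSpectral.

(** * Numbers with square sum 1: how many gaps can exceed 1 *)

(*%%A2*)
Section Star.
Variables (R : rcfType) (n : nat) (l : 'I_n -> R).

(** The [l i] will be the eigenvalues of a unit symmetric matrix; a pair matters when its squared
    gap exceeds 1, the squared norm of the matrices it is tested against. *)
Definition excess (i j : 'I_n) : R := Num.max 0 ((l i - l j) ^+ 2 - 1).

Lemma excess_ge0 i j : 0 <= excess i j.
Proof. by rewrite le_max lexx. Qed.

Lemma excess_sym i j : excess i j = excess j i.
Proof. by rewrite /excess -[l i - l j]opprB sqrrN. Qed.

Lemma excess_ii i : excess i i = 0.
Proof. by rewrite /excess subrr expr0n /= max_l // lerBlDr add0r ler01. Qed.

Lemma excess_gt0P i j : excess i j != 0 -> 1 < (l i - l j) ^+ 2.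
Proof.
rewrite ltNge; apply: contra => h.
by rewrite /excess max_l // subr_le0.
Qed.

Lemma ler_sum_uniq (s : seq 'I_n) (F : 'I_n -> R) : uniq s ->
  (forall i, 0 <= F i) -> \sum_(i <- s) F i <= \sum_i F i.
Proof.
move=> us F0; rewrite big_uniq //= [leRHS](bigID (mem s)) /= lerDl.
exact: sumr_ge0.
Qed.

Hypothesis l1 : \sum_i l i ^+ 2 = 1.

(** A squared gap is at most twice the sum of the two squares, so the squared gaps of two disjoint
    pairs add up to at most 2. *)
Lemma excess_disjoint i j k p : uniq [:: i; j; k; p] ->
  excess i j != 0 -> excess k p != 0 -> False.
Proof.
move=> /ler_sum_uniq/(_ (fun i => sqr_ge0 (l i))).
rewrite l1 !big_cons big_nil => h /excess_gt0P h1 /excess_gt0P h2.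
have := sqr_ge0 (l i + l j); have := sqr_ge0 (l k + l p).
by move: h h1 h2; rewrite !expr2 !(mulrDl, mulrDr, mulNr, mulrN, opprD, opprK); lra.
Qed.

(** The three squared gaps add up to three times the sum of squares minus the square of the sum,
    hence to at most 3. *)
Lemma excess_triangle i j k : uniq [:: i; j; k] ->
  excess i j != 0 -> excess j k != 0 -> excess i k != 0 -> False.
Proof.
move=> /ler_sum_uniq/(_ (fun i => sqr_ge0 (l i))).
rewrite l1 !big_cons big_nil => h /excess_gt0P h1 /excess_gt0P h2 /excess_gt0P h3.
have := sqr_ge0 (l i + l j + l k).
by move: h h1 h2 h3; rewrite !expr2 !(mulrDl, mulrDr, mulNr, mulrN, opprD, opprK); lra.
Qed.

Lemma excess_neq i j : excess i j != 0 -> i != j.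
Proof. by apply: contraNneq => ->; rewrite excess_ii. Qed.

(* Two pairs of positive excess always meet, and three of them never form a
   triangle, so all of them share a point. *)
Lemma excess_star : (forall i j, excess i j = 0) \/
  exists i0 j0, excess i0 j0 != 0 /\
    forall i j, excess i j != 0 -> (i == i0) || (j == i0).
Proof.
have [/existsP[i /existsP[j hij]]|none] :=
  boolP [exists i, exists j, excess i j != 0]; last first.
  left=> i j; apply/eqP; move: none => /existsPn/(_ i)/existsPn/(_ j).
  by rewrite negbK.
right; have nij := excess_neq hij.
have [/existsP[a /existsP[b /and3P[hab ai bi]]]|none] :=
  boolP [exists a, exists b, [&& excess a b != 0, a != i & b != i]]; last first.
  exists i, j; split=> // a b hab; rewrite -[_ || _]negbK negb_or.
  apply/negP => h; move/negP: none; apply; apply/existsP; exists a.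
  by apply/existsP; exists b; rewrite hab.
(* A pair avoiding [i] must meet {i, j}, so it contains [j], and [j] becomes the centre. *)
have [k [hjk ki]] : exists k, excess j k != 0 /\ k != i.
  have [aj|aj] := eqVneq a j; first by exists b; rewrite -aj.
  have [bj|bj] := eqVneq b j; first by exists a; rewrite excess_sym -bj.
  exfalso; apply: (@excess_disjoint i j a b) => //.
  by rewrite /= !inE !negb_or nij (eq_sym i) ai (eq_sym i) bi (eq_sym j) aj
       (eq_sym j) bj (excess_neq hab).
exists j, k; split=> // p q hpq; rewrite -[_ || _]negbK negb_or.
apply/negP => /andP[pj qj].
have nk := excess_neq hjk.
(* A pair avoiding [j] forces in the same way a pair {i, r}, which together with {i, j} and {j, k}
   gives a triangle if r = k and two disjoint pairs otherwise. *)
have [r [hir rj]] : exists r, excess i r != 0 /\ r != j.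
  have [pi|pi] := eqVneq p i; first by exists q; rewrite -pi.
  have [qi|qi] := eqVneq q i; first by exists p; rewrite excess_sym -qi.
  exfalso; apply: (@excess_disjoint i j p q) => //.
  by rewrite /= !inE !negb_or nij (eq_sym i) pi (eq_sym i) qi (eq_sym j) pj
       (eq_sym j) qj (excess_neq hpq).
have ri := excess_neq hir.
have [rk|rk] := eqVneq r k.
  apply: (@excess_triangle i j k) => //; last by rewrite -rk.
  by rewrite /= !inE !negb_or nij (eq_sym i) ki nk.
apply: (@excess_disjoint i r j k) => //.
by rewrite /= !inE !negb_or ri nij (eq_sym i) ki rj rk nk.
Qed.

(** Lagrange's identity: the defect in the Cauchy-Schwarz inequality between [l] and the constant 1
    on [J]. *)
Lemma sqr_sum_le (J : {set 'I_n}) :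
  \sum_(i in J) \sum_(j in J) (l i - l j) ^+ 2 =
  2 * (#|J|%:R * \sum_(i in J) l i ^+ 2 - (\sum_(i in J) l i) ^+ 2).
Proof.
under eq_bigr => i _ do under eq_bigr => j _ do rewrite sqrrB.
under eq_bigr => i _ do
  rewrite big_split sumrB /= sumr_const sumrMnl -mulr_sumr.
rewrite big_split sumrB /= sumr_const !sumrMnl -mulr_suml.
have [s sE] : exists s : R, #|J|%:R = s by eexists.
have nE (x : R) : x *+ #|J| = s * x by rewrite -sE mulr_natl.
by rewrite sE !nE -[_ *+ 2]mulr_natl; ring.
Qed.

(** The extremal configuration: a centre, leaves with a common value, total sum zero. The quadratic
    relation on [t] is the normalization of the square sum to 1. *)
Definition star_shape (i0 : 'I_n) (J : {set 'I_n}) (t : R) :=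
  [/\ i0 \notin J, (0 < #|J|)%N, #|J|%:R * (#|J|%:R + 1) * t ^+ 2 = 1 &
   forall i, l i = if i == i0 then #|J|%:R * t else if i \in J then - t else 0].

(** The positive excesses form a star, so the sum runs over the edges from [i0] to [J], each counted
    twice. Then 2 minus the sum is a combination of three nonnegative terms: the squared total of
    the star, the spread [D] of the leaves and the mass [N] off the star. Equality makes all three
    vanish, which is the star shape. *)
Lemma excess_sum : \sum_i \sum_j excess i j <= 2 /\
  (\sum_i \sum_j excess i j = 2 -> exists i0 J t, star_shape i0 J t).
Proof.
case: excess_star => [none|[i0 [j0 [h0 star]]]].
  rewrite big1; last by move=> i _; rewrite big1.
  by split; [rewrite ler0n|move/eqP; rewrite eq_sym pnatr_eq0].
pose J := [set j | excess i0 j != 0].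
have iJ : i0 \notin J by rewrite inE excess_ii eqxx.
have J0 : (0 < #|J|)%N by apply/card_gt0P; exists j0; rewrite inE.
have -> : \sum_i \sum_j excess i j = 2 * \sum_j excess i0 j.
  rewrite (bigD1 i0) //= mulr_natl mulr2n; congr (_ + _).
  rewrite [RHS](bigD1 i0) //= excess_ii add0r; apply: eq_bigr => i ii0.
  rewrite (bigD1 i0) //= big1 ?addr0 1?excess_sym // => j ji0.
  by apply/eqP; apply: contraTT ji0 => /star; rewrite (negbTE ii0) /= negbK.
have -> : \sum_j excess i0 j = \sum_(j in J) ((l i0 - l j) ^+ 2 - 1).
  rewrite (bigID (mem J)) /= [X in _ + X]big1 ?addr0 => [|j]; last first.
    by rewrite inE negbK => /eqP.
  apply: eq_bigr => j; rewrite inE => /excess_gt0P h.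
  by rewrite /excess max_r // subr_ge0 ltW.
under eq_bigr => j _ do rewrite sqrrB.
rewrite sumrB big_split sumrB /= !sumr_const sumrMnl -mulr_sumr.
have := sqr_sum_le J.
set D := \sum_(i in J) \sum_(j in J) _.
have D0 : 0 <= D by apply: sumr_ge0 => i _; apply: sumr_ge0 => j _; exact: sqr_ge0.
set S2 := (\sum_(i in J) l i ^+ 2); set S1 := \sum_(i in J) l i => DE.
pose N := \sum_(i | (i != i0) && (i \notin J)) l i ^+ 2.
have N0 : 0 <= N by apply: sumr_ge0 => i _; exact: sqr_ge0.
have tot : l i0 ^+ 2 + S2 + N = 1.
  rewrite -l1 (bigD1 i0) //= (bigID (mem J)) /= addrA; congr (_ + _ + _).
  apply: eq_bigl => i; case: eqVneq => //= ->; exact/negbTE.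
have [s sE] : exists s : R, #|J|%:R = s by eexists.
have nE (x : R) : x *+ #|J| = s * x by rewrite -sE mulr_natl.
have s0 : 0 < s by rewrite -sE ltr0n.
have key : 2 * (l i0 ^+ 2 *+ #|J| - (l i0 * S1) *+ 2 + S2 - 1 *+ #|J|)
  = 2 - (2 * (l i0 + S1) ^+ 2 + D + 2 * (s + 1) * N).
  have -> : N = 1 - l i0 ^+ 2 - S2 by rewrite -tot; ring.
  by rewrite DE sE !nE; ring.
rewrite key.
have q0 := sqr_ge0 (l i0 + S1).
have sN : 0 <= 2 * (s + 1) * N by rewrite !mulr_ge0 // addr_ge0 // ltW.
split=> [|eq2]; first by rewrite lerBlDr lerDl !addr_ge0 // mulr_ge0.
have [e1 e2 e3] : [/\ l i0 + S1 = 0, D = 0 & N = 0].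
  have hq : (l i0 + S1) ^+ 2 = 0 by lra.
  have hN : 2 * (s + 1) * N = 0 by lra.
  split; last 2 first; first by lra.
    move/eqP: hN; rewrite !mulf_eq0 pnatr_eq0 /= => /orP[|/eqP//].
    by rewrite gt_eqF // addr_gt0.
  by apply/eqP; rewrite -sqrf_eq0 hq.
exists i0, J, (l i0 / s).
have lJ j : j \in J -> l j = - (l i0 / s).
  move=> jJ.
  have lc i : i \in J -> l i = l j.
    move=> iJ'; move/eqP: e2; rewrite psumr_eq0 => [/allP/(_ i)|k _]; last first.
      by apply: sumr_ge0 => ? _; exact: sqr_ge0.
    rewrite mem_index_enum iJ' /= => /(_ isT).
    rewrite psumr_eq0 => [/allP/(_ j)|k _]; last exact: sqr_ge0.
    rewrite mem_index_enum jJ /= => /(_ isT).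
    by rewrite sqrf_eq0 subr_eq0 => /eqP.
  have S1E : S1 = s * l j.
    by rewrite /S1 (eq_bigr (fun=> l j)) // sumr_const nE.
  have -> : l i0 = - (s * l j) by move: e1; rewrite S1E; lra.
  by rewrite mulNr opprK mulrC mulKf // gt_eqF.
have lN i : i != i0 -> i \notin J -> l i = 0.
  move=> ii0 iJ'; move/eqP: e3; rewrite psumr_eq0 => [/allP/(_ i)|k _]; last first.
    exact: sqr_ge0.
  by rewrite mem_index_enum ii0 iJ' /= sqrf_eq0 => /(_ isT)/eqP.
split=> //.
  have S2E : S2 = s * (l i0 / s) ^+ 2.
    rewrite /S2 (eq_bigr (fun=> (l i0 / s) ^+ 2)) ?sumr_const ?nE //.
    by move=> j /lJ ->; rewrite sqrrN.
  rewrite sE; apply: (etrans _ tot); rewrite e3 S2E addr0; field.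
  by rewrite gt_eqF.
move=> i; case: eqVneq => [->|ii0]; first by rewrite sE mulrCA mulfV ?mulr1 // gt_eqF.
by case: ifPn => [/lJ//|]; exact: lN.
Qed.

End Star.

(** * Frobenius product and one row of the commutator inequality *)

(*%%A3*)
Section FrobeniusProduct.
Variables (R : rcfType) (n : nat).
Implicit Types A B P : 'M[R]_n.

Definition dotm A B : R := \sum_i \sum_j A i j * B i j.

Definition commutator A B := A *m B - B *m A.

Lemma dotmC A B : dotm A B = dotm B A.
Proof. by apply: eq_bigr => i _; apply: eq_bigr => j _; rewrite mulrC. Qed.

Lemma dotm_tr A B : dotm A B = \tr (A *m B^T).
Proof.
rewrite /dotm /mxtrace; apply: eq_bigr => i _; rewrite mxE.
by apply: eq_bigr => j _; rewrite mxE.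
Qed.

Lemma dotm_ge0 A : 0 <= dotm A A.
Proof. by do 2!apply: sumr_ge0 => ? _; rewrite -expr2 sqr_ge0. Qed.

Lemma dotmDl A B C : dotm (A + B) C = dotm A C + dotm B C.
Proof. by rewrite !dotm_tr mulmxDl mxtraceD. Qed.

Lemma dotmZl c A B : dotm (c *: A) B = c * dotm A B.
Proof. by rewrite !dotm_tr -scalemxAl mxtraceZ. Qed.

Lemma dotm0l B : dotm 0 B = 0.
Proof. by rewrite /dotm big1 // => i _; rewrite big1 // => j _; rewrite mxE mul0r. Qed.

Lemma dotmDr A B C : dotm A (B + C) = dotm A B + dotm A C.
Proof. by rewrite dotmC dotmDl !(dotmC _ A). Qed.

Lemma dotmZr c A B : dotm A (c *: B) = c * dotm A B.
Proof. by rewrite dotmC dotmZl dotmC. Qed.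

Lemma dotm_suml (I : finType) (F : I -> 'M[R]_n) B :
  dotm (\sum_i F i) B = \sum_i dotm (F i) B.
Proof.
rewrite dotm_tr mulmx_suml raddf_sum.
by apply: eq_bigr => i _; rewrite dotm_tr.
Qed.

Lemma dotm_eq0 A : dotm A A = 0 -> A = 0.
Proof.
move=> /eqP; rewrite psumr_eq0 => [/allP h|i _]; last first.
  by apply: sumr_ge0 => j _; rewrite -expr2 sqr_ge0.
apply/matrixP => i j; have := h i (mem_index_enum i).
rewrite psumr_eq0 => [/allP/(_ j (mem_index_enum j))|k _]; last first.
  by rewrite -expr2 sqr_ge0.
by rewrite /= mulf_eq0 orbb mxE => /eqP.
Qed.

Lemma dotm_conj P A B : P *m P^T = 1%:M ->
  dotm (P *m A *m P^T) (P *m B *m P^T) = dotm A B.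
Proof.
move=> PP; have PP' := mulmx1C PP.
rewrite !dotm_tr !trmx_mul trmxK -!mulmxA (mulmxA P^T P) PP' mul1mx.
by rewrite mxtrace_mulC -!mulmxA PP' mulmx1.
Qed.

Lemma commutator_conj P A B : P *m P^T = 1%:M ->
  commutator (P *m A *m P^T) (P *m B *m P^T) = P *m commutator A B *m P^T.
Proof.
move=> PP; have PP' := mulmx1C PP.
rewrite /commutator mulmxBr mulmxBl -!mulmxA.
by rewrite !(mulmxA P^T P) PP' !mul1mx.
Qed.

Lemma dotm_commutator_diag (l : 'rV[R]_n) B :
  dotm (commutator (diag_mx l) B) (commutator (diag_mx l) B) =
  \sum_i \sum_j (l 0 i - l 0 j) ^+ 2 * B i j ^+ 2.
Proof.
apply: eq_bigr => i _; apply: eq_bigr => j _.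
rewrite /commutator mul_diag_mx mul_mx_diag !mxE -expr2 -exprMn.
by congr (_ ^+ 2); ring.
Qed.

Lemma dotm_delta A i j : dotm A (delta_mx i j) = A i j.
Proof.
rewrite /dotm (bigD1 i) //= (bigD1 j) //= mxE !eqxx mulr1 !big1 ?addr0 //.
  move=> k ki; rewrite big1 // => p _; rewrite mxE (negbTE ki) mulr0 //.
by move=> k kj; rewrite mxE (negbTE kj) andbF mulr0.
Qed.

End FrobeniusProduct.

Section OrthonormalFamily.
Variables (R : rcfType) (n m : nat) (b : 'I_m -> 'M[R]_n) (nu : 'I_m -> bool).
Hypothesis b_sym : forall a, (b a)^T = b a.
Hypothesis b_orth : forall a d, dotm (b a) (b d) = ((a == d) && nu a)%:R.

(** [V] is the projection of [E] on the family, and |E - V|^2 >= 0. Members flagged by [nu] are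
    unit, the others are zero, so that the family may be padded with zeros. *)
Lemma bessel E : \sum_d dotm (b d) E ^+ 2 <= dotm E E.
Proof.
pose V := \sum_d dotm (b d) E *: b d.
have bV d : dotm (b d) V = (nu d)%:R * dotm (b d) E.
  rewrite dotmC dotm_suml (bigD1 d) //= big1 ?addr0.
    by rewrite dotmZl b_orth eqxx mulrC.
  by move=> e ed; rewrite dotmZl b_orth (negbTE ed) mulr0.
have nuE d : (nu d)%:R * dotm (b d) E = dotm (b d) E.
  case: (boolP (nu d)) => nd; rewrite ?mul1r // mul0r.
  have /dotm_eq0 -> : dotm (b d) (b d) = 0 by rewrite b_orth eqxx (negbTE nd).
  by rewrite dotm0l.
have VE X : dotm V X = \sum_d dotm (b d) E * dotm (b d) X.
  by rewrite dotm_suml; apply: eq_bigr => d _; rewrite dotmZl.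
have VV : dotm V V = \sum_d dotm (b d) E ^+ 2.
  by rewrite VE; apply: eq_bigr => d _; rewrite bV nuE.
have VE' : dotm V E = \sum_d dotm (b d) E ^+ 2 by rewrite VE.
have := dotm_ge0 (E - V).
have -> : dotm (E - V) (E - V) = dotm E E - 2 * dotm V E + dotm V V.
  rewrite -scaleN1r dotmDl dotmZl !(dotmC _ (E + _)) !dotmDl !dotmZl.
  by rewrite (dotmC E V); ring.
by rewrite VV VE'; lra.
Qed.

(** The test matrix is half of E_ij + E_ji, of squared norm 1/2; its product with a symmetric matrix
    is the (i, j) entry. *)
Lemma bessel_entry i j : i != j -> \sum_d b d i j ^+ 2 <= 2^-1.
Proof.
move=> ij; have := bessel (2^-1 *: (delta_mx i j + delta_mx j i)).
rewrite (eq_bigr (fun d => b d i j ^+ 2)); last first.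
  move=> d _; rewrite dotmC dotmZl dotmDl !(dotmC _ (b d)) !dotm_delta.
  by rewrite -[b d in X in _ * (_ + X)]b_sym mxE; congr (_ ^+ 2); field.
move/le_trans; apply.
rewrite dotmZl dotmC dotmZl dotmDl !(dotmC (delta_mx _ _)) !dotm_delta !mxE.
by rewrite !eqxx (eq_sym j) (negbTE ij) /=; lra.
Qed.

End OrthonormalFamily.

Section DiagonalRow.
Variables (R : rcfType) (n m : nat) (b : 'I_m -> 'M[R]_n) (nu : 'I_m -> bool).
Hypothesis b_sym : forall a, (b a)^T = b a.
Hypothesis b_orth : forall a d, dotm (b a) (b d) = ((a == d) && nu a)%:R.

Definition comm_norm (a d : 'I_m) : R :=
  dotm (commutator (b a) (b d)) (commutator (b a) (b d)).

Variables (l : 'rV[R]_n) (a : 'I_m).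
Hypothesis ba : b a = diag_mx l.
Hypothesis nua : nu a.

Let c d := comm_norm a d.
Let ll i := l 0 i.

Lemma comm_norm_diagE d :
  c d = \sum_i \sum_j (l 0 i - l 0 j) ^+ 2 * b d i j ^+ 2.
Proof. by rewrite /c /comm_norm ba dotm_commutator_diag. Qed.

Lemma diag_norm1 : \sum_i ll i ^+ 2 = 1.
Proof.
have := b_orth a a; rewrite eqxx nua /= mulr1n => <-.
apply: eq_bigr => i _; rewrite (bigD1 i) //= big1 ?addr0 ba.
  by rewrite !mxE eqxx mulr1n expr2.
by move=> j ji; rewrite !mxE eq_sym (negbTE ji) mulr0n mul0r.
Qed.

Lemma comm_norm_gt1_nu d : 1 < c d -> nu d.
Proof.
apply: contraLR => nd; rewrite -leNgt.
have /dotm_eq0 bd0 : dotm (b d) (b d) = 0 by rewrite b_orth eqxx (negbTE nd).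
rewrite comm_norm_diagE bd0 big1 ?ler01 // => i _; rewrite big1 // => j _.
by rewrite mxE expr0n mulr0.
Qed.

(** A commutator norm above 1 forces [b d] to be a unit matrix, so the subtracted 1 can be spread
    over its squared entries. *)
Lemma comm_norm_excess d : 1 < c d -> c d - 1 =
  \sum_i \sum_j ((l 0 i - l 0 j) ^+ 2 - 1) * b d i j ^+ 2.
Proof.
move=> /comm_norm_gt1_nu nd.
have bd1 : dotm (b d) (b d) = 1 by rewrite b_orth eqxx nd.
rewrite -[X in _ - X = _]bd1 comm_norm_diagE /dotm -sumrB; apply: eq_bigr => i _.
by rewrite -sumrB; apply: eq_bigr => j _; ring.
Qed.

(** What is left in [bessel_entry] once only the members with commutator norm above 1 are kept. *)
Let defect i j := 2^-1 - \sum_(d | 1 < c d) b d i j ^+ 2.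

Lemma defect_ge0 i j : i != j -> 0 <= defect i j.
Proof.
move=> ij; rewrite subr_ge0; apply: le_trans (bessel_entry b_sym b_orth ij).
rewrite [leRHS](bigID (fun d => 1 < c d)) /= lerDl.
by apply: sumr_ge0 => d _; exact: sqr_ge0.
Qed.

(* Each difference between the two sides is a sum of nonnegative terms, which
   are listed so that the equality case can be read off. *)
Lemma excess_row :
  1 - \sum_d Num.max 0 (c d - 1) =
  (1 - 2^-1 * \sum_i \sum_j excess ll i j)
  + \sum_i \sum_j excess ll i j * defect i j
  + \sum_(d | 1 < c d) \sum_i \sum_j
      (excess ll i j - ((ll i - ll j) ^+ 2 - 1)) * b d i j ^+ 2.
Proof.
have -> : \sum_d Num.max 0 (c d - 1) = \sum_(d | 1 < c d) (c d - 1).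
  rewrite (bigID (fun d => 1 < c d)) /= [X in _ + X]big1 ?addr0.
    by apply: eq_bigr => d h; rewrite max_r // subr_ge0 ltW.
  by move=> d; rewrite -leNgt => h; rewrite max_l // subr_le0.
rewrite (eq_bigr _ comm_norm_excess).
rewrite [X in _ + _ + X](eq_bigr (fun d =>
  \sum_i \sum_j excess ll i j * b d i j ^+ 2 -
  \sum_i \sum_j ((ll i - ll j) ^+ 2 - 1) * b d i j ^+ 2)); last first.
  move=> d _; rewrite -sumrB; apply: eq_bigr => i _; rewrite -sumrB.
  by apply: eq_bigr => j _; rewrite mulrBl.
rewrite sumrB.
have -> : \sum_i \sum_j excess ll i j * defect i j =
  2^-1 * (\sum_i \sum_j excess ll i j) -
  \sum_(d | 1 < c d) \sum_i \sum_j excess ll i j * b d i j ^+ 2.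
  rewrite [X in _ - X]exchange_big mulr_sumr -sumrB; apply: eq_bigr => i _.
  rewrite [X in _ - X]exchange_big mulr_sumr -sumrB; apply: eq_bigr => j _ /=.
  by rewrite /defect mulrBr mulr_sumr mulrC.
by rewrite /ll; ring.
Qed.

Let slack_ge0 i j : 0 <= excess ll i j - ((ll i - ll j) ^+ 2 - 1).
Proof. by rewrite subr_ge0 le_max lexx orbT. Qed.

Let excess_defect_ge0 i j : 0 <= excess ll i j * defect i j.
Proof.
have [->|ij] := eqVneq i j; first by rewrite excess_ii mul0r.
by rewrite mulr_ge0 ?excess_ge0 ?defect_ge0.
Qed.

(** The three groups in [excess_row] are nonnegative by [excess_sum], by Bessel and by definition of
    the positive part. This bound is the core of the DDVV inequality. *)
Lemma excess_row_le1 : \sum_d Num.max 0 (c d - 1) <= 1.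
Proof.
rewrite -subr_ge0 excess_row; apply: addr_ge0; first apply: addr_ge0.
- by have [h _] := excess_sum diag_norm1; rewrite subr_ge0 ler_pdivrMl ?mulr1.
- by do 2!apply: sumr_ge0 => ? _; exact: excess_defect_ge0.
- by do 3!apply: sumr_ge0 => ? _; rewrite mulr_ge0 ?sqr_ge0.
Qed.

(** The three groups vanish separately: the first gives the star, the second saturates Bessel at the
    edges of the star, and the third kills each entry whose squared gap is below 1. *)
Lemma excess_row_eq1 : \sum_d Num.max 0 (c d - 1) = 1 ->
  exists i0 J t,
  [/\ star_shape ll i0 J t,
      forall j, j \in J -> \sum_(d | 1 < c d) b d i0 j ^+ 2 = 2^-1 &
      forall d i j, 1 < c d -> (ll i - ll j) ^+ 2 < 1 -> b d i j = 0].
Proof.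
move=> e1.
have := excess_row; rewrite e1 subrr => /esym.
have [h1 star] := excess_sum diag_norm1.
set X := 1 - _; set Y := \sum_i _; set Z := \sum_(d | _) _ => XYZ.
have X0 : 0 <= X by rewrite /X subr_ge0 ler_pdivrMl ?mulr1.
have Y0 : 0 <= Y by do 2!apply: sumr_ge0 => ? _; exact: excess_defect_ge0.
have Z0 : 0 <= Z by do 3!apply: sumr_ge0 => ? _; rewrite mulr_ge0 ?sqr_ge0.
have {}X0 : X = 0 by lra.
have {}Y0 : Y = 0 by lra.
have {}Z0 : Z = 0 by lra.
have [|i0 [J [t st]]] := star; first by move: X0; rewrite /X; set S := \sum_i _; lra.
exists i0, J, t; split=> //.
  move=> j jJ.
  have e0 : excess ll i0 j != 0.
    case: st => iJ s0 st lE; rewrite /excess !lE eqxx jJ.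
    have -> : (j == i0) = false by apply: contraNF iJ => /eqP <-.
    set s := #|J|%:R in st *.
    have s1 : 0 < s by rewrite ltr0n.
    (* By the normalization of [t] the squared gap along an edge of the star is 1 + (s + 1) t^2. *)
    have st2 : 1 < (s * t - - t) ^+ 2.
      have -> : (s * t - - t) ^+ 2 = (s * (s + 1) * t ^+ 2) + (s + 1) * t ^+ 2.
        by ring.
      rewrite st ltrDl mulr_gt0 ?addr_gt0 // lt_def sqr_ge0 andbT.
      by apply: contra_eq_neq st => ->; rewrite mulr0 eq_sym oner_eq0.
    by rewrite max_r ?subr_ge0 ?ltW // subr_eq0 gt_eqF.
  have : excess ll i0 j * defect i0 j = 0.
    move/eqP: Y0; rewrite psumr_eq0 => [/allP/(_ i0 (mem_index_enum _))|i _].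
      rewrite psumr_eq0 => [/allP/(_ j (mem_index_enum _))/eqP //|k _].
      exact: excess_defect_ge0.
    by apply: sumr_ge0 => ? _; exact: excess_defect_ge0.
  move/eqP; rewrite mulf_eq0 (negbTE e0) /= subr_eq0 => /eqP -> //.
move=> d i j cd lij.
have : (excess ll i j - ((ll i - ll j) ^+ 2 - 1)) * b d i j ^+ 2 = 0.
  move/eqP: Z0; rewrite psumr_eq0 => [/allP/(_ d (mem_index_enum _))|k _].
    rewrite cd /= psumr_eq0 => [/allP/(_ i (mem_index_enum _))|k _].
      rewrite psumr_eq0 => [/allP/(_ j (mem_index_enum _))/eqP //|k _].
      by rewrite mulr_ge0 ?sqr_ge0.
    by apply: sumr_ge0 => ? _; rewrite mulr_ge0 ?sqr_ge0.
  by do 2!apply: sumr_ge0 => ? _; rewrite mulr_ge0 ?sqr_ge0.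
move/eqP; rewrite mulf_eq0 => /orP[|]; last by rewrite sqrf_eq0 => /eqP.
have := excess_ge0 ll i j; move: lij; set u := (_ - _) ^+ 2; set v := excess _ _ _.
by move=> hu hv /eqP; lra.
Qed.

End DiagonalRow.

(** * Equality in the weighted commutator inequality *)

(*%%A4*)
Section NormalizedEquality.
Variables (R : rcfType) (n m : nat) (b : 'I_m -> 'M[R]_n) (nu : 'I_m -> bool).
Hypothesis b_sym : forall a, (b a)^T = b a.
Hypothesis b_orth : forall a d, dotm (b a) (b d) = ((a == d) && nu a)%:R.

Let c := comm_norm b.

Lemma comm_norm_sym a d : c a d = c d a.
Proof.
rewrite /c /comm_norm; have -> : commutator (b a) (b d) = -1 *: commutator (b d) (b a).
  by rewrite scaleN1r opprB.
by rewrite dotmZl dotmC dotmZl mulrA mulrNN !mul1r.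
Qed.

Lemma comm_norm_refl a : c a a = 0.
Proof.
rewrite /c /comm_norm /commutator subrr.
by rewrite dotm0l.
Qed.

Lemma diagonalize_at a : exists (P : 'M[R]_n) (l : 'rV[R]_n),
  let b' d := P *m b d *m P^T in
  [/\ P *m P^T = 1%:M, b' a = diag_mx l, forall d, (b' d)^T = b' d,
      forall e d, dotm (b' e) (b' d) = ((e == d) && nu e)%:R &
      forall e d, comm_norm b' e d = c e d].
Proof.
have [P [l [PP Pl]]] := symmetric_diagonalization (b_sym a).
exists P, l; split=> // [d|e d|e d]; first by rewrite !trmx_mul trmxK b_sym mulmxA.
  by rewrite dotm_conj.
by rewrite /comm_norm commutator_conj // dotm_conj.
Qed.

Lemma comm_norm_row_le1 a : nu a -> \sum_d Num.max 0 (c a d - 1) <= 1.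
Proof.
move=> nua; have [P [l [PP ba s o cE]]] := diagonalize_at a.
under eq_bigr => d _ do rewrite -cE.
exact: (excess_row_le1 s o ba nua).
Qed.

Variable x : 'I_m -> R.
Hypothesis x_ge0 : forall a, 0 <= x a.
Hypothesis x_nu : forall a, x a != 0 -> nu a.
Hypothesis equality : \sum_a \sum_d x a * x d * c a d = (\sum_a x a) ^+ 2.

Let dd a d := Num.max 0 (c a d - 1).
Let mm a d := if a == d then 0 else Num.max 0 (1 - c a d).

(** Write c = 1 + (c - 1)^+ - (1 - c)^+ off the diagonal, and replace x_a x_d by half of x_a^2 +
    x_d^2 - (x_a - x_d)^2 in front of the first positive part. The difference of the two sides of
    the inequality becomes a sum of [A] (slack in the row bound), [B] (commutators that are too
    small) and [C] (unequal weights), all nonnegative. Equality makes every term vanish. *)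
Lemma equality_terms :
  [/\ forall a, x a != 0 -> \sum_d dd a d = 1,
      forall a d, x a != 0 -> x d != 0 -> a != d -> 1 <= c a d &
      forall a d, 1 < c a d -> x a = x d].
Proof.
have dd0 a d : 0 <= dd a d by rewrite le_max lexx.
have mm0 a d : 0 <= mm a d by rewrite /mm; case: eqP => // _; rewrite le_max lexx.
have ddC a d : dd a d = dd d a by rewrite /dd comm_norm_sym.
have cE a d : c a d = 1 - (a == d)%:R + dd a d - mm a d.
  rewrite /dd /mm; case: eqVneq => [->|ad].
    by rewrite comm_norm_refl max_l; [rewrite /= mulr1n; ring|rewrite sub0r oppr_le0 ler01].
  rewrite /= mulr0n subr0; have [h|h] := lerP (c a d) 1.
    by rewrite max_l ?subr_le0 // max_r ?subr_ge0 //; ring.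
  by rewrite max_r ?subr_ge0 ?ltW // max_l ?subr_le0 ?ltW //; ring.
pose A a := x a ^+ 2 * (1 - \sum_d dd a d).
pose B a d := x a * x d * mm a d.
pose C a d := 2^-1 * (dd a d * (x a - x d) ^+ 2).
have A0 a : 0 <= A a.
  rewrite /A; have [->|xa] := eqVneq (x a) 0; first by rewrite expr0n mul0r.
  by rewrite mulr_ge0 ?sqr_ge0 // subr_ge0 comm_norm_row_le1 // x_nu.
have B0 a d : 0 <= B a d by apply: mulr_ge0 => //; apply: mulr_ge0.
have C0 a d : 0 <= C a d by rewrite mulr_ge0 ?invr_ge0 ?ler0n // mulr_ge0 ?sqr_ge0.
have sumE : \sum_a A a + \sum_a \sum_d B a d + \sum_a \sum_d C a d = 0.
  have sqE : \sum_a \sum_d x a * x d = (\sum_a x a) ^+ 2.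
    rewrite expr2 mulr_suml; apply: eq_bigr => a _.
    by rewrite mulr_sumr.
  have diag : \sum_a \sum_d x a * x d * (a == d)%:R = \sum_a x a ^+ 2.
    apply: eq_bigr => a _; rewrite (bigD1 a) //= eqxx mulr1 big1 ?addr0 ?expr2 //.
    by move=> d da; rewrite eq_sym (negbTE da) mulr0.
  have AE : \sum_a A a = \sum_a x a ^+ 2 - \sum_a \sum_d x a ^+ 2 * dd a d.
    rewrite -sumrB; apply: eq_bigr => a _.
    by rewrite /A mulrBr mulr1 mulr_sumr.
  have CE : \sum_a \sum_d C a d =
      \sum_a \sum_d x a ^+ 2 * dd a d - \sum_a \sum_d x a * x d * dd a d.
    have h : \sum_a \sum_d x d ^+ 2 * dd a d = \sum_a \sum_d x a ^+ 2 * dd a d.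
      rewrite exchange_big; apply: eq_bigr => a _; apply: eq_bigr => d _.
      by rewrite ddC.
    have -> : \sum_a \sum_d C a d = 2^-1 * (\sum_a \sum_d x a ^+ 2 * dd a d
        + \sum_a \sum_d x d ^+ 2 * dd a d) - \sum_a \sum_d x a * x d * dd a d.
      rewrite -big_split mulr_sumr -sumrB; apply: eq_bigr => a _.
      rewrite -big_split mulr_sumr -sumrB; apply: eq_bigr => d _ /=.
      by rewrite /C; field.
    by rewrite h; field.
  have eqE : \sum_a \sum_d x a * x d * c a d = \sum_a \sum_d x a * x d
     - \sum_a \sum_d x a * x d * (a == d)%:R
     + \sum_a \sum_d x a * x d * dd a d - \sum_a \sum_d B a d.
    rewrite -sumrB -big_split -sumrB; apply: eq_bigr => a _ /=.
    rewrite -sumrB -big_split -sumrB; apply: eq_bigr => d _ /=.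
    by rewrite cE /B; ring.
  by move: eqE; rewrite equality sqE diag AE CE; lra.
have SA : 0 <= \sum_a A a by apply: sumr_ge0.
have SB : 0 <= \sum_a \sum_d B a d by do 2!apply: sumr_ge0 => ? _.
have SC : 0 <= \sum_a \sum_d C a d by do 2!apply: sumr_ge0 => ? _.
have A1 a : A a = 0.
  have /eqP : \sum_a A a = 0 by lra.
  by rewrite psumr_eq0 // => /allP/(_ a (mem_index_enum a))/eqP.
have sum2 (F : 'I_m -> 'I_m -> R) : (forall a d, 0 <= F a d) ->
    \sum_a \sum_d F a d = 0 -> forall a d, F a d = 0.
  move=> F0 /eqP + a d; rewrite psumr_eq0 => [/allP/(_ a (mem_index_enum a))|? _].
    by rewrite psumr_eq0 // => /allP/(_ d (mem_index_enum d))/eqP.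
  exact: sumr_ge0.
have B1 := sum2 _ B0 (_ : _ = 0); have C1 := sum2 _ C0 (_ : _ = 0).
split=> [a xa|a d xa xd ad|a d cad].
- move/eqP: (A1 a); rewrite /A mulf_eq0 sqrf_eq0 (negbTE xa) subr_eq0 /=.
  by move/eqP.
- have /eqP := B1 (ltac:(lra)) a d.
  rewrite /B !mulf_eq0 (negbTE xa) (negbTE xd) /= /mm (negbTE ad).
  by apply: contraTT; rewrite -ltNge => h; rewrite max_r ?subr_ge0 ?ltW // subr_eq0 gt_eqF.
- have /eqP := C1 (ltac:(lra)) a d.
  rewrite /C mulf_eq0 invr_eq0 pnatr_eq0 /= mulf_eq0 sqrf_eq0 subr_eq0 => /orP[|/eqP//].
  by rewrite /dd max_r ?subr_ge0 ?ltW // subr_eq0 gt_eqF.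
Qed.

(** Both matrices live on the row and column [i0], with vectors v, w that are orthogonal and of
    squared norm 1/2. Their commutator is v^T w - w^T v, of squared norm 2 |v|^2 |w|^2. The value
    1/2 is too small for two members of positive weight. *)
Lemma comm_norm_spoke (P : 'M[R]_n) (i0 : 'I_n) (d e : 'I_m) (v w : 'rV[R]_n) :
  let b' d := P *m b d *m P^T in
  let E : 'rV[R]_n := delta_mx 0 i0 in
  P *m P^T = 1%:M -> v 0 i0 = 0 -> w 0 i0 = 0 -> nu d -> nu e -> d != e ->
  b' d = E^T *m v + v^T *m E -> b' e = E^T *m w + w^T *m E ->
  c d e = 2^-1.
Proof.
move=> b' E PP v0 w0 nd ne de bd be.
have EvT (u : 'rV[R]_n) : E *m u^T = (u 0 i0)%:M.
  by rewrite [LHS]mx11_scalar /E -rowE !mxE.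
have vET (u : 'rV[R]_n) : u *m E^T = (u 0 i0)%:M.
  by rewrite -[LHS]trmxK trmx_mul trmxK EvT tr_scalar_mx.
have E1 : E 0 i0 = 1 by rewrite mxE !eqxx.
have uv (u u' : 'rV[R]_n) : u *m u'^T = (dotv u u')%:M by rewrite [LHS]mx11_scalar.
have dotmE (u u' t t' : 'rV[R]_n) :
    dotm (u^T *m u') (t^T *m t') = dotv u t * dotv u' t'.
  rewrite dotm_tr trmx_mul trmxK -mulmxA (mulmxA u') uv mul_scalar_mx.
  by rewrite -scalemxAr mxtraceZ mxtrace_mulC uv mxtrace_scalar (dotvC u) mulrC.
have prod (u u' : 'rV[R]_n) : u 0 i0 = 0 -> u' 0 i0 = 0 ->
   (E^T *m u + u^T *m E) *m (E^T *m u' + u'^T *m E)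
   = dotv u u' *: (E^T *m E) + u^T *m u'.
  move=> u0 u'0; rewrite mulmxDl !mulmxDr -!mulmxA.
  rewrite (mulmxA u) vET u0 (mulmxA u) uv (mulmxA E) vET E1 (mulmxA E u'^T) EvT u'0.
  rewrite !mul_scalar_mx !scale0r scale1r !mulmx0 -scalemxAr.
  by rewrite add0r addr0.
have dot_b (u u' : 'rV[R]_n) : u 0 i0 = 0 -> u' 0 i0 = 0 ->
   dotm (E^T *m u + u^T *m E) (E^T *m u' + u'^T *m E) = 2 * dotv u u'.
  move=> u0 u'0; rewrite !dotmDl !dotmDr !dotmE.
  have -> : dotv E E = 1 by rewrite /dotv vET E1 mxE.
  have -> : dotv E u' = 0 by rewrite /dotv EvT u'0 mxE mul0rn.
  have -> : dotv u E = 0 by rewrite /dotv vET u0 mxE mul0rn.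
  by ring.
have vv : dotv v v = 2^-1.
  have := dot_b _ _ v0 v0; rewrite -bd /b' dotm_conj // b_orth eqxx nd /=.
  by move=> h; lra.
have ww : dotv w w = 2^-1.
  have := dot_b _ _ w0 w0; rewrite -be /b' dotm_conj // b_orth eqxx ne /=.
  by move=> h; lra.
have vw : dotv v w = 0.
  have := dot_b _ _ v0 w0; rewrite -bd -be /b' dotm_conj // b_orth (negbTE de) /=.
  by move=> h; lra.
have -> : c d e = dotm (commutator (b' d) (b' e)) (commutator (b' d) (b' e)).
  by rewrite commutator_conj // dotm_conj.
rewrite /commutator bd be !prod // (dotvC w) vw !scale0r !add0r.
rewrite -scaleN1r !(dotmDl, dotmZl) !(dotmDr, dotmZr) !dotmE.
by rewrite vv ww vw (dotvC w) vw; field.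
Qed.

(** Off the edges of the star the gaps are, up to sign, 0, t and s t, and s (s + 1) t^2 = 1 with s
    >= 1 makes their squares less than 1. *)
Lemma star_gap_lt1 (l : 'I_n -> R) i0 (J : {set 'I_n}) t i j :
  star_shape l i0 J t -> ~~ ((i == i0) && (j \in J)) ->
  ~~ ((j == i0) && (i \in J)) -> (l i - l j) ^+ 2 < 1.
Proof.
case=> iJ; set s := #|J|%:R; rewrite -(ler1n R).
rewrite -/s => s1 st lE ij ji.
have t0 : 0 < t ^+ 2.
  rewrite lt_def sqr_ge0 andbT; apply: contra_eq_neq st => ->.
  by rewrite mulr0 eq_sym oner_eq0.
have t1 : t ^+ 2 < 1 by nra.
have st1 : (s * t) ^+ 2 < 1 by rewrite exprMn; nra.
have nJ k : k \in J -> (k == i0) = false by move=> kJ; apply: contraNF iJ => /eqP <-.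
rewrite !lE; case: (eqVneq i i0) ij ji => [->|ii0]; case: (eqVneq j i0) => [->|ji0] /=;
  rewrite ?(negbTE iJ) //= => ij ji.
- by rewrite subrr expr0n ltr01.
- by rewrite (negbTE ij) subr0.
- by rewrite (negbTE ji) sub0r sqrrN.
- by case: (i \in J); case: (j \in J); rewrite ?subrr ?expr0n ?subr0 ?sub0r ?opprK ?sqrrN ?ltr01.
Qed.

(** A member [a] of positive weight has total excess 1, so some [d] has commutator norm above 1 with
    it, and by [excess_row_eq1] such a [b d] lives on the row and column of the centre. Uniqueness
    of [d] makes one matrix saturate Bessel on every edge, which leaves a single edge; orthogonality
    to [b d] then excludes any third member. *)
Lemma equality_shape a : x a != 0 ->
  exists (d : 'I_m) (P : 'M[R]_n) (i0 j0 : 'I_n) (t e : R),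
  [/\ [/\ a != d, P *m P^T = 1%:M & i0 != j0],
      t ^+ 2 = 2^-1 /\ e ^+ 2 = 2^-1,
      x d = x a /\ (forall f, f != a -> f != d -> x f = 0),
      P *m b a *m P^T = t *: (delta_mx i0 i0 - delta_mx j0 j0) &
      P *m b d *m P^T = e *: (delta_mx i0 j0 + delta_mx j0 i0)].
Proof.
move=> xa; have [row1 c1 xE] := equality_terms.
have nua := x_nu xa.
have [P [l [PP ba s o cE]]] := diagonalize_at a.
have [b' b'D] : exists b' : 'I_m -> 'M[R]_n, forall d, b' d = P *m b d *m P^T.
  by exists (fun d => P *m b d *m P^T).
have {}ba : b' a = diag_mx l by rewrite b'D.
have {}s d : (b' d)^T = b' d by rewrite b'D.
have {}o e d : dotm (b' e) (b' d) = ((e == d) && nu e)%:R by rewrite !b'D.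
have {}cE e d : comm_norm b' e d = c e d by rewrite -cE /comm_norm !b'D.
have := row1 _ xa; rewrite /dd; under eq_bigr => f _ do rewrite -cE.
case/(excess_row_eq1 s o ba nua) => i0 [J [t [st spoke off]]].
have [iJ J0 st1 lE] := st.
have b0 d i j : 1 < c a d -> ~~ ((i == i0) && (j \in J)) ->
    ~~ ((j == i0) && (i \in J)) -> b' d i j = 0.
  by move=> cd h1 h2; apply: off; [rewrite cE|exact: star_gap_lt1 st h1 h2].
have b'E d : 1 < c a d -> let v := row i0 (b' d) in
    v 0 i0 = 0 /\ b' d = (delta_mx 0 i0)^T *m v + v^T *m delta_mx 0 i0.
  move=> cd v; have v0 : v 0 i0 = 0 by rewrite mxE b0 ?eqxx.
  split=> //; apply/matrixP => i j.
  rewrite trmx_delta !mxE !big_ord1 !mxE /= eqxx andbT.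
  have sE p q : b' d p q = b' d q p by rewrite -[in LHS]s mxE.
  case: (eqVneq i i0) => [->|ii0]; case: (eqVneq j i0) => [->|ji0] /=.
  - by move: v0; rewrite mxE => ->; ring.
  - by ring.
  - by rewrite sE; ring.
  - by rewrite b0 ?(negbTE ii0) ?(negbTE ji0) //; ring.
have cnu d : 1 < c a d -> nu d.
  by move=> /xE xd; apply: x_nu; rewrite -xd.
have [j0 j0J] : exists j, j \in J by apply/card_gt0P.
have [d cd] : exists d, 1 < c a d.
  apply/existsP; rewrite -[X in is_true X]negbK negb_exists; apply/negP => /forallP h.
  have := spoke _ j0J; rewrite big1 => [/esym/eqP|f]; first by rewrite invr_eq0 pnatr_eq0.
  by rewrite cE (negbTE (h f)).
(* Two such members carry the weight of [a], so [equality_terms] requires a commutator norm of at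
   least 1, whereas it is 1/2. *)
have Kd f : 1 < c a f -> f = d.
  move=> cf; apply/eqP/negPn/negP => fd.
  have [v0 bf] := b'E f cf; have [w0 bd] := b'E d cd.
  have cfd : c f d = 2^-1.
    apply: (comm_norm_spoke PP v0 w0 (cnu _ cf) (cnu _ cd) fd).
      by rewrite -b'D.
    by rewrite -b'D.
  have := c1 f d; rewrite -(xE _ _ cf) -(xE _ _ cd) cfd => /(_ xa xa fd).
  by lra.
have bd2 j : j \in J -> b' d i0 j ^+ 2 = 2^-1.
  move=> /spoke <-; rewrite (big_pred1 d) // => f /=; rewrite cE.
  by apply/idP/eqP => [/Kd//|->].
have nd : dotm (b' d) (b' d) = 1 by rewrite o eqxx cnu.
have [v0 bdE] := b'E d cd.
have dE : 2 * \sum_j b' d i0 j ^+ 2 = 1.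
  rewrite -[RHS]nd.
  rewrite /dotm [RHS](bigD1 i0) //= mulr_natl mulr2n; congr (_ + _).
  rewrite [LHS](bigD1 i0) //=; move: (v0); rewrite mxE => ->; rewrite expr0n add0r.
  apply: eq_bigr => i ii0; rewrite (bigD1 i0) //= big1 ?addr0 => [|j ji0].
    by rewrite -[in RHS]s mxE expr2.
  by rewrite b0 ?mul0r ?(negbTE ii0) ?(negbTE ji0).
(* Each leaf uses up 1/2 of a row whose squares add up to 1/2. *)
have J1 : #|J| = 1%N.
  apply/eqP; rewrite eqn_leq J0 andbT -(ler_nat R).
  have : \sum_(j in J) b' d i0 j ^+ 2 <= \sum_j b' d i0 j ^+ 2.
    rewrite [leRHS](bigID (mem J)) /= lerDl.
    by apply: sumr_ge0 => ? _; exact: sqr_ge0.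
  rewrite (eq_bigr _ bd2) sumr_const -mulr_natl.
  by move: dE; set S := \sum_j _; set k := #|J|%:R => h1 h2; lra.
have JE : J = [set j0].
  by apply/eqP; rewrite eq_sym eqEcard finset.sub1set j0J J1 cards1.
have i0j0 : i0 != j0 by apply: contraNneq iJ => ->.
have t2 : t ^+ 2 = 2^-1 by move: st1; rewrite J1 => h; lra.
have bdij : b' d = b' d i0 j0 *: (delta_mx i0 j0 + delta_mx j0 i0).
  apply/matrixP => i j; rewrite !mxE.
  have sE p q : b' d p q = b' d q p by rewrite -[in LHS]s mxE.
  case: (boolP ((i == i0) && (j == j0))) => [/andP[/eqP -> /eqP ->]|h1].
    by rewrite (negbTE i0j0) /=; ring.
  case: (boolP ((i == j0) && (j == i0))) => [/andP[/eqP -> /eqP ->]|h2].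
    by rewrite sE /=; ring.
  by rewrite [LHS]b0 ?JE ?inE ?addr0 ?mulr0 // andbC.
exists d, P, i0, j0, t, (b' d i0 j0); split=> //; last 2 first.
- rewrite -b'D ba; apply/matrixP => i j; rewrite !mxE lE J1 JE inE mul1r.
  have [->|ij] := eqVneq i j.
    rewrite mulr1n !andbb; case: (eqVneq j i0) => [->|ji0].
      by rewrite (negbTE i0j0) /=; ring.
    by case: eqVneq => _ /=; ring.
  rewrite mulr0n; case: (eqVneq i i0) ij => [->|_] ij /=.
    by rewrite eq_sym (negbTE ij) (negbTE i0j0) /=; ring.
  case: (eqVneq i j0) ij => [->|_] ij /=; last by ring.
  by rewrite eq_sym (negbTE ij) /=; ring.
- by rewrite -b'D -bdij.
- split=> //; apply: contraTneq cd => <-; rewrite comm_norm_refl.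
  by rewrite -leNgt ler01.
- by split=> //; exact: bd2.
split=> [|f fa fd]; first by rewrite (xE _ _ cd).
apply/eqP/negPn/negP => xf.
(* A third member is orthogonal to [b d], so its (i0, j0) entry is 0. All remaining squared gaps are
   at most 1/2, whence c a f <= 1/2, against c a f >= 1. *)
have caf : 1 <= c a f by apply: c1; rewrite // eq_sym.
have e0 : b' d i0 j0 != 0.
  have := bd2 _ j0J; apply: contra_eq_neq => ->.
  by rewrite expr0n eq_sym invr_eq0 pnatr_eq0.
have bf0 : b' f i0 j0 = 0.
  have := o f d; rewrite (negbTE fd) bdij dotmC dotmZl dotmDl !(dotmC (delta_mx _ _)).
  rewrite !dotm_delta -[b' f in X in _ * (_ + X)]s mxE => /eqP.
  by rewrite mulf_eq0 (negbTE e0) /= -mulr2n -mulr_natl mulf_eq0 pnatr_eq0 => /eqP.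
have nf : dotm (b' f) (b' f) = 1 by rewrite o eqxx x_nu.
suff : c a f <= 2^-1 by lra.
rewrite -cE (comm_norm_diagE ba) -[leRHS]mulr1 -[X in _ <= _ * X]nf /dotm mulr_sumr.
apply: ler_sum => i _; rewrite mulr_sumr; apply: ler_sum => j _.
rewrite -expr2.
have bf0' : b' f j0 i0 = 0 by rewrite -[b' f]s mxE.
case: (boolP ((i == i0) && (j == j0))) => [/andP[/eqP -> /eqP ->]|h1].
  by rewrite bf0 expr0n !mulr0.
case: (boolP ((i == j0) && (j == i0))) => [/andP[/eqP -> /eqP ->]|h2].
  by rewrite bf0' expr0n !mulr0.
apply: ler_wpM2r; first exact: sqr_ge0.
rewrite !lE J1 JE !inE mul1r.
move: h1 h2; case: (eqVneq i i0) => [->|ii0]; case: (eqVneq j i0) => [->|ji0] /=;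
  rewrite ?(negbTE i0j0) ?andbT ?andbF //=.
- by move=> _ _; rewrite subrr expr0n /= invr_ge0 ler0n.
- by move=> /negbTE -> _; rewrite subr0 t2.
- by move=> _ /negbTE ->; rewrite sub0r sqrrN t2.
- move=> _ _; case: eqVneq => _; case: eqVneq => _;
    by rewrite ?subrr ?expr0n ?subr0 ?sub0r ?opprK ?sqrrN ?t2 /= ?lexx ?invr_ge0 ?ler0n.
Qed.

End NormalizedEquality.

(** * Equality case of the DDVV inequality *)

(*%%A5*)
Lemma commutatorZ (R : rcfType) n s t (A B : 'M[R]_n) :
  commutator (s *: A) (t *: B) = (s * t) *: commutator A B.
Proof.
by rewrite /commutator -!scalemxAl -!scalemxAr !scalerA (mulrC t) -scalerBr.
Qed.

(** For a fixed entry (i, j) the m x m matrix of commutator entries is conjugated by [Q], which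
    preserves its Frobenius norm. *)
Lemma commutator_orth_sum (R : rcfType) n m (B : 'I_m -> 'M[R]_n) (Q : 'M[R]_m) :
  Q *m Q^T = 1%:M ->
  let B' e := \sum_f Q e f *: B f in
  \sum_a \sum_d comm_norm B' a d = \sum_a \sum_d comm_norm B a d.
Proof.
move=> QQ B'.
pose K (C : 'I_m -> 'M[R]_n) i j : 'M[R]_m := \matrix_(a, d) commutator (C a) (C d) i j.
have KE (C : 'I_m -> 'M[R]_n) :
    \sum_a \sum_d comm_norm C a d = \sum_i \sum_j dotm (K C i j) (K C i j).
  rewrite /comm_norm /dotm.
  under eq_bigr => a _ do rewrite exchange_big /=.
  rewrite exchange_big; apply: eq_bigr => i _ /=.
  under eq_bigr => a _ do rewrite exchange_big /=.
  rewrite exchange_big; apply: eq_bigr => j _ /=.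
  by apply: eq_bigr => a _; apply: eq_bigr => d _; rewrite !mxE.
rewrite !KE; apply: eq_bigr => i _; apply: eq_bigr => j _.
have -> : K B' i j = Q *m K B i j *m Q^T; last exact: dotm_conj.
have comE a d : commutator (B' a) (B' d) =
    \sum_g (\sum_f (Q a f * Q d g) *: commutator (B f) (B g)).
  rewrite /commutator /B' !mulmx_suml.
  under eq_bigr => f _ do rewrite mulmx_sumr.
  rewrite exchange_big -sumrB /=; apply: eq_bigr => g _.
  rewrite mulmx_sumr -sumrB; apply: eq_bigr => f _.
  by rewrite -!scalemxAl -!scalemxAr !scalerA scalerBr (mulrC (Q d g)).
apply/matrixP => a d; rewrite [LHS]mxE comE [RHS]mxE summxE.
apply: eq_bigr => g _; rewrite summxE [X in _ = X * _]mxE [X in _ = _ * X]mxE.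
rewrite mulr_suml; apply: eq_bigr => f _.
by rewrite [LHS]mxE [K B i j f g]mxE; ring.
Qed.

(** An orthogonal change of the family that diagonalizes its Gram matrix makes the members mutually
    orthogonal. Normalizing them, with the squared norms as weights, leads to [equality_shape];
    rotating back gives the stated form. *)
Theorem commutator_equality (R : rcfType) n m (B : 'I_m -> 'M[R]_n) :
  (forall a, (B a)^T = B a) ->
  \sum_a \sum_d comm_norm B a d = (\sum_a dotm (B a) (B a)) ^+ 2 ->
  (forall a, B a = 0) \/
  exists (e1 e2 : 'rV[R]_n) (q1 q2 : 'rV[R]_m) (mu : R),
  [/\ mu != 0,
      [/\ dotv e1 e1 = 1, dotv e2 e2 = 1 & dotv e1 e2 = 0],
      [/\ dotv q1 q1 = 1, dotv q2 q2 = 1 & dotv q1 q2 = 0] &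
      forall a, B a = mu *: (q1 0 a *: (e1^T *m e1 - e2^T *m e2)
                             + q2 0 a *: (e1^T *m e2 + e2^T *m e1))].
Proof.
move=> B_sym eqB.
pose G : 'M[R]_m := \matrix_(a, d) dotm (B a) (B d).
have [|Q [x [QQ QG]]] := @symmetric_diagonalization R m G.
  by apply/matrixP => a d; rewrite !mxE dotmC.
pose B' e := \sum_f Q e f *: B f.
have B'_sym e : (B' e)^T = B' e.
  rewrite raddf_sum; apply: eq_bigr => f _ /=.
  by rewrite linearZ /= B_sym.
have B'_orth e d : dotm (B' e) (B' d) = x 0 e *+ (e == d).
  have := congr1 (fun M : 'M[R]_m => M e d) QG; rewrite !mxE => <-.
  rewrite /B' dotmC dotm_suml; apply: eq_bigr => g _.
  rewrite dotmZl dotmC dotm_suml mulr_sumr !mxE mulr_suml.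
  by apply: eq_bigr => f _; rewrite dotmZl !mxE; ring.
have BE f : B f = \sum_e Q e f *: B' e.
  under eq_bigr => e _ do rewrite /B' scaler_sumr.
  rewrite exchange_big (bigD1 f) //= [X in _ + X]big1 ?addr0 => [|g gf].
    under eq_bigr => e _ do rewrite scalerA.
    rewrite -scaler_suml.
    have := congr1 (fun M : 'M[R]_m => M f f) (mulmx1C QQ).
    rewrite !mxE eqxx => QE; rewrite (_ : \sum_i _ = 1) ?scale1r //.
    by rewrite -[RHS]QE; apply: eq_bigr => e _; rewrite !mxE.
  under eq_bigr => e _ do rewrite scalerA.
  rewrite -scaler_suml.
  have := congr1 (fun M : 'M[R]_m => M f g) (mulmx1C QQ).
  rewrite !mxE eq_sym (negbTE gf) => QE; rewrite (_ : \sum_i _ = 0) ?scale0r //.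
  by rewrite -[RHS]QE; apply: eq_bigr => e _; rewrite !mxE.
have x0 e : 0 <= x 0 e by have := B'_orth e e; rewrite eqxx mulr1n => <-; exact: dotm_ge0.
pose nu e := x 0 e != 0.
(* For weight 0 the inverse square root is 0 by convention, so [b e] is the zero matrix, in
   accordance with [nu]. *)
pose b e := (Num.sqrt (x 0 e))^-1 *: B' e.
have B'E e : B' e = Num.sqrt (x 0 e) *: b e.
  rewrite /b scalerA; have [xe|xe] := eqVneq (x 0 e) 0.
    rewrite xe sqrtr0 mul0r scale0r; apply: dotm_eq0.
    by rewrite B'_orth eqxx xe.
  by rewrite mulfV ?scale1r // sqrtr_eq0 -ltNge lt_def xe x0.
have b_sym e : (b e)^T = b e by rewrite /b linearZ /= B'_sym.
have b_orth e d : dotm (b e) (b d) = ((e == d) && nu e)%:R.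
  rewrite /b dotmZl dotmC dotmZl dotmC B'_orth.
  case: eqVneq => [<-|_]; last by rewrite !mulr0.
  rewrite mulr1n /nu /=; have [->|xe] := eqVneq (x 0 e) 0; first by rewrite !mulr0.
  rewrite mulrA -invfM -expr2 sqr_sqrtr // mulVf //.
have sumx : \sum_e x 0 e = \sum_a dotm (B a) (B a).
  have -> : \sum_e x 0 e = \tr (diag_mx x) by rewrite mxtrace_diag.
  rewrite -QG mxtrace_mulC mulmxA (mulmx1C QQ) mul1mx.
  by apply: eq_bigr => a _; rewrite mxE.
have cE e d : comm_norm B' e d = x 0 e * x 0 d * comm_norm b e d.
  rewrite /comm_norm !B'E commutatorZ dotmZl dotmZr mulrA.
  by rewrite -expr2 exprMn !sqr_sqrtr.
have equality : \sum_a \sum_d x 0 a * x 0 d * comm_norm b a d = (\sum_a x 0 a) ^+ 2.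
  rewrite sumx -eqB -(commutator_orth_sum B QQ) -/B'.
  by apply: eq_bigr => e _; apply: eq_bigr => d _; rewrite cE.
have [/existsP[a xa]|none] := boolP [exists a, x 0 a != 0]; last first.
  left=> f; rewrite BE big1 // => e _; rewrite B'E.
  move: none; rewrite negb_exists => /forallP/(_ e); rewrite negbK => /eqP ->.
  by rewrite sqrtr0 scale0r scaler0.
right.
have [d [P [i0 [j0 [t [ep [[ad PP ij] [t2 ep2] [xd xf] ba bd]]]]]]] :=
  equality_shape b_sym b_orth x0 (fun e => id) equality xa.
have QQ1 e f : dotv (row e Q) (row f Q) = (e == f)%:R.
  have := congr1 (fun M : 'M[R]_m => M e f) QQ; rewrite !mxE => <-.
  by rewrite dotvE; apply: eq_bigr => i _; rewrite !mxE.
have PP1 e f : dotv (row e P) (row f P) = (e == f)%:R.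
  have := congr1 (fun M : 'M[R]_n => M e f) PP; rewrite !mxE => <-.
  by rewrite dotvE; apply: eq_bigr => i _; rewrite !mxE.
have tN0 : t != 0 by apply: contra_eq_neq t2 => ->; rewrite expr0n eq_sym invr_eq0 pnatr_eq0.
(* The ratio ep / t is a sign; it is absorbed into the second normal direction [q2]. *)
have s2 : (ep / t) * (ep / t) = 1.
  by rewrite -expr2 expr_div_n t2 ep2 mulfV // invr_eq0 pnatr_eq0.
exists (row i0 P), (row j0 P), (row a Q), ((ep / t) *: row d Q),
  (Num.sqrt (x 0 a) * t); split.
- by rewrite mulf_neq0 // sqrtr_eq0 -ltNge lt_def xa x0.
- by rewrite !PP1 !eqxx (negbTE ij).
- rewrite !(dotvC _ (_ *: _)) !dotvZl !(dotvC _ (_ *: _)) !dotvZl !QQ1 !eqxx.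
  by rewrite eq_sym (negbTE ad) !mulr1 mulr0 s2.
move=> f; rewrite BE (bigD1 a) //= (bigD1 d) 1?eq_sym //= big1 => [|g /andP[ga gd]]; last first.
  by rewrite B'E xf // sqrtr0 scale0r scaler0.
rewrite addr0 !B'E xd.
have bP g : b g = P^T *m (P *m b g *m P^T) *m P.
  by rewrite !mulmxA (mulmx1C PP) mul1mx -mulmxA (mulmx1C PP) mulmx1.
have dP i j : P^T *m delta_mx i j *m P = (row i P)^T *m row j P.
  by rewrite -(mul_delta_mx (0 : 'I_1)) mulmxA -mulmxA -rowE -trmx_delta -trmx_mul -rowE.
rewrite (bP a) (bP d) ba bd.
rewrite -!scalemxAr -!scalemxAl mulmxBr mulmxBl mulmxDr mulmxDl !dP.
set X := _ - _; set Y := _ *m _ + _ *m _.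
rewrite !mxE [RHS]scalerDr !scalerA; congr (_ *: _ + _ *: _); first by ring.
by field.
Qed.

Local Open Scope classical_set_scope.
Local Open Scope ring_scope.

(** * Calculus of smooth functions on open sets *)

(*%%B1*)
Section Differentiability.
Context {R : realType} {V W : normedModType R}.
Implicit Types f g : V -> W.

Lemma nbhs_radius (x : V) (P : V -> Prop) : (\forall y \near x, P y) <->
  exists2 e : R, 0 < e & forall y, `|x - y| < e -> P y.
Proof. by rewrite nbhs_normP; split=> -[e e0 h]; exists e => // y; exact: h. Qed.

Lemma differentiable_estimateP f (x : V) : differentiable f x ->
  forall e : R, 0 < e ->
    \forall h \near (0 : V), `|f (h + x) - f x - 'd f x h| <= e * `|h|.
Proof.
move=> /diff_locally fx e e0.
have /eqaddoP/(_ _ e0) := fx.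
apply: filterS => h /=.
by rewrite -[X in `|X|]/(f (h + x) - (f x + 'd f x h)) opprD addrA.
Qed.

(** For functions known only through an increment estimate with a prescribed derivative, such as
    solutions of total differential systems. *)
Lemma differentiable_of_estimate f (x : V) (df : {linear V -> W}) :
  continuous df ->
  (forall e : R, 0 < e ->
    \forall h \near (0 : V), `|f (h + x) - f x - df h| <= e * `|h|) ->
  differentiable f x /\ 'd f x = df :> (V -> W).
Proof.
move=> cdf est.
have eqo : f \o shift x = cst (f x) + df +o_ 0 id.
  apply/eqaddoP => e e0; apply: filterS (est e e0) => h /=.
  by rewrite -[X in _ -> is_true (`|X| <= _)]/(f (h + x) - (f x + df h)) opprD addrA.
have dfE := diff_unique cdf eqo.
by split=> //; apply/diff_locallyP; rewrite dfE.
Qed.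

Lemma near_differentiable f g (x : V) :
  (\forall y \near x, f y = g y) -> differentiable f x -> differentiable g x.
Proof.
move=> fg fx; have fgx := nbhs_singleton fg.
have [] := @differentiable_of_estimate g x ('d f x).
- exact: diff_continuous.
- move=> e e0; have := differentiable_estimateP fx e0.
  have : \forall h \near (0 : V), f (h + x) = g (h + x).
    move/nbhs_radius: fg => [r r0 fg]; apply/nbhs_radius; exists r => // h.
    by rewrite sub0r normrN => hr; apply: fg; rewrite opprD addrCA subrr addr0 normrN.
  by apply: filterS2 => h -> ; rewrite fgx.
- by [].
Qed.

End Differentiability.

Section ScalarFields.
Context {R : realType} {n : nat}.
Local Notation V := 'rV[R]_n.
Implicit Types (U : set V) (f g : V -> R).

Definition smooth U f := smooth_on U (f : V -> R^o).

Lemma near_open U x : open U -> U x -> \forall y \near x, U y.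
Proof. by move=> oU Ux; exact: open_nbhs_nbhs. Qed.

Lemma Ck_ext k U f g : open U -> (forall x, U x -> f x = g x) ->
  Ck k U (f : V -> R^o) -> Ck k U (g : V -> R^o).
Proof.
move=> oU; elim: k f g => [|k IH] f g fg /=.
  move=> cf x Ux; have fgx : \forall y \near x, f y = g y.
    by apply: filterS (near_open oU Ux) => y; exact: fg.
  have := cf x Ux; rewrite /prop_for /continuous_at -(fg x Ux).
  move=> cvf; apply: cvg_trans cvf.
  exact: (@near_eq_cvg _ _ (nbhs x) _ f g fgx).
have fgn x : U x -> \forall y \near x, f y = g y.
  by move=> Ux; apply: filterS (near_open oU Ux) => y; exact: fg.
case=> df Df; split=> [x Ux|v].
  exact: near_differentiable (fgn x Ux) (df x Ux).
apply: IH (Df v) => x Ux; exact: near_eq_derive (fgn x Ux).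
Qed.

Lemma smooth_ext U f g : open U -> (forall x, U x -> f x = g x) ->
  smooth U f -> smooth U g.
Proof. by move=> oU fg sf k; exact: Ck_ext fg (sf k). Qed.

Lemma Ck_subset k (W : normedModType R) U U' (f : V -> W) :
  U' `<=` U -> Ck k U f -> Ck k U' f.
Proof.
move=> UU; elim: k f => [|k IH] f /= => [cf x /UU|[df Df]]; first exact: cf.
by split=> [x /UU|v]; [exact: df|exact: IH].
Qed.

Lemma smooth_subset U U' f : U' `<=` U -> smooth U f -> smooth U' f.
Proof. by move=> UU sf k; apply: Ck_subset UU _. Qed.

Lemma smooth_differentiable U f x : smooth U f -> U x -> differentiable f x.
Proof. by move=> /(_ 1%N)[df _]; exact: df. Qed.

Lemma smooth_derive U f v : smooth U f -> smooth U ('D_v f).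
Proof. by move=> sf k; have [_] := sf k.+1; apply. Qed.

Lemma smooth_derivable U f x v : smooth U f -> U x -> derivable f x v.
Proof. by move=> sf Ux; apply: diff_derivable; exact: smooth_differentiable sf Ux. Qed.

Lemma smooth_continuous U f x : smooth U f -> U x -> {for x, continuous f}.
Proof. by move=> /(_ 0%N); apply. Qed.

Lemma Ck_le j k (W : normedModType R) U (f : V -> W) :
  (j <= k)%N -> Ck k U f -> Ck j U f.
Proof.
elim: k j f => [|k IH] [|j] f //=.
  by move=> _ [df _] x Ux; apply: differentiable_continuous; exact: df.
by rewrite ltnS => jk [df Df]; split=> // v; exact: IH.
Qed.

Lemma Ck_cst k U (c : R) : Ck k U (fun=> c : R^o).
Proof.
elim: k c => [|k IH] c /=; first by move=> x _; exact: cst_continuous.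
split=> [x _|v]; first exact: differentiable_cst.
have -> : (fun x : V => 'D_v (fun=> c : R^o) x) = (fun=> 0).
  by apply/funext => x; exact: derive_cst.
exact: IH.
Qed.

Lemma smooth_cst U c : smooth U (fun=> c).
Proof. by move=> k; exact: Ck_cst. Qed.

Lemma CkD k U f g : open U -> Ck k U (f : V -> R^o) -> Ck k U (g : V -> R^o) ->
  Ck k U (fun x => f x + g x : R^o).
Proof.
move=> oU; elim: k f g => [|k IH] f g /=.
  by move=> cf cg x Ux; exact: (@continuousD R R^o _ f g x (cf x Ux) (cg x Ux)).
move=> [df Df] [dg Dg]; split=> [x Ux|v].
  by apply: differentiableD; [exact: df|exact: dg].
apply: (Ck_ext oU _ (IH _ _ (Df v) (Dg v))) => x Ux.
by apply/esym/deriveD; apply: diff_derivable; [exact: df|exact: dg].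
Qed.

Lemma CkM k U f g : open U -> Ck k U (f : V -> R^o) -> Ck k U (g : V -> R^o) ->
  Ck k U (fun x => f x * g x : R^o).
Proof.
move=> oU; elim: k f g => [|k IH] f g /=.
  by move=> cf cg x Ux; exact: (@continuousM R _ f g x (cf x Ux) (cg x Ux)).
move=> Cf Cg; have [df Df] := Cf; have [dg Dg] := Cg; split=> [x Ux|v].
  by apply: differentiableM; [exact: df|exact: dg].
have Cf' : Ck k U (f : V -> R^o) := @Ck_le k k.+1 R^o U f (leqnSn k) Cf.
have Cg' : Ck k U (g : V -> R^o) := @Ck_le k k.+1 R^o U g (leqnSn k) Cg.
apply: (Ck_ext oU _ (CkD oU (IH _ _ Cf' (Dg v)) (IH _ _ Cg' (Df v)))) => x Ux.
by apply/esym/deriveM; apply: diff_derivable; [exact: df|exact: dg].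
Qed.

Lemma CkV k U f : open U -> (forall x, U x -> f x != 0) ->
  Ck k U (f : V -> R^o) -> Ck k U (fun x => (f x)^-1 : R^o).
Proof.
move=> oU f0; elim: k => [|k IH].
  by move=> cf x Ux; exact: (@continuousV R _ f x (f0 x Ux) (cf x Ux)).
move=> Cf; have [df Df] := Cf; split=> [x Ux|v].
  by apply: differentiableV; [exact: df|exact: f0].
have Cf' : Ck k U (f : V -> R^o) := @Ck_le k k.+1 R^o U f (leqnSn k) Cf.
have := CkM oU (Ck_cst k U (-1)) (CkM oU (CkM oU (IH Cf') (IH Cf')) (Df v)).
apply: (Ck_ext oU) => x Ux; rewrite deriveV ?f0 //; last exact/diff_derivable/df.
by rewrite -exprVn expr2 mulN1r -mulNr.
Qed.

Lemma smoothD U f g : open U -> smooth U f -> smooth U g ->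
  smooth U (fun x => f x + g x).
Proof. by move=> oU sf sg k; exact: CkD. Qed.

Lemma smoothM U f g : open U -> smooth U f -> smooth U g ->
  smooth U (fun x => f x * g x).
Proof. by move=> oU sf sg k; exact: CkM. Qed.

Lemma smoothV U f : open U -> (forall x, U x -> f x != 0) -> smooth U f ->
  smooth U (fun x => (f x)^-1).
Proof. by move=> oU f0 sf k; exact: CkV. Qed.

Lemma smoothN U f : open U -> smooth U f -> smooth U (fun x => - f x).
Proof.
move=> oU sf; apply: smooth_ext (smoothM oU (smooth_cst U (-1)) sf) => // x _.
by rewrite mulN1r.
Qed.

Lemma smoothB U f g : open U -> smooth U f -> smooth U g ->
  smooth U (fun x => f x - g x).
Proof. by move=> oU sf sg; apply: smoothD => //; exact: smoothN. Qed.

Lemma smooth_sum U (I : Type) (r : seq I) (P : pred I) (F : I -> V -> R) :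
  open U -> (forall i, P i -> smooth U (F i)) ->
  smooth U (fun x => \sum_(i <- r | P i) F i x).
Proof.
move=> oU sF; elim: r => [|i r IH].
  by apply: smooth_ext (smooth_cst U 0) => // x _; rewrite big_nil.
have [Pi|Pi] := boolP (P i); last first.
  by apply: smooth_ext IH => // x _; rewrite big_cons (negbTE Pi).
apply: smooth_ext (smoothD oU (sF i Pi) IH) => // x _.
by rewrite big_cons Pi.
Qed.

Lemma smooth_prod U (I : Type) (r : seq I) (P : pred I) (F : I -> V -> R) :
  open U -> (forall i, P i -> smooth U (F i)) ->
  smooth U (fun x => \prod_(i <- r | P i) F i x).
Proof.
move=> oU sF; elim: r => [|i r IH].
  by apply: smooth_ext (smooth_cst U 1) => // x _; rewrite big_nil.
have [Pi|Pi] := boolP (P i); last first.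
  by apply: smooth_ext IH => // x _; rewrite big_cons (negbTE Pi).
apply: smooth_ext (smoothM oU (sF i Pi) IH) => // x _.
by rewrite big_cons Pi.
Qed.

Lemma derivativeD f g x v : differentiable f x -> differentiable g x ->
  'D_v (fun y => f y + g y : R^o) x = 'D_v f x + 'D_v g x.
Proof. by move=> df dg; apply: deriveD; exact: diff_derivable. Qed.

Lemma derivativeB f g x v : differentiable f x -> differentiable g x ->
  'D_v (fun y => f y - g y : R^o) x = 'D_v f x - 'D_v g x.
Proof. by move=> df dg; apply: deriveB; exact: diff_derivable. Qed.

Lemma derivativeM f g x v : differentiable f x -> differentiable g x ->
  'D_v (fun y => f y * g y : R^o) x = 'D_v f x * g x + f x * 'D_v g x.
Proof.
move=> df dg; transitivity (f x *: 'D_v g x + g x *: 'D_v f x).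
  by apply: (@deriveM _ _ f g); exact: diff_derivable.
by rewrite addrC; congr (_ + _); rewrite [LHS]mulrC.
Qed.

Lemma derivative_sum (I : finType) (F : I -> V -> R) x v :
  (forall i, differentiable (F i) x) ->
  differentiable (fun y => \sum_i F i y : R^o) x /\
  'D_v (fun y => \sum_i F i y : R^o) x = \sum_i 'D_v (F i) x.
Proof.
move=> dF.
elim: index_enum => [|i r [IH1 IH2]].
  rewrite big_nil (_ : (fun y => _) = cst (0 : R^o)).
    by split; [exact: differentiable_cst|exact: derive_cst].
  by apply/funext => y; rewrite big_nil.
rewrite big_cons (_ : (fun y => _) = (fun y => F i y + \sum_(j <- r) F j y : R^o)).
  split; first by apply: differentiableD.
  by rewrite derivativeD // IH2.
by apply/funext => y; rewrite big_cons.
Qed.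

Lemma derive_linear f x u v (a b : R) : differentiable f x ->
  'D_(a *: u + b *: v) f x = a * 'D_u f x + b * 'D_v f x.
Proof. by move=> df; rewrite !deriveE // linearD !linearZ. Qed.

Lemma derive_coord_sum f x v : differentiable f x ->
  'D_v f x = \sum_k v 0 k * 'D_(delta_mx 0 k) f x.
Proof.
move=> df; rewrite deriveE // {1}(row_sum_delta v) raddf_sum.
by apply: eq_bigr => k _ /=; rewrite linearZ deriveE.
Qed.

Lemma is_derive_line f x u (s : R) : differentiable f (x + s *: u) ->
  is_derive s 1 (fun t => f (x + t *: u) : R^o) ('D_u f (x + s *: u)).
Proof.
move=> df.
have E : (fun h : R => h^-1 *: (((fun t => f (x + t *: u)) \o shift s) (h *: 1)
           - f (x + s *: u))) =
         (fun h : R => h^-1 *: ((f \o shift (x + s *: u)) (h *: u) - f (x + s *: u))).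
  apply/funext => h /=; congr (_ *: (f _ - _)).
  by rewrite [h *: 1]mulr1 scalerDl addrCA.
have dv : derivable f (x + s *: u) u by exact: diff_derivable.
by apply: DeriveDef; rewrite /derivable /derive /= E.
Qed.

Lemma smooth_continuous_at U f x (e : R) : smooth U f -> U x -> 0 < e ->
  \forall y \near x, `|f x - f y| < e.
Proof.
move=> sf Ux e0; have := smooth_continuous sf Ux.
by move/(@cvgrPdist_lt R R^o); apply.
Qed.

Lemma mean_value_line f x u (h : R) : 0 < h ->
  (forall s, 0 <= s <= h -> differentiable f (x + s *: u)) ->
  exists2 s, 0 < s < h & f (x + h *: u) - f x = 'D_u f (x + s *: u) * h.
Proof.
move=> h0 df.
have [||s sI] := @MVT R (fun t => f (x + t *: u)) (fun t => 'D_u f (x + t *: u)) 0 h h0.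
- move=> s; rewrite in_itv /= => /andP[s0 sh].
  by apply: is_derive_line; apply: df; rewrite !ltW.
- apply: (@derivable_within_continuous R R^o) => s; rewrite in_itv /= => sI.
  by have /is_derive_line[] := df s sI.
by rewrite scale0r addr0 subr0 => E; exists s => //; move: sI; rewrite in_itv.
Qed.

(** The mean value theorem, along v and then along u, turns the second difference into the mixed
    derivative at a nearby point; continuity of that derivative controls the error. *)
Lemma second_difference U f x u v (e : R) : open U -> smooth U f -> U x -> 0 < e ->
  exists2 d : R, 0 < d & forall h, 0 < h < d ->
   `|f (x + h *: u + h *: v) - f (x + h *: u) - (f (x + h *: v) - f x)
     - 'D_u (fun y => 'D_v f y) x * h ^+ 2| <= e * h ^+ 2.
Proof.
move=> oU sf Ux e0.
have sv := smooth_derive v sf; have suv := smooth_derive u sv.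
have : \forall y \near x, U y /\ `|'D_u (fun y => 'D_v f y) x - 'D_u (fun y => 'D_v f y) y| < e.
  by apply: filter_app (smooth_continuous_at suv Ux e0); apply: filterS (near_open oU Ux).
case/nbhs_radius => r r0 near_x.
have c0 : 0 < `|u| + `|v| + 1 by rewrite ltr_wpDl ?addr_ge0.
exists (r / (`|u| + `|v| + 1)); first by rewrite divr_gt0.
move=> h /andP[h0]; rewrite ltr_pdivlMr // => hr.
have inU s t : 0 <= s <= h -> 0 <= t <= h -> `|x - (x + s *: u + t *: v)| < r.
  move=> /andP[s0 sh] /andP[t0 th]; rewrite -addrA opprD addNKr normrN.
  apply: le_lt_trans hr; apply: le_trans (ler_normD _ _) _.
  rewrite !normrZ !ger0_norm // !mulrDr mulr1 -[leLHS]addr0.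
  by apply: lerD; [apply: lerD; exact: ler_wpM2r|exact: ltW].
have Uxy s t : 0 <= s <= h -> 0 <= t <= h -> U (x + s *: u + t *: v).
  by move=> sh th; have [] := near_x _ (inU s t sh th).
have h0' : 0 <= h <= h by rewrite (ltW h0) /=.
have z0 : 0 <= (0 : R) <= h by apply/andP; split=> //; exact: ltW.
pose phi t := f (x + h *: u + t *: v) - f (x + t *: v).
pose dphi t := 'D_v f (x + h *: u + t *: v) - 'D_v f (x + t *: v).
have dphiE t : 0 <= t <= h -> is_derive t 1 (phi : R -> R^o) (dphi t).
  move=> th; apply: is_deriveB; apply: is_derive_line.
    exact: smooth_differentiable sf (Uxy _ _ h0' th).
  apply: smooth_differentiable sf _; rewrite -[x in x + _]addr0 -(scale0r u).
  exact: Uxy.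
have [||s] := @MVT R phi dphi 0 h h0.
- by move=> s; rewrite in_itv /= => /andP[s0 sh]; apply: dphiE; rewrite !ltW.
- apply: (@derivable_within_continuous R R^o) => s; rewrite in_itv /= => sI.
  by have [] := dphiE s sI.
rewrite in_itv /= subr0 => /andP[s0 sh] E1.
have sh' : 0 <= s <= h by rewrite !ltW.
have [t t0|t /andP[t0 th] E2] := @mean_value_line ('D_v f) (x + s *: v) u h h0.
  apply: smooth_differentiable sv _; rewrite addrAC; exact: Uxy.
have th' : 0 <= t <= h by rewrite !ltW.
have -> : f (x + h *: u + h *: v) - f (x + h *: u) - (f (x + h *: v) - f x)
    = phi h - phi 0 by rewrite /phi !scale0r !addr0; ring.
rewrite E1 /dphi (addrAC x) E2 -mulrA -expr2 -mulrBl normrM.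
rewrite (ger0_norm (sqr_ge0 h)) ler_pM2r ?exprn_gt0 // distrC ltW // addrAC.
by have [] := near_x _ (inU t s th' sh').
Qed.

(** Schwarz's theorem: the second difference is symmetric in u and v, so both mixed derivatives
    approximate it. A discrepancy would be at most half of itself. *)
Lemma derive_comm U f x u v : open U -> smooth U f -> U x ->
  'D_u (fun y => 'D_v f y) x = 'D_v (fun y => 'D_u f y) x.
Proof.
move=> oU sf Ux; apply/eqP/negPn/negP => neq.
set a := 'D_u _ x in neq; set b := 'D_v _ x in neq.
have e0 : 0 < `|a - b| / 4 by rewrite divr_gt0 // normr_gt0 subr_eq0.
have [d d0 hd] := second_difference u v oU sf Ux e0.
have [d' d'0 hd'] := second_difference v u oU sf Ux e0.
pose h := Num.min d d' / 2.
have m0 : 0 < Num.min d d' by rewrite lt_min d0.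
have h0 : 0 < h by rewrite divr_gt0.
have hm : h < Num.min d d' by rewrite ltr_pdivrMr // mulrDr mulr1 ltrDl.
have := hd h; have := hd' h; rewrite h0; move: hm; rewrite lt_min => /andP[-> ->].
rewrite -/a -/b => /(_ isT) h1 /(_ isT) h2.
have h2p : 0 < h ^+ 2 by rewrite exprn_gt0.
have : `|a - b| * h ^+ 2 <= `|a - b| / 2 * h ^+ 2.
  rewrite -{1}(ger0_norm (ltW h2p)) -normrM.
  have -> : `|a - b| / 2 * h ^+ 2 = `|a - b| / 4 * h ^+ 2 + `|a - b| / 4 * h ^+ 2.
    by field.
  move: h1 h2; set A := _ - b * _; set B := _ - a * _ => h1 h2.
  have -> : (a - b) * h ^+ 2 = A - B.
    by rewrite /A /B (addrAC x (h *: v)); ring.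
  exact: le_trans (ler_normB _ _) (lerD h1 h2).
have ab0 : 0 < `|a - b| by rewrite normr_gt0 subr_eq0.
by rewrite ler_pM2r // leNgt ltr_pdivrMr // mulr_natr mulr2n ltrDl ab0.
Qed.

Lemma zero_derivative_const (r : R) x0 f :
  (forall y, `|x0 - y| < r -> differentiable f y) ->
  (forall y v, `|x0 - y| < r -> 'D_v f y = 0) ->
  forall y, `|x0 - y| < r -> f y = f x0.
Proof.
move=> df Df y yr.
have inr s : 0 <= s <= 1 -> `|x0 - (x0 + s *: (y - x0))| < r.
  move=> /andP[s0 s1]; rewrite opprD addNKr normrN normrZ ger0_norm //.
  by apply: le_lt_trans yr; rewrite distrC ler_piMl.
have [s s01|s /andP[s0 s1]] := @mean_value_line f x0 (y - x0) 1 ltr01.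
  exact/df/inr.
rewrite scale1r (addrC x0) subrK Df ?mul0r; last by apply: inr; rewrite !ltW.
by move/eqP; rewrite subr_eq0 => /eqP.
Qed.

End ScalarFields.

Section VectorFields.
Context {R : realType} {n p : nat}.
Local Notation V := 'rV[R]_n.
Local Notation W := 'rV[R]_p.
Implicit Types (U : set V) (X : V -> W).

(** Coordinatewise, to reduce everything to scalar functions; differentiability of the map itself is
    a separate hypothesis where the chain rule asks for it. *)
Definition smoothv U X := forall k, smooth U (fun x => X x 0 k).

Lemma derive_row X x v k : differentiable X x ->
  ('D_v X x) 0 k = 'D_v (fun y => X y 0 k) x.
Proof. by move=> dX; rewrite derive_mx ?mxE //; exact: diff_derivable. Qed.

Lemma derivable_row X x v : (forall k, derivable (fun y => X y 0 k) x v) ->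
  derivable X x v.
Proof. by move=> dX; apply/derivable_mxP => i j; rewrite ord1. Qed.

Lemma derive_smoothv U X x v k : smoothv U X -> U x ->
  ('D_v X x) 0 k = 'D_v (fun y => X y 0 k) x.
Proof.
move=> sX Ux; rewrite derive_mx ?mxE //; apply: derivable_row => j.
exact: smooth_derivable (sX j) Ux.
Qed.

Lemma smooth_on_smoothv U X : open U -> smooth_on U X -> smoothv U X.
Proof.
move=> oU sX k j; move: X {sX}(sX j); elim: j => [|j IH] X /=.
  move=> cX x Ux; apply: (@continuous_comp _ _ _ X (fun M : W => M 0 k)).
    exact: cX.
  exact: coord_continuous.
case=> dX DX; split=> [x Ux|v].
  apply: (@differentiable_comp _ _ _ _ X (fun M : W => M 0 k)); first exact: dX.
  exact: differentiable_coord.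
apply: (Ck_ext oU _ (IH _ (DX v))) => x Ux.
by rewrite derive_row //; exact: dX.
Qed.

Lemma smoothv_derive U X v : open U -> smoothv U X -> smoothv U (fun x => 'D_v X x).
Proof.
move=> oU sX k; apply: smooth_ext (smooth_derive v (sX k)) => // x Ux.
by rewrite (derive_smoothv v k sX Ux).
Qed.

Lemma row_lincomb (a b : R) (u v : W) k :
  (a *: u + b *: v) 0 k = a * u 0 k + b * v 0 k.
Proof. by rewrite !mxE. Qed.

Lemma derive_linearv U X x (a b : R) u v : smoothv U X -> U x ->
  'D_(a *: u + b *: v) X x = a *: 'D_u X x + b *: 'D_v X x.
Proof.
move=> sX Ux; apply/rowP => k; rewrite [RHS]row_lincomb.
apply: etrans (derive_smoothv _ k sX Ux) _.
apply: etrans (derive_linear _ _ _ _ _) _.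
  exact: smooth_differentiable (sX k) Ux.
by congr (_ * _ + _ * _); apply/esym; exact: derive_smoothv sX Ux.
Qed.

Lemma derive_commv U X x u v : open U -> smoothv U X -> U x ->
  'D_u (fun y => 'D_v X y) x = 'D_v (fun y => 'D_u X y) x.
Proof.
move=> oU sX Ux; apply/rowP => k.
have e w : \forall y \near x, ('D_w X y) 0 k = 'D_w (fun z => X z 0 k) y.
  by apply: filterS (near_open oU Ux) => y Uy; exact: derive_smoothv sX Uy.
have E w w' : ('D_w (fun y => 'D_w' X y) x) 0 k =
    'D_w (fun y => 'D_w' (fun z => X z 0 k) y) x.
  apply: etrans (derive_smoothv _ k (smoothv_derive _ oU sX) Ux) _.
  exact: near_eq_derive (e w').
apply: etrans (E u v) _; apply: etrans _ (esym (E v u)).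
exact: derive_comm oU (sX k) Ux.
Qed.

End VectorFields.

Section Composition.
Context {R : realType} {n p : nat}.
Local Notation V := 'rV[R]_n.
Local Notation W := 'rV[R]_p.
Variables (U : set V) (U' : set W) (F : V -> W).
Hypotheses (oU : open U) (oU' : open U').
Hypothesis dF : forall x, U x -> differentiable F x.
Hypothesis sF : smoothv U F.
Hypothesis FU : forall x, U x -> U' (F x).

Lemma derive_compose (f : W -> R) x v : smooth U' f -> U x ->
  'D_v (fun y => f (F y) : R^o) x = 'D_('D_v F x) f (F x).
Proof.
move=> sf Ux; have df := smooth_differentiable sf (FU Ux).
have dc : differentiable (f \o F) x by apply: differentiable_comp => //; exact: dF.
rewrite deriveE // (@diff_comp _ _ _ _ F f) //; last exact: dF.
by rewrite /= -!deriveE //; exact: dF.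
Qed.

(** Induction on the order, for all smooth [f] at once: by the chain rule a derivative of the
    composite is a sum of products of derivatives of [F] with composites of lower order. *)
Lemma smooth_compose (f : W -> R) : smooth U' f -> smooth U (fun x => f (F x)).
Proof.
move=> sf k; elim: k f sf => [|k IH] f sf /=.
  move=> x Ux; apply: (@continuous_comp _ _ _ F f).
    by apply: differentiable_continuous; exact: dF.
  exact: smooth_continuous sf (FU Ux).
split=> [x Ux|v].
  apply: (@differentiable_comp _ _ _ _ F f); first exact: dF.
  exact: smooth_differentiable sf (FU Ux).
have sum_Ck (r : seq 'I_p) :
    Ck k U (fun x => \sum_(i <- r) 'D_v (fun y => F y 0 i) x * 'D_(delta_mx 0 i) f (F x) : R^o).
  elim: r => [|i r IHr].
    by apply: Ck_ext (Ck_cst k U 0) => // x _; rewrite big_nil.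
  apply: (Ck_ext oU _ (CkD oU (CkM oU (smooth_derive v (sF i) k)
    (IH _ (smooth_derive (delta_mx 0 i) sf))) IHr)) => x _.
  by rewrite big_cons.
apply: (Ck_ext oU _ (sum_Ck (index_enum 'I_p))) => x Ux.
rewrite derive_compose // derive_coord_sum; last exact: smooth_differentiable sf (FU Ux).
by apply: eq_bigr => i _; rewrite derive_row //; exact: dF.
Qed.

End Composition.

(** * Directional derivatives as operators, and bilinear forms *)

(*%%B2*)
HB.lock Definition dd (R : realType) (n : nat) (f : 'rV[R]_n -> R) (v x : 'rV[R]_n) : R :=
  'D_v (f : 'rV[R]_n -> R^o) x.

Definition ddv (R : realType) (n p : nat) (X : 'rV[R]_n -> 'rV[R]_p)
    (v x : 'rV[R]_n) : 'rV[R]_p :=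
  \row_k dd (fun y => X y 0 k) v x.

Definition ddm (R : realType) (n p : nat) (A : 'rV[R]_n -> 'M[R]_p)
    (v x : 'rV[R]_n) : 'M[R]_p :=
  \matrix_(i, j) dd (fun y => A y i j) v x.

(** The double sum is the form that gets differentiated; [bil_mul] gives the matrix form, from which
    bilinearity follows. *)
Definition bil (R : realType) (p : nat) (A : 'M[R]_p) (u v : 'rV[R]_p) : R :=
  \sum_i \sum_j u 0 i * A i j * v 0 j.

Section Bilinear.
Context {R : realType} {p : nat}.
Implicit Types (A : 'M[R]_p) (u v w : 'rV[R]_p).

Lemma bil_mul A u v : bil A u v = (u *m A *m v^T) 0 0.
Proof.
rewrite mxE /bil exchange_big; apply: eq_bigr => j _.
by rewrite !mxE mulr_suml; apply: eq_bigr => i _.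
Qed.

Lemma bilDl A u v w : bil A (u + v) w = bil A u w + bil A v w.
Proof. by rewrite !bil_mul !mulmxDl mxE. Qed.

Lemma bilDr A u v w : bil A w (u + v) = bil A w u + bil A w v.
Proof. by rewrite !bil_mul linearD mulmxDr mxE. Qed.

Lemma bilZl A (a : R) u v : bil A (a *: u) v = a * bil A u v.
Proof. by rewrite !bil_mul -!scalemxAl mxE. Qed.

Lemma bilZr A (a : R) u v : bil A u (a *: v) = a * bil A u v.
Proof. by rewrite !bil_mul linearZ -scalemxAr mxE. Qed.

Lemma bilNl A u v : bil A (- u) v = - bil A u v.
Proof. by rewrite -scaleN1r bilZl mulN1r. Qed.

Lemma bilNr A u v : bil A u (- v) = - bil A u v.
Proof. by rewrite -scaleN1r bilZr mulN1r. Qed.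

Lemma bilBl A u v w : bil A (u - v) w = bil A u w - bil A v w.
Proof. by rewrite bilDl bilNl. Qed.

Lemma bilBr A u v w : bil A w (u - v) = bil A w u - bil A w v.
Proof. by rewrite bilDr bilNr. Qed.

Lemma bil0l A v : bil A 0 v = 0.
Proof. by rewrite -(scale0r 0) bilZl mul0r. Qed.

Lemma bil0r A v : bil A v 0 = 0.
Proof. by rewrite -(scale0r 0) bilZr mul0r. Qed.

Lemma bil_suml A (I : finType) (F : I -> 'rV[R]_p) v :
  bil A (\sum_i F i) v = \sum_i bil A (F i) v.
Proof.
by elim/big_rec2: _ => [|i a b _ <-]; rewrite ?bil0l // bilDl.
Qed.

Lemma bil_sumr A (I : finType) (F : I -> 'rV[R]_p) v :
  bil A v (\sum_i F i) = \sum_i bil A v (F i).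
Proof.
by elim/big_rec2: _ => [|i a b _ <-]; rewrite ?bil0r // bilDr.
Qed.

Lemma bil_delta A i j : bil A (delta_mx 0 i) (delta_mx 0 j) = A i j.
Proof. by rewrite bil_mul -rowE trmx_delta -colE !mxE. Qed.

Lemma bil_addm A B u v : bil (A + B) u v = bil A u v + bil B u v.
Proof. by rewrite !bil_mul mulmxDr mulmxDl mxE. Qed.

Lemma bil_scalem (a : R) A u v : bil (a *: A) u v = a * bil A u v.
Proof. by rewrite !bil_mul -scalemxAr -scalemxAl mxE. Qed.

Lemma bil_tr A u v : bil A^T u v = bil A v u.
Proof.
rewrite /bil exchange_big; apply: eq_bigr => i _; apply: eq_bigr => j _.
by rewrite mxE mulrC mulrA mulrAC.
Qed.

End Bilinear.

Section DirectionalDerivative.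
Context {R : realType} {n : nat}.
Local Notation V := 'rV[R]_n.
Variable U : set V.
Hypothesis oU : open U.
Implicit Types (f g : V -> R) (x : V).

Lemma ddE f v x : dd f v x = 'D_v (f : V -> R^o) x.
Proof. by rewrite dd.unlock. Qed.

Lemma dd_funE f v : dd f v = 'D_v (f : V -> R^o).
Proof. by apply/funext => x; exact: ddE. Qed.

Lemma smooth_dd f v : smooth U f -> smooth U (dd f v).
Proof. by rewrite dd_funE; exact: smooth_derive. Qed.

Lemma dd_near f g v x : (\forall y \near x, f y = g y) -> dd f v x = dd g v x.
Proof. by rewrite !ddE; exact: near_eq_derive. Qed.

Lemma dd_ext f g v x : (forall y, U y -> f y = g y) -> U x -> dd f v x = dd g v x.
Proof. by move=> fg Ux; apply: dd_near; apply: filterS (near_open oU Ux). Qed.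

Lemma ddD f g v x : smooth U f -> smooth U g -> U x ->
  dd (fun y => f y + g y) v x = dd f v x + dd g v x.
Proof.
by move=> sf sg Ux; rewrite !ddE derivativeD //;
  [exact: smooth_differentiable sf Ux|exact: smooth_differentiable sg Ux].
Qed.

Lemma ddB f g v x : smooth U f -> smooth U g -> U x ->
  dd (fun y => f y - g y) v x = dd f v x - dd g v x.
Proof.
by move=> sf sg Ux; rewrite !ddE derivativeB //;
  [exact: smooth_differentiable sf Ux|exact: smooth_differentiable sg Ux].
Qed.

Lemma ddM f g v x : smooth U f -> smooth U g -> U x ->
  dd (fun y => f y * g y) v x = dd f v x * g x + f x * dd g v x.
Proof.
by move=> sf sg Ux; rewrite !ddE derivativeM //;
  [exact: smooth_differentiable sf Ux|exact: smooth_differentiable sg Ux].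
Qed.

Lemma dd_cst (c : R) v x : dd (fun=> c) v x = 0.
Proof. by rewrite ddE; exact: (@derive_cst R V R^o c x v). Qed.

Lemma ddZ (c : R) f v x : smooth U f -> U x ->
  dd (fun y => c * f y) v x = c * dd f v x.
Proof.
move=> sf Ux; rewrite (ddM (f := fun=> c)) // ?dd_cst ?mul0r ?add0r //.
exact: smooth_cst.
Qed.

Lemma dd_sum (I : finType) (F : I -> V -> R) v x :
  (forall i, smooth U (F i)) -> U x ->
  dd (fun y => \sum_i F i y) v x = \sum_i dd (F i) v x.
Proof.
move=> sF Ux; rewrite ddE.
have dF i : differentiable (F i) x := smooth_differentiable (sF i) Ux.
apply: etrans (derivative_sum v dF).2 _.
by apply: eq_bigr => i _; rewrite ddE.
Qed.

Lemma dd_linear f u v x (a b : R) : smooth U f -> U x ->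
  dd f (a *: u + b *: v) x = a * dd f u x + b * dd f v x.
Proof.
move=> sf Ux; rewrite !ddE; apply: derive_linear.
exact: smooth_differentiable sf Ux.
Qed.

Lemma dd_comm f u v x : smooth U f -> U x -> dd (dd f v) u x = dd (dd f u) v x.
Proof. by move=> sf Ux; rewrite !dd_funE; exact: derive_comm sf Ux. Qed.

Lemma dd_coord_sum f v x : smooth U f -> U x ->
  dd f v x = \sum_k v 0 k * dd f (delta_mx 0 k) x.
Proof.
move=> sf Ux; rewrite ddE derive_coord_sum; last exact: smooth_differentiable sf Ux.
by apply: eq_bigr => k _; rewrite ddE.
Qed.

Section Fields.
Context {p : nat}.
Local Notation W := 'rV[R]_p.
Implicit Types (X Y : V -> W) (A : V -> 'M[R]_p).

Definition smoothm A := forall i j, smooth U (fun x => A x i j).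

Lemma ddvE X v x k : ddv X v x 0 k = dd (fun y => X y 0 k) v x.
Proof. by rewrite mxE. Qed.

Lemma derive_ddv X v x : smoothv U X -> U x -> 'D_v X x = ddv X v x.
Proof.
move=> sX Ux; apply/rowP => k; rewrite [RHS]ddvE [RHS]ddE.
exact: derive_smoothv sX Ux.
Qed.

Lemma smoothv_ddv X v : smoothv U X -> smoothv U (ddv X v).
Proof.
move=> sX k; apply: smooth_ext (smooth_dd v (sX k)) => // x _.
by rewrite mxE.
Qed.

Lemma smoothv_cst (w : W) : smoothv U (fun=> w).
Proof. by move=> k; exact: smooth_cst. Qed.

Lemma smoothvD X Y : smoothv U X -> smoothv U Y -> smoothv U (fun x => X x + Y x).
Proof.
move=> sX sY k; apply: smooth_ext (smoothD oU (sX k) (sY k)) => // x _.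
by rewrite mxE.
Qed.

Lemma smoothvZ f X : smooth U f -> smoothv U X -> smoothv U (fun x => f x *: X x).
Proof.
move=> sf sX k; apply: smooth_ext (smoothM oU sf (sX k)) => // x _.
by rewrite mxE.
Qed.

Lemma smoothvB X Y : smoothv U X -> smoothv U Y -> smoothv U (fun x => X x - Y x).
Proof.
move=> sX sY k; apply: smooth_ext (smoothB oU (sX k) (sY k)) => // x _.
by rewrite !mxE.
Qed.

Lemma ddv_ext X Y v x : (forall y, U y -> X y = Y y) -> U x -> ddv X v x = ddv Y v x.
Proof.
by move=> XY Ux; apply/rowP => k; rewrite !mxE; apply: dd_ext => // y Uy; rewrite XY.
Qed.

Lemma ddvD X Y v x : smoothv U X -> smoothv U Y -> U x ->
  ddv (fun y => X y + Y y) v x = ddv X v x + ddv Y v x.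
Proof.
move=> sX sY Ux; apply/rowP => k; rewrite !mxE -ddD //.
by apply: dd_ext => // y _; rewrite mxE.
Qed.

Lemma ddvB X Y v x : smoothv U X -> smoothv U Y -> U x ->
  ddv (fun y => X y - Y y) v x = ddv X v x - ddv Y v x.
Proof.
move=> sX sY Ux; apply/rowP => k; rewrite !mxE -ddB //.
by apply: dd_ext => // y _; rewrite !mxE.
Qed.

Lemma ddvZ f X v x : smooth U f -> smoothv U X -> U x ->
  ddv (fun y => f y *: X y) v x = dd f v x *: X x + f x *: ddv X v x.
Proof.
move=> sf sX Ux; apply/rowP => k; rewrite !mxE -ddM //.
by apply: dd_ext => // y _; rewrite !mxE.
Qed.

Lemma ddv_cst (w : W) v x : ddv (fun=> w) v x = 0.
Proof. by apply/rowP => k; rewrite !mxE dd_cst. Qed.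

Lemma ddv_linear X u v x (a b : R) : smoothv U X -> U x ->
  ddv X (a *: u + b *: v) x = a *: ddv X u x + b *: ddv X v x.
Proof. by move=> sX Ux; apply/rowP => k; rewrite !mxE dd_linear. Qed.

Lemma ddv_comm X u v x : smoothv U X -> U x ->
  ddv (ddv X v) u x = ddv (ddv X u) v x.
Proof.
move=> sX Ux; apply/rowP => k; rewrite !mxE.
have e w : forall y, U y -> ddv X w y 0 k = dd (fun z => X z 0 k) w y.
  by move=> y _; rewrite mxE.
by rewrite (dd_ext _ (e v)) // (dd_ext _ (e u)) // dd_comm.
Qed.

Lemma ddm_linear A u v x (a b : R) : smoothm A -> U x ->
  ddm A (a *: u + b *: v) x = a *: ddm A u x + b *: ddm A v x.
Proof. by move=> sA Ux; apply/matrixP => i j; rewrite !mxE dd_linear. Qed.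

Lemma smoothm_ddm A v : smoothm A -> smoothm (ddm A v).
Proof.
move=> sA i j; apply: smooth_ext (smooth_dd v (sA i j)) => // x _.
by rewrite mxE.
Qed.

Lemma ddm_comm A u v x : smoothm A -> U x -> ddm (ddm A v) u x = ddm (ddm A u) v x.
Proof.
move=> sA Ux; apply/matrixP => i j; rewrite !mxE.
have e w : forall y, U y -> ddm A w y i j = dd (fun z => A z i j) w y.
  by move=> y _; rewrite mxE.
by rewrite (dd_ext _ (e v)) // (dd_ext _ (e u)) // dd_comm.
Qed.

Lemma smooth_bil A X Y : smoothm A -> smoothv U X -> smoothv U Y ->
  smooth U (fun x => bil (A x) (X x) (Y x)).
Proof.
move=> sA sX sY; apply: smooth_sum => // i _; apply: smooth_sum => // j _.
by apply: smoothM => //; apply: smoothM.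
Qed.

Lemma dd_bil A X Y v x : smoothm A -> smoothv U X -> smoothv U Y -> U x ->
  dd (fun y => bil (A y) (X y) (Y y)) v x =
  bil (ddm A v x) (X x) (Y x) + bil (A x) (ddv X v x) (Y x)
  + bil (A x) (X x) (ddv Y v x).
Proof.
move=> sA sX sY Ux; rewrite /bil.
have s1 i j : smooth U (fun y => X y 0 i * A y i j) by apply: smoothM.
have s2 i j : smooth U (fun y => X y 0 i * A y i j * Y y 0 j) by apply: smoothM.
rewrite dd_sum // => [|i]; last by apply: smooth_sum.
rewrite -!big_split; apply: eq_bigr => i _ /=.
rewrite dd_sum // -!big_split; apply: eq_bigr => j _ /=.
by rewrite !ddM // !mxE; ring.
Qed.

Lemma dd_bil_cst A (a b : W) v x : smoothm A -> U x ->
  dd (fun y => bil (A y) a b) v x = bil (ddm A v x) a b.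
Proof.
move=> sA Ux; rewrite (dd_bil (X := fun=> a) (Y := fun=> b)) //; try exact: smoothv_cst.
by rewrite !ddv_cst bil0l bil0r !addr0.
Qed.

Lemma bil_ddm_sym A v x : smoothm A -> (forall y, U y -> (A y)^T = A y) -> U x ->
  (ddm A v x)^T = ddm A v x.
Proof.
move=> sA tA Ux; apply/matrixP => i j; rewrite !mxE; apply: dd_ext => // y Uy.
by rewrite -[in LHS]tA // mxE.
Qed.

End Fields.

(** Cramer's rule: cofactors and the determinant are polynomials in the entries. *)
Lemma smoothm_invmx {p} (A : V -> 'M[R]_p) : smoothm A ->
  (forall x, U x -> A x \in unitmx) -> smoothm (fun x => invmx (A x)).
Proof.
move=> sA uA i j.
have sdet q (B : V -> 'M[R]_q) : (forall i j, smooth U (fun x => B x i j)) ->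
    smooth U (fun x => \det (B x)).
  move=> sB; apply: smooth_sum => // s _; apply: smoothM => //; first exact: smooth_cst.
  by apply: smooth_prod.
have sinv : smooth U (fun x => (\det (A x))^-1).
  apply: smoothV => //; last exact: sdet.
  by move=> x /uA; rewrite unitmxE unitfE.
have scof : smooth U (fun x => cofactor (A x) j i).
  rewrite /cofactor; apply: smoothM => //; first exact: smooth_cst.
  apply: sdet => k l; apply: smooth_ext (sA (lift j k) (lift i l)) => // x _.
  by rewrite !mxE.
apply: smooth_ext (smoothM oU sinv scof) => // x Ux.
by rewrite /invmx uA // !mxE.
Qed.

End DirectionalDerivative.

Section ComposedDerivative.
Context {R : realType} {n p : nat}.
Variables (U : set 'rV[R]_n) (U' : set 'rV[R]_p) (F : 'rV[R]_n -> 'rV[R]_p).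
Hypotheses (oU : open U) (oU' : open U').
Hypothesis dF : forall x, U x -> differentiable F x.
Hypothesis sF : smoothv U F.
Hypothesis FU : forall x, U x -> U' (F x).

Lemma dd_compose f v x : smooth U' f -> U x ->
  dd (fun y => f (F y)) v x = dd f (ddv F v x) (F x).
Proof.
move=> sf Ux; rewrite !ddE -(derive_ddv v sF Ux).
exact: (derive_compose dF FU).
Qed.

Lemma ddm_compose q (A : 'rV[R]_p -> 'M[R]_q) v x :
  (forall i j, smooth U' (fun y => A y i j)) -> U x ->
  ddm (fun y => A (F y)) v x = ddm A (ddv F v x) (F x).
Proof.
move=> sA Ux; apply/matrixP => i j; rewrite !mxE.
exact: (dd_compose v (sA i j) Ux).
Qed.

End ComposedDerivative.

(** * Linear differential equations: Picard iteration and a Gronwall bound *)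

(*%%B3*)
Section MatrixNorm.
Context {R : realType}.

Lemma norm_mx_le m n (M : 'M[R]_(m, n)) (c : R) : 0 <= c ->
  (forall i j, `|M i j| <= c) -> `|M| <= c.
Proof.
by move=> c0 h; rewrite /Num.Def.normr/= mx_normrE bigmax_le // => -[i j] _.
Qed.

Lemma entry_le_norm m n (M : 'M[R]_(m, n)) i j : `|M i j| <= `|M|.
Proof.
rewrite [leRHS]/Num.Def.normr/= mx_normrE.
exact: (le_bigmax _ (fun ij => `|M ij.1 ij.2|) (i, j)).
Qed.

Lemma norm_mulmx m n p (A : 'M[R]_(m, n)) (B : 'M[R]_(n, p)) :
  `|A *m B| <= n%:R * `|A| * `|B|.
Proof.
apply: norm_mx_le => [|i j]; first by rewrite !mulr_ge0.
rewrite mxE; apply: le_trans (ler_norm_sum _ _ _) _.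
have -> : n%:R * `|A| * `|B| = \sum_(k < n) `|A| * `|B|.
  by rewrite sumr_const card_ord -mulrA mulr_natl.
by apply: ler_sum => k _; rewrite normrM ler_pM ?entry_le_norm.
Qed.

End MatrixNorm.

Section Picard.
Context {R : realType}.

Lemma le0_geometric (x C : R) : 0 <= C -> (forall k, x <= C / 2 ^+ k) -> x <= 0.
Proof.
move=> C0 h; rewrite leNgt; apply/negP => x0.
have := upper_nthrootP (leqnn (Num.Def.archi_bound (C / x))).
set k := Num.Def.archi_bound _ => hk.
move: hk; rewrite ltr_pdivrMr // => hk.
by have := h k; rewrite ler_pdivlMr ?exprn_gt0 // leNgt mulrC hk.
Qed.

(** The bounds u k - 2 C / 2^k increase, the bounds u k + 2 C / 2^k decrease and the former stay
    below the latter; the limit is the supremum of the lower ones. *)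
Lemma geometric_limit (u : nat -> R) (C : R) : 0 <= C ->
  (forall k, `|u k.+1 - u k| <= C / 2 ^+ k) ->
  exists l, forall k, `|l - u k| <= 2 * C / 2 ^+ k.
Proof.
move=> C0 h.
pose lo k := u k - 2 * C / 2 ^+ k; pose hi k := u k + 2 * C / 2 ^+ k.
have step k : 2 * C / 2 ^+ k = C / 2 ^+ k + 2 * C / 2 ^+ k.+1.
  by rewrite exprS; field; rewrite expf_neq0.
have loS k : lo k <= lo k.+1.
  have := h k; rewrite ler_norml => /andP[h1 _].
  by rewrite /lo (step k); lra.
have hiS k : hi k.+1 <= hi k.
  have := h k; rewrite ler_norml => /andP[_ h2].
  by rewrite /hi (step k); lra.
have lo_mono j k : (j <= k)%N -> lo j <= lo k.
  elim: k => [|k IH]; first by rewrite leqn0 => /eqP ->.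
  by rewrite leq_eqVlt => /orP[/eqP -> //|jk]; exact: le_trans (IH jk) (loS k).
have hi_mono j k : (j <= k)%N -> hi k <= hi j.
  elim: k => [|k IH]; first by rewrite leqn0 => /eqP ->.
  by rewrite leq_eqVlt => /orP[/eqP -> //|jk]; exact: le_trans (hiS k) (IH jk).
have lohi j k : lo j <= hi k.
  apply: le_trans (lo_mono j (maxn j k) (leq_maxl _ _)) _.
  apply: le_trans _ (hi_mono k (maxn j k) (leq_maxr _ _)).
  have e0 : 0 <= 2 * C / 2 ^+ maxn j k by rewrite divr_ge0 ?mulr_ge0 ?exprn_ge0.
  by rewrite /lo /hi; lra.
have ub k : ubound (range lo) (hi k) by move=> _ [j _ <-].
exists (sup (range lo)) => k; rewrite ler_norml; apply/andP; split.
  have : lo k <= sup (range lo).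
    apply: (@ub_le_sup R (range lo)); last by exists k.
    by exists (hi 0%N).
  by rewrite /lo; lra.
have : sup (range lo) <= hi k by apply: ge_sup => //; exists (lo 0%N), 0%N.
by rewrite /hi; lra.
Qed.

Definition clamp (a b t : R) : R := Num.max a (Num.min t b).

Lemma clamp_id a b t : a <= t <= b -> clamp a b t = t.
Proof. by move=> /andP[h1 h2]; rewrite /clamp min_l // max_r. Qed.

Lemma clamp_in a b t : a <= b -> a <= clamp a b t <= b.
Proof.
move=> ab; rewrite /clamp le_max lexx /= ge_max ab /=.
by rewrite ge_min lexx orbT.
Qed.

Lemma continuous_clamp a b : continuous (clamp a b).
Proof.
move=> t; apply: (@continuous_max R R (fun=> a) (fun t => Num.min t b) t).
  exact: cst_continuous.
by apply: (@continuous_min R R id (fun=> b) t); [exact: cvg_id|exact: cst_continuous].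
Qed.

(** The integral from -3, shifted to vanish at 0. The base point -3 leaves a margin to the left of
    [-2, 2], where equations are solved. *)
Lemma primitive_exists (f : R -> R) : continuous f ->
  exists F : R -> R, F 0 = 0 /\ forall t : R, -3 < t -> is_derive t 1 (F : R -> R^o) (f t).
Proof.
move=> cf.
pose F0 (x : R) : R := (\int[lebesgue_measure]_(t in `[(-3)%R, x]) f t)%R.
exists (fun x => F0 x - F0 0); split=> [|t t3]; first by rewrite subrr.
have int_f : lebesgue_measure.-integrable `[-3, t + 1] (EFin \o f).
  apply: continuous_compact_integrable; first exact: segment_compact.
  exact: continuous_subspaceT.
have tt : t < t + 1 by rewrite ltrDl.
have [dF F'] := continuous_FTC1_closed tt int_f t3 (cf t).
rewrite -[f t]subr0; apply: (@is_deriveB R R^o R^o F0 (fun=> F0 0)).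
by apply: DeriveDef => //; rewrite -derive1E.
Qed.

Definition prim (f : R -> R) : R -> R :=
  if pselect (continuous f) is left cf then sval (cid (primitive_exists cf)) else f.

Lemma primP (f : R -> R) : continuous f ->
  prim f 0 = 0 /\ forall t : R, -3 < t -> is_derive t 1 (prim f : R -> R^o) (f t).
Proof. by rewrite /prim => cf; case: pselect => // c; case: cid. Qed.

(* A function vanishing at 0 whose derivative is bounded by [e] is bounded by
   [e * |t|]. *)
Lemma derivative_bound (D : R -> R) (D' : R -> R) (e t : R) : 0 <= e ->
  D 0 = 0 ->
  (forall s : R, `|s| <= `|t| -> is_derive s 1 (D : R -> R^o) (D' s)) ->
  (forall s : R, `|s| <= `|t| -> `|D' s| <= e) -> `|D t| <= e * `|t|.
Proof.
move=> e0 D0 dD D'e.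
have cD (i : interval R) : (forall s, s \in i -> `|s| <= `|t|) ->
    {within [set` i], continuous D}.
  move=> hi; apply: (@derivable_within_continuous R R^o) => s /hi hs.
  by have [] := dD s hs.
case: (ltgtP t 0) => [t0|t0|->]; last by rewrite D0 !normr0 mulr0.
- have sub s : s \in `[t, 0] -> `|s| <= `|t|.
    rewrite in_itv /= => /andP[ts s0].
    by rewrite (ler0_norm s0) (ltr0_norm t0) lerN2.
  have [s sI||c cI] := @MVT R D D' t 0 t0.
  + by apply: dD; apply: sub; exact: subset_itv_oo_cc sI.
  + exact: cD.
  + rewrite D0 !sub0r => /(congr1 Num.norm); rewrite normrN normrM normrN => ->.
    by apply: ler_wpM2r => //; apply: D'e; apply: sub; exact: subset_itv_oo_cc cI.
- have sub s : s \in `[0, t] -> `|s| <= `|t|.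
    rewrite in_itv /= => /andP[s0 st].
    by rewrite (ger0_norm s0) (gtr0_norm t0).
  have [s sI||c cI] := @MVT R D D' 0 t t0.
  + by apply: dD; apply: sub; exact: subset_itv_oo_cc sI.
  + exact: cD.
  + rewrite D0 !subr0 => ->; rewrite normrM.
    by apply: ler_wpM2r => //; apply: D'e; apply: sub; exact: subset_itv_oo_cc cI.
Qed.

(** By the mean value theorem a bound m on |D| over [0, 1] improves to m / 2 + e; iterating drives
    it to the fixed point 2 e. *)
Lemma gronwall N (D D' : R -> 'rV[R]_N) (e : R) : 0 <= e -> D 0 = 0 ->
  (forall (s : R) a, 0 <= s <= 1 -> is_derive s 1 (fun s => D s 0 a : R^o) (D' s 0 a)) ->
  (forall s : R, 0 <= s <= 1 -> `|D' s| <= 2^-1 * `|D s| + e) ->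
  forall s : R, 0 <= s <= 1 -> `|D s| <= 2 * e.
Proof.
move=> e0 D0 dD D'e.
have [m0 m00 hm0] : exists2 m0, 0 <= m0 & forall s : R, 0 <= s <= 1 -> `|D s| <= m0.
  have bnd a : exists2 m0, 0 <= m0 & forall s : R, 0 <= s <= 1 -> `|D s 0 a| <= m0.
    have cD : {within `[0, 1], continuous (fun s => `|D s 0 a| : R)}.
      have c1 : {within `[0, 1], continuous (fun s => D s 0 a : R^o)}.
        apply: (@derivable_within_continuous R R^o) => s; rewrite in_itv /= => sI.
        by have [] := dD s a sI.
      move=> s; apply: (@continuous_comp _ _ _ _ (fun x : R => `|x|)); first exact: c1.
      exact: norm_continuous.
    have [c cI hc] := EVT_max ler01 cD.
    by exists `|D c 0 a| => // s sI; apply: hc; rewrite in_itv.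
  have {}bnd a := cid2 (bnd a).
  exists (\sum_a s2val (bnd a)) => [|s sI].
    by apply: sumr_ge0 => a _; exact: s2valP (bnd a).
  have m0a a : 0 <= s2val (bnd a) := s2valP (bnd a).
  apply: norm_mx_le => [|i a]; first exact: sumr_ge0.
  rewrite ord1; apply: le_trans (s2valP' (bnd a) s sI) _.
  by rewrite (bigD1 a) //= lerDl sumr_ge0.
have improve m : 0 <= m -> (forall s : R, 0 <= s <= 1 -> `|D s| <= m) ->
    forall s : R, 0 <= s <= 1 -> `|D s| <= 2^-1 * m + e.
  move=> mp hm s /andP[s0 s1].
  have h0 : 0 <= 2^-1 * m + e by rewrite addr_ge0 // mulr_ge0 // invr_ge0.
  apply: norm_mx_le => // i a; rewrite ord1.
  case: (ltgtP s 0) s0 => // [s0 _|-> _]; last by rewrite D0 mxE normr0.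
  have sub r : r \in `[0, s] -> 0 <= r <= 1.
    by rewrite in_itv /= => /andP[-> /le_trans]; apply.
  have [r rI||c cI] := @MVT R (fun s => D s 0 a) (fun s => D' s 0 a) 0 s s0.
  - by apply: dD; apply: sub; exact: subset_itv_oo_cc rI.
  - apply: (@derivable_within_continuous R R^o) => r rI.
    by have [] := dD r a (sub r rI).
  have cI' := sub c (subset_itv_oo_cc cI).
  rewrite D0 mxE !subr0 => ->; rewrite normrM (gtr0_norm s0).
  apply: (@le_trans _ _ `|D' c|).
    by apply: le_trans (entry_le_norm (D' c) 0 a); rewrite ler_piMr.
  apply: le_trans (D'e c cI') _; rewrite lerD2r ler_wpM2l ?invr_ge0 //.
  exact: hm.
have iter k s : 0 <= s <= 1 -> `|D s| <= 2 * e + m0 / 2 ^+ k.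
  elim: k s => [|k IH] s sI.
    by rewrite expr0 divr1; apply: le_trans (hm0 s sI) _; rewrite lerDr mulr_ge0.
  have p0 : 0 <= 2 * e + m0 / 2 ^+ k by rewrite addr_ge0 ?mulr_ge0 // invr_ge0 exprn_ge0.
  apply: le_trans (improve _ p0 IH s sI) _.
  by rewrite le_eqVlt; apply/orP; left; apply/eqP; rewrite exprS; field; rewrite expf_neq0.
move=> s sI; rewrite -subr_le0; apply: (le0_geometric m00) => k.
by rewrite lerBlDl; exact: iter.
Qed.

Lemma continuous_sumr (I : Type) (r : seq I) (F : I -> R -> R) :
  (forall i, continuous (F i)) -> continuous (fun t => \sum_(i <- r) F i t).
Proof.
move=> cF t; elim: r => [|i r IH].
  have -> : (fun t => \sum_(i <- [::]) F i t) = (fun=> 0 : R).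
    by apply/funext => s; rewrite big_nil.
  exact: cst_continuous.
have -> : (fun t => \sum_(j <- i :: r) F j t) =
    (fun t => F i t + \sum_(j <- r) F j t).
  by apply/funext => s; rewrite big_cons.
exact: (@continuousD R R^o R (F i) (fun t => \sum_(j <- r) F j t) t (cF i t) IH).
Qed.

(** Picard iteration on [-2, 2]. The smallness of [d] makes the integral operator halve distances,
    and clamping the time makes the estimates valid for every real t. *)
Lemma linear_ode N (M : R -> 'M[R]_N) (y0 : 'rV[R]_N) (d : R) :
  (forall a b, continuous (fun t => M t a b : R)) ->
  (forall t, `|M t| <= d) -> 0 <= d -> 2 * (N%:R * d) <= 2^-1 ->
  exists y : R -> 'rV[R]_N, y 0 = y0 /\
    forall (t : R) a, -2 < t < 2 -> is_derive t 1 (fun t => y t 0 a : R^o) ((y t *m M t) 0 a).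
Proof.
move=> cM Md d0 hd.
pose cl := clamp (-2) 2.
have clI t : -2 <= cl t <= 2 by apply: clamp_in; lra.
have cl3 t : -3 < cl t by have /andP[h _] := clI t; apply: lt_le_trans h; lra.
have cln t : `|cl t| <= 2 by rewrite ler_norml; exact: clI.
pose good (y : R -> 'rV[R]_N) := forall a, continuous (fun t => y t 0 a : R).
pose rhs (y : R -> 'rV[R]_N) a t := (y t *m M t) 0 a.
have crhs y a : good y -> continuous (rhs y a).
  move=> gy t; rewrite /rhs.
  have -> : (fun t => (y t *m M t) 0 a) = (fun t => \sum_b y t 0 b * M t b a).
    by apply/funext => s; rewrite mxE.
  apply: continuous_sumr => b r.
  exact: (@continuousM R R (fun t => y t 0 b) (fun t => M t b a) r (gy b r) (cM b a r)).
pose Phi (y : R -> 'rV[R]_N) t : 'rV[R]_N := \row_a (y0 0 a + prim (rhs y a) (cl t)).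
have gPhi y : good y -> good (Phi y).
  move=> gy a t.
  have -> : (fun t => Phi y t 0 a) = (fun t => y0 0 a + (prim (rhs y a) \o cl) t).
    by apply/funext => s; rewrite mxE.
  have [_ dP] := primP (crhs y a gy).
  have c1 : {for t, continuous (prim (rhs y a) \o cl)}.
    apply: continuous_comp; first exact: continuous_clamp.
    have [dv _] := dP _ (cl3 t).
    by apply: differentiable_continuous; apply/derivable1_diffP.
  have c0 : {for t, continuous (fun=> y0 0 a : R)} by exact: cst_continuous.
  exact: (@continuousD R R^o R _ _ t c0 c1).
have PhiL y z C : good y -> good z -> 0 <= C ->
    (forall t, `|y t - z t| <= C) -> forall t, `|Phi y t - Phi z t| <= C / 2.
  move=> gy gz C0 yz t; apply: norm_mx_le => [|i a]; first by rewrite divr_ge0.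
  rewrite !mxE opprD addrACA subrr add0r.
  have [P0 dP] := primP (crhs y a gy); have [Q0 dQ] := primP (crhs z a gz).
  have in3 s : `|s| <= `|cl t| -> -3 < s.
    move=> /le_trans/(_ (cln t)); rewrite ler_norml => /andP[h _].
    by apply: lt_le_trans h; lra.
  have := @derivative_bound (fun s => prim (rhs y a) s - prim (rhs z a) s)
     (fun s => rhs y a s - rhs z a s) (N%:R * C * d) (cl t).
  rewrite P0 Q0 subrr => /(_ _ erefl) h.
  apply: le_trans (h _ _ _) _.
  - by rewrite !mulr_ge0.
  - by move=> s /in3 s3; apply: is_deriveB; [exact: dP|exact: dQ].
  - move=> s _; rewrite /rhs.
    have -> : (y s *m M s) 0 a - (z s *m M s) 0 a = ((y s - z s) *m M s) 0 a.
      by rewrite mulmxBl !mxE.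
    apply: le_trans (entry_le_norm _ _ _) _; apply: le_trans (norm_mulmx _ _) _.
    by rewrite -!mulrA ler_wpM2l // ler_pM.
  - apply: le_trans (ler_wpM2l _ (cln t)) _; first by rewrite !mulr_ge0.
    have -> : N%:R * C * d * 2 = C * (2 * (N%:R * d)) by ring.
    by rewrite ler_wpM2l.
pose ys := fix ys k := if k is k'.+1 then Phi (ys k') else fun=> y0.
have gys k : good (ys k).
  by elim: k => [|k IH] /=; [move=> a t; exact: cst_continuous|exact: gPhi].
have [C0 C0p hC0] : exists2 C : R, 0 <= C & forall t, `|ys 1%N t - ys 0%N t| <= C.
  exists (2 * (N%:R * `|y0| * d)) => [|t]; first by rewrite !mulr_ge0.
  apply: norm_mx_le => [|i a]; first by rewrite !mulr_ge0.
  rewrite !mxE ord1 addrAC subrr add0r /=.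
  have [P0 dP] := primP (crhs (fun=> y0) a (gys 0%N)).
  have in3 s : `|s| <= `|cl t| -> -3 < s.
    move=> /le_trans/(_ (cln t)); rewrite ler_norml => /andP[h _].
    by apply: lt_le_trans h; lra.
  apply: le_trans (@derivative_bound _ _ (N%:R * `|y0| * d) (cl t) _ P0 _ _) _.
  - by rewrite !mulr_ge0.
  - by move=> s /in3 s3; exact: dP.
  - move=> s _; apply: le_trans (entry_le_norm _ _ _) _; apply: le_trans (norm_mulmx _ _) _.
    by rewrite -!mulrA ler_wpM2l // ler_wpM2l.
  - by rewrite mulrC ler_wpM2r // !mulr_ge0.
have stepC k t : `|ys k.+1 t - ys k t| <= C0 / 2 ^+ k.
  elim: k t => [|k IH] t; first by rewrite expr0 divr1.
  have q0 : 0 <= C0 / 2 ^+ k by rewrite divr_ge0 ?exprn_ge0.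
  have := PhiL _ _ _ (gys k.+1) (gys k) q0 IH t.
  by rewrite exprS invfM mulrA mulrAC.
have lim t a : exists l, forall k, `|l - ys k t 0 a| <= 2 * C0 / 2 ^+ k.
  apply: geometric_limit => // k; apply: le_trans (stepC k t).
  by apply: le_trans (entry_le_norm _ 0 a); rewrite !mxE.
pose y t : 'rV[R]_N := \row_a sval (cid (lim t a)).
have yk k t : `|y t - ys k t| <= 2 * C0 / 2 ^+ k.
  apply: norm_mx_le => [|i a]; first by rewrite divr_ge0 ?mulr_ge0 ?exprn_ge0.
  by rewrite !mxE ord1; case: cid.
have gy : good y.
  move=> a t; apply/(@cvgrPdist_le R R^o) => e e0.
  have [k hk] : exists k, 2 * C0 / 2 ^+ k <= e / 3.
    apply: contrapT => /forallNP hk.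
    have : e / 3 <= 0.
      apply: (@le0_geometric _ (2 * C0)) => [|k]; first by rewrite mulr_ge0.
      by rewrite ltW // ltNge; apply/negP; exact: hk.
    by rewrite leNgt divr_gt0.
  have e3 : 0 < e / 3 by rewrite divr_gt0.
  have := gys k a t; move/(@cvgrPdist_le R R^o) => /(_ _ e3).
  apply: filterS => s hs.
  have ya r : `|y r 0 a - ys k r 0 a| <= e / 3.
    by apply: le_trans hk; apply: le_trans (yk k r); apply: le_trans (entry_le_norm _ 0 a); rewrite !mxE.
  have -> : y t 0 a - y s 0 a = (y t 0 a - ys k t 0 a) + (ys k t 0 a - ys k s 0 a)
     - (y s 0 a - ys k s 0 a) by ring.
  have -> : e = e / 3 + e / 3 + e / 3 by field.
  apply: le_trans (ler_normB _ _) _; apply: lerD => //.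
  by apply: le_trans (ler_normD _ _) _; apply: lerD.
have Py t : Phi y t = y t.
  apply/eqP; rewrite -subr_eq0 -normr_le0; apply: (@le0_geometric _ (2 * C0)) => [|k].
    by rewrite mulr_ge0.
  have q0 : 0 <= 2 * C0 / 2 ^+ k by rewrite divr_ge0 ?mulr_ge0 ?exprn_ge0.
  have h1 := PhiL _ _ _ gy (gys k) q0 (yk k) t.
  have h2 := yk k.+1 t.
  have -> : Phi y t - y t = (Phi y t - Phi (ys k) t) - (y t - ys k.+1 t).
    by rewrite /= opprB addrA subrK.
  apply: le_trans (ler_normB _ _) _; apply: le_trans (lerD h1 h2) _.
  rewrite le_eqVlt; apply/orP; left; apply/eqP; rewrite exprS; field.
  by rewrite expf_neq0.
have yE t a : y t 0 a = y0 0 a + prim (rhs y a) (cl t).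
  by rewrite -[in LHS]Py mxE.
exists y; split.
  apply/rowP => a; rewrite yE /cl clamp_id; last by apply/andP; split; lra.
  by rewrite (primP (crhs y a gy)).1 addr0.
move=> t a /andP[t1 t2].
have [_ dP] := primP (crhs y a gy).
have d1 : is_derive t 1 (fun t => y0 0 a + prim (rhs y a) t : R^o) (rhs y a t).
  rewrite -[rhs y a t]add0r; apply: (@is_deriveD R R^o R^o (fun=> y0 0 a)).
  by apply: dP; lra.
apply: near_eq_is_derive d1.
near=> s; rewrite yE /cl clamp_id //; apply/andP; split; apply: ltW.
  by near: s; exact: lt_nbhsr.
by near: s; exact: lt_nbhsl.
Unshelve. all: by end_near. Qed.

End Picard.

(** * Flat linear systems dY = Y A, integrated along rays *)

(*%%B4*)
Section RadialFrobenius.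
Context {R : realType} {n N : nat}.
Local Notation V := 'rV[R]_n.
Variables (x0 : V) (r K : R) (A : V -> V -> 'M[R]_N) (DA : V -> V -> V -> 'M[R]_N).
Variable y0 : 'rV[R]_N.
Hypothesis r0 : 0 < r.
Hypothesis K0 : 0 <= K.
Local Notation inball p := (`|x0 - p| < r).
Hypothesis A_lin : forall (a b : R) u v p, A (a *: u + b *: v) p = a *: A u p + b *: A v p.
Hypothesis DA_scale : forall (t : R) v k p, inball p -> DA v (t *: k) p = t *: DA v k p.
Hypothesis A_bound : forall v p, inball p -> `|A v p| <= K * `|v|.
Hypothesis A_lip : forall v p k, inball p -> inball (p + k) ->
  `|A v (p + k) - A v p| <= K * `|v| * `|k|.
Hypothesis A_taylor : forall v p k, inball p -> inball (p + k) ->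
  `|A v (p + k) - A v p - DA v k p| <= K * `|v| * `|k| ^+ 2.
Hypothesis A_flat : forall u v p, inball p ->
  A u p *m A v p + DA v u p = A v p *m A u p + DA u v p.
Hypothesis A_line : forall v w (t : R) a b, inball (x0 + t *: w) ->
  is_derive t 1 (fun s => A v (x0 + s *: w) a b : R^o) (DA v w (x0 + t *: w) a b).
Hypothesis small : 2 * (N%:R * (K * r)) <= 2^-1.

Lemma is_derive_bigsum (I : finType) (f : I -> R -> R) (f' : I -> R) (t : R) :
  (forall i, is_derive t 1 (f i : R -> R^o) (f' i)) ->
  is_derive t 1 (fun s => \sum_i f i s : R^o) (\sum_i f' i).
Proof.
move=> df; elim: (index_enum I) => [|i l IH].
  rewrite big_nil (_ : (fun s => _) = cst (0 : R^o)); last first.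
    by apply/funext => s; rewrite big_nil.
  exact: is_derive_cst.
rewrite big_cons (_ : (fun s => _) = (fun s => f i s + \sum_(j <- l) f j s)); last first.
  by apply/funext => s; rewrite big_cons.
exact: (@is_deriveD R R^o R^o (f i)).
Qed.

Lemma is_derive_mul (f g : R -> R) (f' g' t : R) :
  is_derive t 1 (f : R -> R^o) f' -> is_derive t 1 (g : R -> R^o) g' ->
  is_derive t 1 (fun s => f s * g s : R^o) (f' * g t + f t * g').
Proof.
move=> df dg; have := @is_deriveM R R^o f g t 1 f' g' df dg.
by rewrite addrC [f' * _]mulrC.
Qed.

Lemma is_derive_mulmx (y : R -> 'rV[R]_N) (y' : 'rV[R]_N) (M : R -> 'M[R]_N)
    (M' : 'M[R]_N) (t : R) a :
  (forall b, is_derive t 1 (fun s => y s 0 b : R^o) (y' 0 b)) ->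
  (forall b, is_derive t 1 (fun s => M s b a : R^o) (M' b a)) ->
  is_derive t 1 (fun s => (y s *m M s) 0 a : R^o) ((y' *m M t + y t *m M') 0 a).
Proof.
move=> dy dM.
have -> : (fun s => (y s *m M s) 0 a) = (fun s => \sum_b y s 0 b * M s b a).
  by apply/funext => s; rewrite mxE.
have -> : (y' *m M t + y t *m M') 0 a = \sum_b (y' 0 b * M t b a + y t 0 b * M' b a).
  by rewrite !mxE -big_split.
by apply: is_derive_bigsum => b; apply: is_derive_mul.
Qed.

Let inball_line w (t : R) : `|w| < r -> 0 <= t <= 1 -> inball (x0 + t *: w).
Proof.
move=> wr /andP[t0 t1]; rewrite opprD addNKr normrN normrZ ger0_norm //.
by apply: le_lt_trans wr; rewrite ler_piMl.
Qed.

Lemma radial_solution w : `|w| < r -> exists y : R -> 'rV[R]_N, y 0 = y0 /\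
  forall (t : R) a, 0 <= t <= 1 ->
    is_derive t 1 (fun s => y s 0 a : R^o) ((y t *m A w (x0 + t *: w)) 0 a).
Proof.
move=> wr.
have c01 (t : R) : 0 <= clamp 0 1 t <= 1 by apply: clamp_in; exact: ler01.
(* Clamping the time to [0, 1] keeps the ray inside the ball, where the coefficients are
   controlled. *)
have [||||y [y00 dy]] := @linear_ode R N (fun t => A w (x0 + clamp 0 1 t *: w)) y0 (K * r).
- move=> a b t.
  apply: (@continuous_comp _ _ _ (clamp 0 1) (fun s => A w (x0 + s *: w) a b)).
    exact: continuous_clamp.
  have [dv _] := A_line w a b (inball_line wr (c01 t)).
  by apply: differentiable_continuous; apply/derivable1_diffP.
- move=> t; apply: le_trans (A_bound _ (inball_line wr (c01 t))) _.
  by rewrite ler_wpM2l // ltW.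
- by rewrite mulr_ge0 // ltW.
- exact: small.
exists y; split=> // t a t01; have /andP[t0 t1] := t01.
have := dy t a; rewrite clamp_id //; apply.
by apply/andP; split; lra.
Qed.

(** The solution along the ray from [x0] to [x], as a function of time; the function sought is its
    value at time 1. *)
Definition radial (x : V) : R -> 'rV[R]_N :=
  if pselect (`|x - x0| < r) is left wr then sval (cid (radial_solution wr)) else fun=> y0.

Lemma radial0 x : radial x 0 = y0.
Proof. by rewrite /radial; case: pselect => // wr; case: cid => y []. Qed.

Lemma radial_derive x (t : R) a : inball x -> 0 <= t <= 1 ->
  is_derive t 1 (fun s => radial x s 0 a : R^o)
    ((radial x t *m A (x - x0) (x0 + t *: (x - x0))) 0 a).
Proof.
move=> xr; rewrite /radial; case: pselect => [wr|]; last by rewrite distrC.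
by case: cid => y /= [_ dy] t01; exact: dy.
Qed.

Let NKr : N%:R * (K * r) <= 4^-1.
Proof. by move: small; set c := N%:R * _; lra. Qed.

Let NK0 : 0 <= N%:R * (K * r). Proof. by rewrite !mulr_ge0 // ltW. Qed.

Let mulA_bound (y : 'rV[R]_N) v p : inball p -> `|v| < r ->
  `|y *m A v p| <= 4^-1 * `|y|.
Proof.
move=> pr vr; apply: le_trans (norm_mulmx _ _) _.
rewrite mulrAC; apply: ler_wpM2r => //; apply: le_trans NKr.
apply: ler_wpM2l => //; apply: le_trans (A_bound _ pr) _.
by apply: ler_wpM2l => //; exact: ltW.
Qed.

Lemma radial_bound x (t : R) : inball x -> 0 <= t <= 1 -> `|radial x t| <= 2 * `|y0|.
Proof.
move=> xr t01; have wr : `|x - x0| < r by rewrite distrC.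
have e0 : 0 <= 4^-1 * `|y0| by rewrite mulr_ge0 // invr_ge0.
have h := @gronwall R N (fun t => radial x t - y0)
  (fun t => radial x t *m A (x - x0) (x0 + t *: (x - x0))) _ e0.
have : `|radial x t - y0| <= 2 * (4^-1 * `|y0|).
  apply: h t01.
  - by rewrite radial0 subrr.
  - move=> s a s01; rewrite -[X in is_derive _ _ _ X]subr0.
    have -> : (fun s => (radial x s - y0) 0 a) = (fun s => radial x s 0 a - y0 0 a).
      by apply/funext => q; rewrite !mxE.
    apply: (@is_deriveB R R^o R^o (fun s => radial x s 0 a) (fun=> y0 0 a)).
    exact: radial_derive.
  - move=> s s01; apply: le_trans (mulA_bound _ (inball_line wr s01) wr) _.
    have := ler_normD (radial x s - y0) y0; rewrite subrK.
    have := normr_ge0 (radial x s - y0); set a := `|_ - _|; set b := `|radial _ _|.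
    by set c := `|y0| => a0 h'; lra.
have := ler_normD (radial x t - y0) y0; rewrite subrK.
set a := `|_ - _|; set b := `|radial _ _|; set c := `|y0| => h1 h2.
have c0 : 0 <= c by exact: normr_ge0.
by lra.
Qed.

Section Increment.
Variables (x h : V).
Hypotheses (xr : inball x) (xhr : inball (x + h)).
Let w := x - x0.
Let p0 (t : R) := x0 + t *: w.
Let p1 (t : R) := x0 + t *: (w + h).
Let yx := radial x.
Let yh := radial (x + h).
Let B := 2 * `|y0|.
Let L := K * (1 + r).

Let wr : `|w| < r. Proof. by rewrite /w distrC. Qed.
Let whr : `|w + h| < r. Proof. by rewrite /w addrAC distrC. Qed.
Let p0r (t : R) : 0 <= t <= 1 -> inball (p0 t). Proof. exact: inball_line. Qed.
Let p1r (t : R) : 0 <= t <= 1 -> inball (p1 t). Proof. exact: inball_line. Qed.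
Let p1E (t : R) : p1 t = p0 t + t *: h. Proof. by rewrite /p1 /p0 scalerDr addrA. Qed.
Let L0 : 0 <= L. Proof. by rewrite mulr_ge0 // addr_ge0 // ltW. Qed.
Let B0 : 0 <= B. Proof. by rewrite mulr_ge0. Qed.
Let AD u v p : A (u + v) p = A u p + A v p.
Proof. by have := A_lin 1 1 u v p; rewrite !scale1r. Qed.

Let th (t : R) : 0 <= t <= 1 -> `|t *: h| <= `|h|.
Proof. by move=> /andP[t0 t1]; rewrite normrZ ger0_norm // ler_piMl. Qed.

Let Adiff (t : R) : 0 <= t <= 1 -> `|A (w + h) (p1 t) - A w (p0 t)| <= L * `|h|.
Proof.
move=> t01; rewrite AD addrAC.
apply: le_trans (ler_normD _ _) _.
have h1 : `|A w (p1 t) - A w (p0 t)| <= K * r * `|h|.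
  have pp : inball (p0 t + t *: h) by rewrite -p1E; exact: p1r.
  rewrite p1E; apply: le_trans (A_lip w (p0r t01) pp) _.
  apply: ler_pM => //; [by rewrite mulr_ge0| |exact: th].
  by rewrite ler_wpM2l // ltW.
have h2 := A_bound h (p1r t01).
apply: le_trans (lerD h1 h2) _.
by rewrite /L mulrDr mulr1 mulrDl addrC.
Qed.

Let D (t : R) := yh t - yx t.
Let D' (t : R) := yh t *m A (w + h) (p1 t) - yx t *m A w (p0 t).

Let D'E (t : R) : D' t = D t *m A (w + h) (p1 t) + yx t *m (A (w + h) (p1 t) - A w (p0 t)).
Proof. by rewrite /D' /D mulmxBl mulmxBr addrA subrK. Qed.

Let dyx (t : R) a : 0 <= t <= 1 -> is_derive t 1 (fun s => yx s 0 a : R^o) ((yx t *m A w (p0 t)) 0 a).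
Proof. exact: radial_derive. Qed.

Let dyh (t : R) a : 0 <= t <= 1 ->
  is_derive t 1 (fun s => yh s 0 a : R^o) ((yh t *m A (w + h) (p1 t)) 0 a).
Proof.
have -> : w + h = (x + h) - x0 by rewrite /w addrAC.
rewrite /p1; have -> : w + h = (x + h) - x0 by rewrite /w addrAC.
exact: radial_derive.
Qed.

Let dD (t : R) a : 0 <= t <= 1 -> is_derive t 1 (fun s => D s 0 a : R^o) (D' t 0 a).
Proof.
move=> t01.
have -> : (fun s => D s 0 a) = (fun s => yh s 0 a - yx s 0 a).
  by apply/funext => s; rewrite !mxE.
have -> : D' t 0 a = (yh t *m A (w + h) (p1 t)) 0 a - (yx t *m A w (p0 t)) 0 a.
  by rewrite /D' [LHS]mxE [X in _ + X]mxE.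
by apply: (@is_deriveB R R^o R^o); [exact: dyh|exact: dyx].
Qed.

Let C1 := 2 * (N%:R * B * L).

Let D_bound (t : R) : 0 <= t <= 1 -> `|D t| <= C1 * `|h|.
Proof.
move=> t01.
have e0 : 0 <= N%:R * B * L * `|h| by do 3!(apply: mulr_ge0 => //).
rewrite /C1 -mulrA; move: t t01; apply: (@gronwall R N D D' _ e0) => [||s s01].
- by rewrite /D /yh /yx !radial0 subrr.
- by move=> s a; exact: dD.
rewrite D'E; apply: le_trans (ler_normD _ _) _; apply: lerD.
  apply: le_trans (mulA_bound _ (p1r s01) whr) _.
  by apply: ler_wpM2r => //; lra.
apply: le_trans (norm_mulmx _ _) _.
have -> : N%:R * B * L * `|h| = N%:R * B * (L * `|h|) by rewrite [RHS]mulrA.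
apply: ler_pM => //.
  by apply: ler_wpM2l => //; exact: radial_bound.
exact: Adiff.
Qed.

(** The increment minus its expected first order part; at time 1 it is the error in dY = Y A. *)
Let D2 (t : R) := D t - t *: (yx t *m A h (p0 t)).
Let D2' (t : R) := D' t - (yx t *m A h (p0 t)
  + t *: (yx t *m A w (p0 t) *m A h (p0 t) + yx t *m DA h w (p0 t))).

Let dD2 (t : R) a : 0 <= t <= 1 -> is_derive t 1 (fun s => D2 s 0 a : R^o) (D2' t 0 a).
Proof.
move=> t01.
have -> : (fun s => D2 s 0 a) = (fun s => D s 0 a - s * (yx s *m A h (p0 s)) 0 a).
  by apply/funext => s; rewrite /D2 [LHS]mxE [X in _ + X]mxE [X in - X]mxE.
have -> : D2' t 0 a = D' t 0 a - (1 * (yx t *m A h (p0 t)) 0 a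
  + t * (yx t *m A w (p0 t) *m A h (p0 t) + yx t *m DA h w (p0 t)) 0 a).
  by rewrite /D2' mul1r [LHS]mxE [X in _ + X]mxE [X in - X]mxE [X in - (_ + X)]mxE.
apply: (@is_deriveB R R^o R^o); first exact: dD.
apply: (@is_derive_mul id).
apply: is_derive_mulmx => b; first exact: dyx.
exact: A_line (p0r t01).
Qed.

(** Flatness replaces A_w A_h + DA_h(w) by A_h A_w + DA_w(h). The terms of first order in h then
    cancel, and [D2] solves a linear equation whose source is of second order. *)
Let D2'E (t : R) : 0 <= t <= 1 -> D2' t = D2 t *m A w (p0 t)
  + D t *m (A (w + h) (p1 t) - A w (p0 t))
  + yx t *m (A (w + h) (p1 t) - A (w + h) (p0 t) - t *: DA w h (p0 t)).
Proof.
move=> t01; have fl := A_flat w h (p0r t01).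
have e : yx t *m A w (p0 t) *m A h (p0 t) + yx t *m DA h w (p0 t) =
    yx t *m A h (p0 t) *m A w (p0 t) + yx t *m DA w h (p0 t).
  by rewrite -!mulmxA -!mulmxDr fl.
rewrite /D2' e D'E /D2 (AD w h (p0 t)); move: (D t) (yx t) => d y.
move: (A (w + h) (p1 t)) (A w (p0 t)) (A h (p0 t)) (DA w h (p0 t)) => M1 M2 M3 M4.
rewrite mulmxBl -scalemxAl !mulmxBr mulmxDr -scalemxAr scalerDr.
apply/rowP => i; move: (d *m M1) (d *m M2)
  (y *m M1) (y *m M2) (y *m M3) (y *m M4) (y *m M3 *m M2)
  => c1 c2 c3 c4 c5 c6 c7.
by rewrite !mxE; ring.
Qed.

(** Gronwall twice: [D_bound] shows that the increment is O(|h|), which makes the source in the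
    equation for [D2] of size O(|h|^2). *)
Lemma radial_increment :
  `|yh 1 - yx 1 - yx 1 *m A h x| <=
  2 * (N%:R * C1 * L + N%:R * B * L) * `|h| ^+ 2.
Proof.
have c1 : 0 <= C1 by do 3!(apply: mulr_ge0 => //).
have e0 : 0 <= (N%:R * C1 * L + N%:R * B * L) * `|h| ^+ 2.
  apply: mulr_ge0; last exact: exprn_ge0.
  by apply: addr_ge0; do 2!(apply: mulr_ge0 => //).
have one : 0 <= (1 : R) <= 1 by rewrite ler01 lexx.
have p01 : p0 1 = x by rewrite /p0 scale1r /w addrC subrK.
have -> : yh 1 - yx 1 - yx 1 *m A h x = D2 1 by rewrite /D2 /D scale1r p01.
rewrite -[leRHS]mulrA; apply: (@gronwall R N D2 D2' _ e0 _ _ _ 1 one).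
- by rewrite /D2 /D /yh /yx !radial0 subrr scale0r subrr.
- by move=> s a; exact: dD2.
move=> s s01; rewrite D2'E // -addrA; apply: le_trans (ler_normD _ _) _; apply: lerD.
  apply: le_trans (mulA_bound _ (p0r s01) wr) _.
  by apply: ler_wpM2r => //; lra.
apply: le_trans (ler_normD _ _) _; rewrite mulrDl; apply: lerD.
  apply: le_trans (norm_mulmx _ _) _.
  have -> : N%:R * C1 * L * `|h| ^+ 2 = N%:R * (C1 * `|h|) * (L * `|h|) by ring.
  apply: ler_pM => //.
    by apply: ler_wpM2l => //; exact: D_bound.
  exact: Adiff.
apply: le_trans (norm_mulmx _ _) _.
have -> : N%:R * B * L * `|h| ^+ 2 = N%:R * B * (L * `|h| ^+ 2) by ring.
apply: ler_pM => //.
  by apply: ler_wpM2l => //; exact: radial_bound.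
have pp : inball (p0 s + s *: h) by rewrite -p1E; exact: p1r.
have -> : A (w + h) (p1 s) - A (w + h) (p0 s) - s *: DA w h (p0 s) =
    (A w (p0 s + s *: h) - A w (p0 s) - DA w (s *: h) (p0 s))
    + (A h (p0 s + s *: h) - A h (p0 s)).
  by rewrite (DA_scale _ _ _ (p0r s01)) p1E !AD; apply/matrixP => i j; rewrite !mxE; ring.
apply: le_trans (ler_normD _ _) _.
have sh2 : `|s *: h| ^+ 2 <= `|h| ^+ 2 by rewrite lerXn2r ?nnegrE // th.
have -> : L * `|h| ^+ 2 = K * r * `|h| ^+ 2 + K * `|h| * `|h| by rewrite /L; ring.
apply: lerD.
  apply: le_trans (A_taylor w (p0r s01) pp) _.
  apply: ler_pM => //; first by rewrite mulr_ge0.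
  by rewrite ler_wpM2l // ltW.
apply: le_trans (A_lip h (p0r s01) pp) _.
by apply: ler_wpM2l; [rewrite mulr_ge0|exact: th].
Qed.

End Increment.

(** Along rays the equation holds by construction; [radial_increment] extends it to all directions,
    up to a quadratic error that is uniform on the ball. *)
Theorem radial_frobenius : exists (Y : V -> 'rV[R]_N) (C : R), [/\ Y x0 = y0, 0 <= C &
  forall x h, inball x -> inball (x + h) ->
    `|Y (x + h) - Y x - Y x *m A h x| <= C * `|h| ^+ 2].
Proof.
exists (fun x => radial x 1).
exists (2 * (N%:R * (2 * (N%:R * (2 * `|y0|) * (K * (1 + r)))) * (K * (1 + r))
  + N%:R * (2 * `|y0|) * (K * (1 + r)))).
have r1 : 0 <= 1 + r by rewrite addr_ge0 // ltW.
split.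
- have x0r : inball x0 by rewrite subrr normr0.
  have e0 : 0 <= (0 : R) by [].
  have one : 0 <= (1 : R) <= 1 by rewrite ler01 lexx.
  have := @gronwall R N (fun t => radial x0 t - y0) (fun=> 0) _ e0.
  rewrite radial0 subrr mulr0 => /(_ erefl) h.
  apply/eqP; rewrite -subr_eq0 -normr_le0; apply: (h _ _ 1 one).
    move=> s a s01; rewrite (_ : (0 : 'rV_N) 0 a = (radial x0 s *m A (x0 - x0) (x0 + s *: (x0 - x0))) 0 a - 0).
      have -> : (fun s => (radial x0 s - y0) 0 a) = (fun s => radial x0 s 0 a - y0 0 a).
        by apply/funext => q; rewrite !mxE.
      apply: (@is_deriveB R R^o R^o (fun s => radial x0 s 0 a) (fun=> y0 0 a)).
      exact: radial_derive.
    have := A_lin 0 0 0 0 (x0 + s *: (x0 - x0)).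
    by rewrite !scale0r !addr0 subrr => ->; rewrite mulmx0 !mxE subr0.
  by move=> s s01; rewrite normr0 addr0 mulr_ge0 // invr_ge0.
- by rewrite mulr_ge0 // addr_ge0 // !mulr_ge0.
- by move=> x h xr xhr; exact: radial_increment.
Qed.

End RadialFrobenius.

(** * Uniform local bounds and the Frobenius theorem *)

(*%%B5*)
Section LocalBounds.
Context {R : realType} {n : nat}.
Local Notation V := 'rV[R]_n.
Variables (U : set V) (x0 : V).
Hypotheses (oU : open U) (Ux0 : U x0).

Lemma local_bound (I : finType) (f : I -> V -> R) : (forall i, smooth U (f i)) ->
  exists r K : R, [/\ 0 < r, 0 <= K, forall p, `|x0 - p| < r -> U p &
    forall i p, `|x0 - p| < r -> `|f i p| <= K].
Proof.
move=> sf.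
pose K := \sum_i (`|f i x0| + 1).
have K0 : 0 <= K by apply: sumr_ge0 => i _; rewrite addr_ge0.
have : \forall p \near x0, U p /\ forall i, `|f i x0 - f i p| < 1.
  apply: filterI; first exact: near_open.
  apply: (@filter_forall _ I (fun i p => `|f i x0 - f i p| < 1) (nbhs x0)) => i.
  exact: smooth_continuous_at (sf i) Ux0 ltr01.
case/nbhs_radius => r r0 hr; exists r, K; split=> // [p /hr[]//|i p /hr[_ /(_ i) h]].
have h1 : `|f i p| <= `|f i x0| + 1.
  rewrite -lerBlDl; apply: le_trans (ltW h); rewrite distrC.
  exact: lerB_dist.
apply: le_trans h1 _; rewrite /K (bigD1 i) //= lerDl.
by apply: sumr_ge0 => j _; rewrite addr_ge0.
Qed.

Variables (r K : R) (f : V -> R).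
Hypothesis sf : smooth U f.
Hypothesis rU : forall p, `|x0 - p| < r -> U p.
Hypothesis b1 : forall i p, `|x0 - p| < r -> `|dd f (delta_mx 0 i) p| <= K.
Hypothesis b2 : forall i j p, `|x0 - p| < r ->
  `|dd (dd f (delta_mx 0 i)) (delta_mx 0 j) p| <= K.

Let sum_le (F : 'I_n -> R) (k : V) c : (forall i, `|F i| <= c) ->
  `|\sum_i k 0 i * F i| <= n%:R * c * `|k|.
Proof.
move=> Fc; apply: le_trans (ler_norm_sum _ _ _) _.
have -> : n%:R * c * `|k| = \sum_(i < n) `|k| * c.
  by rewrite sumr_const card_ord -(mulr_natl (_ * _)); ring.
by apply: ler_sum => i _; rewrite normrM ler_pM // entry_le_norm.
Qed.

Lemma first_derivative_bound k p : `|x0 - p| < r -> `|dd f k p| <= n%:R * K * `|k|.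
Proof.
by move=> pr; rewrite (dd_coord_sum _ sf (rU pr)); apply: sum_le => i; exact: b1.
Qed.

Lemma second_derivative_bound k p : `|x0 - p| < r ->
  `|dd (dd f k) k p| <= n%:R ^+ 2 * K * `|k| ^+ 2.
Proof.
move=> pr; have Up := rU pr.
rewrite (dd_coord_sum _ (smooth_dd k sf) Up).
have -> : n%:R ^+ 2 * K * `|k| ^+ 2 = n%:R * (n%:R * K * `|k|) * `|k| by ring.
apply: sum_le => i.
rewrite (dd_ext oU (g := fun y => \sum_j k 0 j * dd f (delta_mx 0 j) y)) //; last first.
  by move=> y Uy; exact: dd_coord_sum sf Uy.
have s1 j : smooth U (fun y => k 0 j * dd f (delta_mx 0 j) y).
  by apply: smoothM => //; [exact: smooth_cst|exact: smooth_dd].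
rewrite (dd_sum _ s1 Up).
rewrite (eq_bigr (fun j => k 0 j * dd (dd f (delta_mx 0 j)) (delta_mx 0 i) p)).
  by apply: sum_le => j; exact: b2.
by move=> j _; rewrite (ddZ _ _ (smooth_dd _ sf) Up).
Qed.

Let segment p k (t : R) : `|x0 - p| < r -> `|x0 - (p + k)| < r -> 0 <= t <= 1 ->
  `|x0 - (p + t *: k)| < r.
Proof.
move=> pr pkr /andP[t0 t1].
have -> : x0 - (p + t *: k) = (1 - t) *: (x0 - p) + t *: (x0 - (p + k)).
  by apply/matrixP => i j; rewrite !mxE; ring.
apply: le_lt_trans (ler_normD _ _) _.
rewrite !normrZ (ger0_norm t0) ger0_norm ?subr_ge0 //.
case: (ltgtP t 0) t0 => // [t0 _|-> _]; last by rewrite mul0r addr0 subr0 mul1r.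
have -> : r = (1 - t) * r + t * r by ring.
rewrite ler_ltD //; last by rewrite ltr_pM2l.
by rewrite ler_wpM2l ?subr_ge0 // ltW.
Qed.

Lemma mean_value_dd (g : V -> R) p k : smooth U g ->
  `|x0 - p| < r -> `|x0 - (p + k)| < r ->
  exists2 t, 0 <= t <= 1 & g (p + k) - g p = dd g k (p + t *: k).
Proof.
move=> sg pr pkr.
have [t t01|t /andP[t0 t1]] := @mean_value_line _ _ g p k 1 ltr01.
  exact: smooth_differentiable sg (rU (segment pr pkr t01)).
rewrite scale1r mulr1 => E; exists t; first by rewrite !ltW.
by rewrite E ddE.
Qed.

Lemma lipschitz_bound p k : `|x0 - p| < r -> `|x0 - (p + k)| < r ->
  `|f (p + k) - f p| <= n%:R * K * `|k|.
Proof.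
move=> pr pkr; have [t t01 ->] := mean_value_dd sf pr pkr.
by apply: first_derivative_bound; exact: segment.
Qed.

Lemma taylor_bound p k : `|x0 - p| < r -> `|x0 - (p + k)| < r ->
  `|f (p + k) - f p - dd f k p| <= n%:R ^+ 2 * K * `|k| ^+ 2.
Proof.
move=> pr pkr; have [t t01 ->] := mean_value_dd sf pr pkr.
have ptr := segment pr pkr t01.
have [s s01 ->] := mean_value_dd (smooth_dd k sf) pr ptr.
have pstr := segment pr ptr s01; have := second_derivative_bound k pstr.
have /andP[t0 t1] := t01.
move=> h; have := dd_linear k 0 t 0 (smooth_dd k sf) (rU pstr).
rewrite scaler0 addr0 mul0r addr0 => ->; rewrite normrM (ger0_norm t0).
by apply: le_trans h; rewrite ler_piMl.
Qed.

End LocalBounds.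

Section Frobenius.
Context {R : realType} {n N : nat}.
Local Notation V := 'rV[R]_n.
Variables (U : set V) (x0 : V) (Am : 'I_n -> V -> 'M[R]_N) (y0 : 'rV[R]_N).
Hypotheses (oU : open U) (Ux0 : U x0).
Hypothesis sA : forall i, smoothm U (Am i).

Definition lincomb_mx (M : 'I_n -> 'M[R]_N) (v : V) := \sum_i v 0 i *: M i.

Local Notation A := (fun v p => lincomb_mx (Am^~ p) v).
Local Notation DA := (fun v k p => lincomb_mx (fun i => ddm (Am i) k p) v).

Hypothesis flat : forall u v p, U p ->
  A u p *m A v p + DA v u p = A v p *m A u p + DA u v p.

Lemma lincomb_mx_norm (M : 'I_n -> 'M[R]_N) v (c : R) : 0 <= c -> (forall i a b, `|M i a b| <= c) ->
  `|lincomb_mx M v| <= n%:R * c * `|v|.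
Proof.
move=> c0 Mc; apply: norm_mx_le => [|a b]; first by rewrite !mulr_ge0.
rewrite /lincomb_mx summxE; apply: le_trans (ler_norm_sum _ _ _) _.
have -> : n%:R * c * `|v| = \sum_(i < n) `|v| * c.
  by rewrite sumr_const card_ord -(mulr_natl (_ * _)); ring.
by apply: ler_sum => i _; rewrite mxE normrM ler_pM // entry_le_norm.
Qed.

Lemma lincomb_mxE M v a b : lincomb_mx M v a b = \sum_i v 0 i * M i a b.
Proof. by rewrite /lincomb_mx summxE; apply: eq_bigr => i _; rewrite mxE. Qed.

Lemma lincomb_mx_linear M (a b : R) u v :
  lincomb_mx M (a *: u + b *: v) = a *: lincomb_mx M u + b *: lincomb_mx M v.
Proof.
rewrite /lincomb_mx !scaler_sumr -big_split; apply: eq_bigr => i _ /=.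
by rewrite !mxE scalerDl !scalerA.
Qed.

Lemma lincomb_mx_sub M M' v : lincomb_mx M v - lincomb_mx M' v =
  lincomb_mx (fun i => M i - M' i) v.
Proof.
by rewrite /lincomb_mx -sumrB; apply: eq_bigr => i _; rewrite scalerBr.
Qed.

(** On a small ball the coefficients and their first two derivatives are bounded, which supplies the
    Lipschitz and Taylor hypotheses of [radial_frobenius]; its quadratic error estimate is then
    differentiability with the right derivative. *)
Lemma frobenius_differentiable : exists (r : R) (Y : V -> 'rV[R]_N),
  [/\ 0 < r, forall p, `|x0 - p| < r -> U p, Y x0 = y0 &
    forall x, `|x0 - x| < r -> differentiable Y x /\
      forall v, 'D_v Y x = Y x *m A v x].
Proof.
pose I : finType := ('I_n * ('I_N * 'I_N))%type.
pose ent (i : I) p := Am i.1 p i.2.1 i.2.2.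
have sent i : smooth U (ent i) := sA i.1 i.2.1 i.2.2.
have [r0 [K0 [r00 K00 rU0 hb0]]] := local_bound oU Ux0 sent.
have [r1 [K1 [r10 K10 _ hb1]]] := @local_bound _ _ U x0 oU Ux0 (I * 'I_n)%type
  (fun q => dd (ent q.1) (delta_mx 0 q.2)) (fun q => smooth_dd _ (sent q.1)).
have [r2 [K2 [r20 K20 _ hb2]]] := @local_bound _ _ U x0 oU Ux0 (I * ('I_n * 'I_n))%type
  (fun q => dd (dd (ent q.1) (delta_mx 0 q.2.1)) (delta_mx 0 q.2.2))
  (fun q => smooth_dd _ (smooth_dd _ (sent q.1))).
pose Kb := K0 + K1 + K2.
have Kb0 : 0 <= Kb by rewrite !addr_ge0.
(* One constant for the sup, Lipschitz and Taylor bounds of the entries, which carry the factors 1,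
   n and n^2; the outer n comes from summing over directions. *)
pose K := n%:R * ((n%:R ^+ 2 + n%:R + 1) * Kb).
have nn : 0 <= (n%:R : R) by [].
have K_ge0 : 0 <= K by rewrite !mulr_ge0 // !addr_ge0 // exprn_ge0.
(* With r <= c one has N K r <= 1/4, the smallness asked of the differential equations. *)
pose c : R := (4 * (N%:R * K + 1))^-1.
have NK0 : 0 <= N%:R * K by rewrite mulr_ge0.
have c0 : 0 < c by rewrite invr_gt0 mulr_gt0 // ltr_wpDl.
pose r := Num.min c (Num.min r0 (Num.min r1 r2)).
have r_gt0 : 0 < r by rewrite !lt_min c0 r00 r10 r20.
have [rc [rr0 [rr1 rr2]]] : r <= c /\ r <= r0 /\ r <= r1 /\ r <= r2.
  by rewrite /r !ge_min !lexx ?orbT.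
have rU p : `|x0 - p| < r -> U p by move=> pr; apply: rU0; exact: lt_le_trans rr0.
have B0 i a b p : `|x0 - p| < r -> `|Am i p a b| <= Kb.
  move=> pr; apply: le_trans (hb0 (i, (a, b)) p (lt_le_trans pr rr0)) _.
  by rewrite /Kb -addrA lerDl addr_ge0.
have B1 i a b j p : `|x0 - p| < r -> `|dd (fun p => Am i p a b) (delta_mx 0 j) p| <= Kb.
  move=> pr; apply: le_trans (hb1 ((i, (a, b)), j) p (lt_le_trans pr rr1)) _.
  by rewrite /Kb addrAC lerDr addr_ge0.
have B2 i a b j l p : `|x0 - p| < r ->
    `|dd (dd (fun p => Am i p a b) (delta_mx 0 j)) (delta_mx 0 l) p| <= Kb.
  move=> pr; apply: le_trans (hb2 ((i, (a, b)), (j, l)) p (lt_le_trans pr rr2)) _.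
  by rewrite /Kb lerDr addr_ge0.
have up (x : R) : 0 <= x -> x <= (n%:R ^+ 2 + n%:R + 1) * Kb -> forall (M : 'I_n -> 'M[R]_N) v,
    (forall i a b, `|M i a b| <= x) -> `|lincomb_mx M v| <= K * `|v|.
  move=> x0' xK M v Mx; apply: le_trans (lincomb_mx_norm v x0' Mx) _.
  by rewrite ler_wpM2r // ler_wpM2l.
have n2 : 0 <= (n%:R ^+ 2 : R) by rewrite exprn_ge0.
have small : 2 * (N%:R * (K * r)) <= 2^-1.
  have h : N%:R * K * r <= 4^-1.
    apply: le_trans (ler_wpM2l NK0 rc) _.
    rewrite /c invfM mulrCA ler_piMr // ?invr_ge0 // ler_pdivrMr ?mul1r ?ltr_wpDl //.
    by rewrite lerDl.
  by move: h; rewrite (mulrA N%:R); move: (N%:R * K * r) => z h; lra.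
have dlin i a b k t p : U p -> dd (fun p => Am i p a b) (t *: k) p = t * dd (fun p => Am i p a b) k p.
  move=> Up; have := dd_linear k 0 t 0 (sA i a b) Up.
  by rewrite scaler0 addr0 mul0r addr0.
have hscale t v k p : `|x0 - p| < r -> DA v (t *: k) p = t *: DA v k p.
  move=> /rU Up; rewrite /lincomb_mx scaler_sumr; apply: eq_bigr => i _.
  apply/matrixP => a b; rewrite !mxE dlin //; ring.
have hbound v p : `|x0 - p| < r -> `|A v p| <= K * `|v|.
  move=> pr; apply: (up Kb) => // [|i a b]; last exact: B0.
  by rewrite ler_peMl // lerDr addr_ge0.
have hlip v p k : `|x0 - p| < r -> `|x0 - (p + k)| < r ->
    `|A v (p + k) - A v p| <= K * `|v| * `|k|.
  move=> pr pkr; rewrite lincomb_mx_sub.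
  apply: le_trans (lincomb_mx_norm v (c := n%:R * Kb * `|k|) _ _) _.
  - by rewrite !mulr_ge0.
  - move=> i a b; rewrite !mxE.
    apply: (lipschitz_bound (sA i a b) rU) => // j q qr; exact: B1.
  - have -> : n%:R * (n%:R * Kb * `|k|) * `|v| = n%:R * (n%:R * Kb) * `|v| * `|k| by ring.
    rewrite ler_wpM2r // ler_wpM2r // ler_wpM2l // ler_wpM2r //.
    by rewrite addrAC lerDr addr_ge0.
have htaylor v p k : `|x0 - p| < r -> `|x0 - (p + k)| < r ->
    `|A v (p + k) - A v p - DA v k p| <= K * `|v| * `|k| ^+ 2.
  move=> pr pkr; rewrite !lincomb_mx_sub.
  apply: le_trans (lincomb_mx_norm v (c := n%:R ^+ 2 * Kb * `|k| ^+ 2) _ _) _.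
  - by rewrite !mulr_ge0 // exprn_ge0.
  - move=> i a b; rewrite !mxE.
    apply: (taylor_bound oU (sA i a b) rU) => // j l q qr; exact: B2.
  - have -> : n%:R * (n%:R ^+ 2 * Kb * `|k| ^+ 2) * `|v| = n%:R * (n%:R ^+ 2 * Kb) * `|v| * `|k| ^+ 2 by ring.
    rewrite ler_wpM2r ?exprn_ge0 // ler_wpM2r // ler_wpM2l // ler_wpM2r //.
    by rewrite -addrA lerDl addr_ge0.
have hflat u v p : `|x0 - p| < r -> A u p *m A v p + DA v u p = A v p *m A u p + DA u v p.
  by move=> /rU; exact: flat.
have hline v w (t : R) a b : `|x0 - (x0 + t *: w)| < r ->
    is_derive t 1 (fun s => A v (x0 + s *: w) a b : R^o) (DA v w (x0 + t *: w) a b).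
  move=> /rU Up.
  have -> : (fun s => A v (x0 + s *: w) a b) = (fun s => \sum_i v 0 i * Am i (x0 + s *: w) a b).
    by apply/funext => s; rewrite lincomb_mxE.
  have -> : DA v w (x0 + t *: w) a b = \sum_i v 0 i * dd (fun p => Am i p a b) w (x0 + t *: w).
    by rewrite lincomb_mxE; apply: eq_bigr => i _; rewrite mxE.
  apply: is_derive_bigsum => i.
  have d1 : is_derive t 1 (fun s => Am i (x0 + s *: w) a b : R^o) (dd (fun p => Am i p a b) w (x0 + t *: w)).
    by rewrite ddE; apply: is_derive_line; exact: smooth_differentiable (sA i a b) Up.
  have := is_derive_mul (is_derive_cst (v 0 i : R^o) t 1) d1.
  by rewrite mul0r add0r.
have [Y [C [Yx0 C0 hY]]] := @radial_frobenius R n N x0 r K A DA y0 r_gt0 K_ge0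
  (fun a b u v p => lincomb_mx_linear _ a b u v) hscale hbound hlip htaylor hflat hline small.
exists r, Y; split=> // x xr.
pose M : 'M[R]_(n, N) := \matrix_i (Y x *m Am i x).
have ME h : h *m M = Y x *m A h x.
  rewrite /lincomb_mx mulmx_sumr mulmx_sum_row; apply: eq_bigr => i _.
  by rewrite rowK scalemxAr.
have cM : continuous (mulmxr M : {linear V -> 'rV[R]_N}).
  apply: (@continuousfor0_continuous R V _ (mulmxr M)).
  apply/(@cvgrPdist_lt R _ _ (nbhs (0 : V)) (nbhs_filter (0 : V))) => e e0.
  apply/(nbhs_radius (0 : V)).
  have b0 : 0 < n%:R * `|M| + 1 by rewrite ltr_wpDl // mulr_ge0.
  exists (e / (n%:R * `|M| + 1)); first by rewrite divr_gt0.
  move=> h; rewrite sub0r normrN ltr_pdivlMr // => he.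
  rewrite [X in `|X - _|]mul0mx sub0r normrN; apply: le_lt_trans he.
  apply: le_trans (norm_mulmx h M) _.
  by rewrite mulrAC mulrC ler_wpM2l // lerDl.
have [|dY dYE] := @differentiable_of_estimate R V _ Y x (mulmxr M) cM.
  move=> e e0.
  have d0 : 0 < r - `|x0 - x| by rewrite subr_gt0.
  have C1 : 0 < C + 1 by rewrite ltr_wpDl.
  apply/nbhs_radius; exists (Num.min (r - `|x0 - x|) (e / (C + 1))).
    by rewrite lt_min d0 divr_gt0.
  move=> h; rewrite sub0r normrN lt_min => /andP[h1 h2].
  have xhr : `|x0 - (x + h)| < r.
    rewrite opprD addrA; apply: le_lt_trans (ler_normB _ _) _.
    by rewrite -ltrBrDl.
  rewrite [h + x]addrC [X in `|_ - X|]ME; apply: le_trans (hY x h xr xhr) _.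
  rewrite expr2 mulrA ler_wpM2r //.
  move: h2; rewrite ltr_pdivlMr // => h2; apply: le_trans (ltW h2).
  by rewrite mulrC ler_wpM2l // lerDl.
split=> // v; rewrite deriveE // dYE; exact: ME.
Qed.

(** Bootstrap: each derivative of [Y] is [Y] times smooth coefficients, so class C^k gives class
    C^(k+1). *)
Lemma frobenius : exists (r : R) (Y : V -> 'rV[R]_N),
  [/\ 0 < r, forall p, `|x0 - p| < r -> U p, Y x0 = y0,
    smoothv [set p | `|x0 - p| < r] Y &
    forall x, `|x0 - x| < r -> forall v, ddv Y v x = Y x *m A v x].
Proof.
have [r [Y [r0 rU Yx0 dY]]] := frobenius_differentiable.
pose B : set V := [set p | `|x0 - p| < r].
have oB : open B.
  have -> : B = ball x0 r by rewrite -ball_normE.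
  exact: ball_open.
have dYa x v a : B x -> 'D_v (fun y => Y y 0 a) x = \sum_b Y x 0 b * (\sum_i v 0 i * Am i x b a).
  move=> Bx; have [dYx Dx] := dY x Bx.
  apply: etrans (esym (derive_row v a dYx)) _.
  apply: etrans (congr1 (fun M : 'rV[R]_N => M 0 a) (Dx v)) _.
  by rewrite mxE; apply: eq_bigr => b _; rewrite lincomb_mxE.
have dYd x a : B x -> differentiable (fun y => Y y 0 a : R^o) x.
  move=> Bx; have [dYx _] := dY x Bx.
  apply: (@differentiable_comp _ _ _ _ Y (fun M : 'rV[R]_N => M 0 a)) => //.
  exact: differentiable_coord.
have sY : smoothv B Y.
  move=> a k; elim: k a => [|k IH] a.
    by move=> x Bx; apply: differentiable_continuous; exact: dYd.
  split=> [x Bx|v]; first exact: dYd.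
  have sAv b : smooth B (fun x => \sum_i v 0 i * Am i x b a).
    apply: smooth_subset (rU) _; apply: smooth_sum => // i _.
    by apply: smoothM => //; [exact: smooth_cst|exact: sA].
  have sum_Ck (l : seq 'I_N) : Ck k B
      (fun x => \sum_(b <- l) Y x 0 b * (\sum_i v 0 i * Am i x b a) : R^o).
    elim: l => [|b l IHl].
      by apply: (Ck_ext oB _ (Ck_cst k B 0)) => x _; rewrite big_nil.
    by apply: (Ck_ext oB _ (CkD oB (CkM oB (IH b) (sAv b k)) IHl)) => x _; rewrite big_cons.
  by apply: (Ck_ext oB _ (sum_Ck (index_enum 'I_N))) => x Bx; rewrite -dYa.
exists r, Y; split=> // x Bx v.
rewrite -(derive_ddv v sY Bx); exact: (dY x Bx).2.
Qed.

End Frobenius.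

(** * Levi-Civita connection and curvature in coordinates *)

(*%%C1*)
Fact Gam_key : unit. Proof. exact: tt. Qed.

Section LeviCivita.
Context {R : realType} {n : nat}.
Local Notation V := 'rV[R]_n.
Variables (U : set V) (G : V -> 'M[R]_n).
Hypothesis oU : open U.
Hypothesis sG : smoothm U G.
Hypothesis tG : forall x, U x -> (G x)^T = G x.
Hypothesis uG : forall x, U x -> G x \in unitmx.

Lemma bil_sym x u v : U x -> bil (G x) u v = bil (G x) v u.
Proof. by move=> Ux; rewrite -bil_tr tG. Qed.

Lemma bil_nondegenerate x a b : U x ->
  (forall w, bil (G x) a w = bil (G x) b w) -> a = b.
Proof.
move=> Ux h; have : a *m G x = b *m G x.
  apply/rowP => k; have := h (delta_mx 0 k).
  by rewrite !bil_mul trmx_delta -!colE ![col _ _ _ _]mxE.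
by move=> /(congr1 (mulmx^~ (invmx (G x)))); rewrite !mulmxK ?uG.
Qed.

(** Christoffel symbols of the first kind, by Koszul's formula. They avoid differentiating the
    inverse metric. *)
Definition chr (x u v w : V) : R :=
  2^-1 * (bil (ddm G u x) v w + bil (ddm G v x) u w - bil (ddm G w x) u v).

Definition Gam (x u v : V) : V := locked_with Gam_key
  ((\row_k chr x u v (delta_mx 0 k)) *m invmx (G x)).

Lemma GamE x u v : Gam x u v = (\row_k chr x u v (delta_mx 0 k)) *m invmx (G x).
Proof. by rewrite /Gam unlock. Qed.

Lemma chr_linear1 x a b u u' v w : U x ->
  chr x (a *: u + b *: u') v w = a * chr x u v w + b * chr x u' v w.
Proof.
move=> Ux; rewrite /chr (ddm_linear _ _ _ _ sG Ux) !(bil_addm, bil_scalem, bilDl, bilDr, bilZl, bilZr).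
by ring.
Qed.

Lemma bil_ddm_symE x u v w : U x -> bil (ddm G u x) v w = bil (ddm G u x) w v.
Proof. by move=> Ux; rewrite -bil_tr (bil_ddm_sym oU _ sG tG Ux). Qed.

Lemma chr_sym x u v w : U x -> chr x u v w = chr x v u w.
Proof. by move=> Ux; rewrite /chr (bil_ddm_symE w u v Ux); ring. Qed.

Lemma chr_linear3 x a b u v w w' : U x ->
  chr x u v (a *: w + b *: w') = a * chr x u v w + b * chr x u v w'.
Proof.
move=> Ux; rewrite /chr (ddm_linear _ _ _ _ sG Ux) !(bil_addm, bil_scalem, bilDl, bilDr, bilZl, bilZr).
by ring.
Qed.

Lemma chr_sum3 x u v w : U x ->
  chr x u v w = \sum_k w 0 k * chr x u v (delta_mx 0 k).
Proof.
move=> Ux; rewrite {1}(row_sum_delta w).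
have -> : forall r : seq 'I_n, chr x u v (\sum_(k <- r) w 0 k *: delta_mx 0 k) =
    \sum_(k <- r) w 0 k * chr x u v (delta_mx 0 k); last by [].
elim=> [|k r IH].
  have := chr_linear3 0 0 u v 0 0 Ux.
  by rewrite !big_nil !scale0r addr0 !mul0r addr0.
have := chr_linear3 (w 0 k) 1 u v (delta_mx 0 k) (\sum_(k <- r) w 0 k *: delta_mx 0 k) Ux.
by rewrite !big_cons -IH scale1r mul1r.
Qed.

Lemma bil_Gam x u v w : U x -> bil (G x) (Gam x u v) w = chr x u v w.
Proof.
move=> Ux; rewrite bil_mul GamE mulmxKV ?uG // chr_sum3 // mxE.
by apply: eq_bigr => k _; rewrite !mxE mulrC.
Qed.

Lemma Gam_sym x u v : U x -> Gam x u v = Gam x v u.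
Proof.
by move=> Ux; apply: (bil_nondegenerate Ux) => w; rewrite !bil_Gam // chr_sym.
Qed.

Lemma Gam_linear1 x a b u u' v : U x ->
  Gam x (a *: u + b *: u') v = a *: Gam x u v + b *: Gam x u' v.
Proof.
move=> Ux; apply: (bil_nondegenerate Ux) => w.
by rewrite bilDl !bilZl !bil_Gam // chr_linear1.
Qed.

Lemma Gam_linear2 x a b u v v' : U x ->
  Gam x u (a *: v + b *: v') = a *: Gam x u v + b *: Gam x u v'.
Proof. by move=> Ux; rewrite Gam_sym // Gam_linear1 // !(Gam_sym _ u). Qed.

Lemma metric_compat x u v w : U x ->
  bil (ddm G u x) v w = bil (G x) (Gam x u v) w + bil (G x) v (Gam x u w).
Proof.
move=> Ux; rewrite (bil_sym v) // !bil_Gam // /chr.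
by rewrite (bil_ddm_symE v u w) // (bil_ddm_symE w u v) // (bil_ddm_symE u w v) //; field.
Qed.

Lemma smooth_chr u v w : smooth U (fun x => chr x u v w).
Proof.
apply: smoothM => //; first exact: smooth_cst.
have s a b c : smooth U (fun x => bil (ddm G a x) b c).
  by apply: smooth_bil => //; [exact: smoothm_ddm|exact: smoothv_cst|exact: smoothv_cst].
by apply: smoothB => //; apply: smoothD.
Qed.

Lemma smooth_Gam u v : smoothv U (fun x => Gam x u v).
Proof.
move=> k; have sI := smoothm_invmx oU sG uG.
apply: smooth_ext (_ : smooth U (fun x =>
   \sum_j chr x u v (delta_mx 0 j) * invmx (G x) j k)) => //.
  by move=> x _; rewrite GamE mxE; apply: eq_bigr => j _; rewrite mxE.
by apply: smooth_sum => // j _; apply: smoothM => //; exact: smooth_chr.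
Qed.

(* Covariant derivative in the direction [u] of the field [X]. *)
Definition cov (X : V -> V) (u x : V) : V := ddv X u x + Gam x u (X x).

Lemma dd_metric X Y u x : smoothv U X -> smoothv U Y -> U x ->
  dd (fun y => bil (G y) (X y) (Y y)) u x =
  bil (G x) (cov X u x) (Y x) + bil (G x) (X x) (cov Y u x).
Proof.
move=> sX sY Ux; rewrite (dd_bil oU) // metric_compat // /cov bilDl bilDr.
by ring.
Qed.

(** Fields with constant coordinates commute, so no bracket term occurs. *)
Definition curv (x u v w : V) : V :=
  cov (fun y => Gam y v w) u x - cov (fun y => Gam y u w) v x.

Definition riem (x u v w z : V) : R := bil (G x) (curv x u v w) z.

(** Differentiate g(Gam(v, w), z) = chr v w z. The resulting expression involves first-kind symbols
    only and shows the symmetries. *)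
Lemma riemE x u v w z : U x -> riem x u v w z =
  dd (fun y => chr y v w z) u x - dd (fun y => chr y u w z) v x
  - bil (G x) (Gam x v w) (Gam x u z) + bil (G x) (Gam x u w) (Gam x v z).
Proof.
move=> Ux; rewrite /riem /curv bilBl.
have E a b : bil (G x) (cov (fun y => Gam y a w) b x) z =
    dd (fun y => chr y a w z) b x - bil (G x) (Gam x a w) (Gam x b z).
  have -> : dd (fun y => chr y a w z) b x = dd (fun y => bil (G y) (Gam y a w) z) b x.
    by apply: (dd_ext oU) => // y Uy; rewrite bil_Gam.
  rewrite (dd_metric (X := fun y => Gam y a w) (Y := fun=> z)) //.
  - by rewrite /cov (ddv_cst z) add0r addrK.
  - exact: smooth_Gam.
  - exact: smoothv_cst.
by rewrite !E; ring.
Qed.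

Lemma riem_skew12 x u v w z : riem x u v w z = - riem x v u w z.
Proof. by rewrite /riem -bilNl /curv opprB. Qed.

(** Symmetrized in w and z, the derivative of a first-kind symbol is a second derivative of the
    metric, which is symmetric in u and v and cancels. *)
Lemma riem_skew34 x u v w z : U x -> riem x u v w z = - riem x u v z w.
Proof.
move=> Ux; apply/eqP; rewrite -addr_eq0 !riemE //; apply/eqP.
have E a b : dd (fun y => chr y a w z) b x + dd (fun y => chr y a z w) b x =
    bil (ddm (ddm G a) b x) w z.
  rewrite -(ddD _ (smooth_chr a w z) (smooth_chr a z w) Ux).
  rewrite -(dd_bil_cst oU w z b (smoothm_ddm oU a sG) Ux).
  apply: (dd_ext oU) => // y Uy; rewrite metric_compat // (bil_sym w) // !bil_Gam //.
have := E v u; have := E u v; rewrite (ddm_comm oU u v sG Ux).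
rewrite (bil_sym (Gam x v z)) // (bil_sym (Gam x u z)) //.
set A := bil (ddm _ _ _) _ _; set p1 := bil _ (Gam x v w) _; set p2 := bil _ (Gam x u w) _.
by move=> h1 h2; apply: (etrans _ (subrr A)); rewrite -{1}h2 -h1; ring.
Qed.

Lemma riem_bianchi x u v w z : U x ->
  riem x u v w z + riem x v w u z + riem x w u v z = 0.
Proof.
move=> Ux; rewrite !riemE //.
have E a b c : dd (fun y => chr y a b z) c x = dd (fun y => chr y b a z) c x.
  by apply: (dd_ext oU) => // y Uy; rewrite chr_sym.
rewrite (E w v u) (E w u v) (E v u w) !(Gam_sym v u) // !(Gam_sym w u) //.
by rewrite !(Gam_sym w v) //; ring.
Qed.

Lemma cov_linear a b u u' X x : smoothv U X -> U x ->
  cov X (a *: u + b *: u') x = a *: cov X u x + b *: cov X u' x.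
Proof.
move=> sX Ux; rewrite /cov (ddv_linear _ _ _ _ sX Ux) Gam_linear1 //.
by rewrite !scalerDr addrACA.
Qed.

Lemma cov_lincomb a b X Y u x : smoothv U X -> smoothv U Y -> U x ->
  cov (fun y => a *: X y + b *: Y y) u x = a *: cov X u x + b *: cov Y u x.
Proof.
move=> sX sY Ux; rewrite /cov Gam_linear2 //.
have sa c : smooth U (fun=> c) by exact: smooth_cst.
rewrite (ddvD oU (X := fun y => a *: X y) (Y := fun y => b *: Y y)) //;
  try exact: smoothvZ.
rewrite (ddvZ oU (f := fun=> a)) // (ddvZ oU (f := fun=> b)) // !dd_cst !scale0r !add0r.
by rewrite !scalerDr addrACA.
Qed.

Lemma cov_ext X Y u x : (forall y, U y -> X y = Y y) -> U x -> cov X u x = cov Y u x.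
Proof. by move=> XY Ux; rewrite /cov (ddv_ext oU _ XY) // XY. Qed.

Lemma curv_linear1 a b x u u' v w : U x ->
  curv x (a *: u + b *: u') v w = a *: curv x u v w + b *: curv x u' v w.
Proof.
move=> Ux; have sg p q : smoothv U (fun y => Gam y p q) by exact: smooth_Gam.
rewrite /curv cov_linear //.
rewrite (@cov_ext (fun y => Gam y (a *: u + b *: u') w)
  (fun y => a *: Gam y u w + b *: Gam y u' w)) => [||//]; last first.
  by move=> y Uy; rewrite Gam_linear1.
by rewrite cov_lincomb // !scalerBr opprD addrACA.
Qed.

Lemma curv_linear3 a b x u v w w' : U x ->
  curv x u v (a *: w + b *: w') = a *: curv x u v w + b *: curv x u v w'.
Proof.
move=> Ux; have sg p q : smoothv U (fun y => Gam y p q) by exact: smooth_Gam.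
rewrite /curv.
have E p q : cov (fun y => Gam y p (a *: w + b *: w')) q x =
    a *: cov (fun y => Gam y p w) q x + b *: cov (fun y => Gam y p w') q x.
  rewrite -cov_lincomb //; apply: cov_ext => // y Uy.
  by rewrite Gam_linear2.
by rewrite !E !scalerBr opprD addrACA.
Qed.

End LeviCivita.

(** * Algebraic curvature tensors and constant curvature *)

(*%%C2*)
Section CurvatureLike.
Context {R : realType} {V : lmodType R}.
Variable T : V -> V -> V -> V -> R.
Hypothesis T_add : forall u u' v w z, T (u + u') v w z = T u v w z + T u' v w z.
Hypothesis T_skew12 : forall u v w z, T u v w z = - T v u w z.
Hypothesis T_skew34 : forall u v w z, T u v w z = - T u v z w.
Hypothesis T_bianchi : forall u v w z, T u v w z + T v w u z + T w u v z = 0.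

(** The octahedron argument: four Bianchi identities combined by means of the skew symmetries. *)
Lemma curvature_like_pair u v w z : T u v w z = T w z u v.
Proof.
have := T_bianchi u v w z; have := T_bianchi v w z u.
have := T_bianchi w z u v; have := T_bianchi z u v w.
have := T_skew12 u v w z; have := T_skew34 u v w z; have := T_skew34 v u w z.
have := T_skew12 v w u z; have := T_skew34 v w u z; have := T_skew34 w v u z.
have := T_skew12 w u v z; have := T_skew34 w u v z; have := T_skew34 u w v z.
have := T_skew12 w z u v; have := T_skew34 w z u v; have := T_skew34 z w u v.
have := T_skew12 z u v w; have := T_skew34 z u v w; have := T_skew34 u z v w.
have := T_skew12 v z w u; have := T_skew34 v z w u; have := T_skew34 z v w u.
have := T_skew12 u z v w; have := T_skew12 z v w u; have := T_skew12 w v z u.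
by lra.
Qed.

Hypothesis T_sec : forall u v, T u v v u = 0.

(** Polarizing [T_sec] gives skewness in the two middle arguments as well. The three terms of the
    Bianchi identity then coincide, so 3 T = 0. *)
Lemma curvature_like_eq0 u v w z : T u v w z = 0.
Proof.
have add2 a b c d e : T a (b + c) d e = T a b d e + T a c d e.
  by rewrite T_skew12 T_add opprD -(T_skew12 a b) -(T_skew12 a c).
have add3 a b c d e : T a b (c + d) e = T a b c e + T a b d e.
  by rewrite !(curvature_like_pair a b) T_add.
have add4 a b c d e : T a b c (d + e) = T a b c d + T a b c e.
  by rewrite !(curvature_like_pair a b) add2.
have p1 a b c : T a b b c = 0.
  have := T_sec (a + c) b; rewrite T_add !add4 !T_sec add0r addr0.
  rewrite (curvature_like_pair c b b a) (T_skew12 b a c b) (T_skew34 a b c b).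
  by rewrite opprK; lra.
have p2 a b c d : T a b c d = - T a c b d.
  by have := p1 a (b + c) d; rewrite add2 !add3 !p1; lra.
have := T_bianchi u v w z.
have := p2 v w u z; have := p2 w u v z; have := T_skew12 v u w z.
have := T_skew12 w v u z; have := p2 u v w z; have := T_skew12 u w v z.
have := p2 w v u z; have := p2 v u w z.
by lra.
Qed.

End CurvatureLike.

Section ConstantCurvature.
Context {R : realType} {n : nat}.
Local Notation V := 'rV[R]_n.
Variables (U : set V) (G : V -> 'M[R]_n).
Hypothesis oU : open U.
Hypothesis sG : smoothm U G.
Hypothesis tG : forall x, U x -> (G x)^T = G x.
Hypothesis uG : forall x, U x -> G x \in unitmx.

(** The difference from the model tensor is curvature-like and has no sectional curvature. *)
Lemma riem_constant (c : R) x : U x ->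
  (forall u v, riem G x u v v u = c * (bil (G x) u u * bil (G x) v v - bil (G x) u v ^+ 2)) ->
  forall u v w z, riem G x u v w z =
    c * (bil (G x) v w * bil (G x) u z - bil (G x) u w * bil (G x) v z).
Proof.
move=> Ux sec u v w z; apply/eqP; rewrite -subr_eq0; apply/eqP.
pose T u v w z := riem G x u v w z -
  c * (bil (G x) v w * bil (G x) u z - bil (G x) u w * bil (G x) v z).
apply: (@curvature_like_eq0 R V T); rewrite /T => {u v w z}.
- move=> u u' v w z; have := curv_linear1 oU sG tG uG 1 1 u u' v w Ux.
  rewrite !scale1r /riem => ->; rewrite !bilDl; ring.
- by move=> u v w z; rewrite riem_skew12; ring.
- by move=> u v w z; rewrite (riem_skew34 oU sG tG uG) //; ring.
- move=> u v w z; have h := riem_bianchi oU sG tG uG u v w z Ux.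
  rewrite (bil_sym tG w u) // (bil_sym tG w v) // (bil_sym tG v u) //.
  by apply: (etrans _ h); ring.
- by move=> u v; rewrite sec (bil_sym tG v u) //; ring.
Qed.

End ConstantCurvature.

(** * Gauss and Codazzi equations of an isometric immersion *)

Section Submanifold.
Context {R : realType} {n p : nat}.
Local Notation V := 'rV[R]_n.
Local Notation W := 'rV[R]_p.
Variables (U : set V) (U' : set W) (G : V -> 'M[R]_n) (Gt : W -> 'M[R]_p) (F : V -> W).
Hypotheses (oU : open U) (oU' : open U').
Hypothesis sG : smoothm U G.
Hypothesis tG : forall x, U x -> (G x)^T = G x.
Hypothesis uG : forall x, U x -> G x \in unitmx.
Hypothesis sGt : smoothm U' Gt.
Hypothesis tGt : forall x, U' x -> (Gt x)^T = Gt x.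
Hypothesis uGt : forall x, U' x -> Gt x \in unitmx.
Hypothesis dF : forall x, U x -> differentiable F x.
Hypothesis sF : smoothv U F.
Hypothesis FU : forall x, U x -> U' (F x).
Hypothesis isoF : forall x u v, U x ->
  bil (G x) u v = bil (Gt (F x)) (ddv F u x) (ddv F v x).

Local Notation T := (ddv F).
Local Notation g := (fun x => bil (G x)).
Local Notation gt := (fun x => bil (Gt (F x))).

(* Covariant derivative along [F] of a field of ambient tangent vectors. *)
Definition covF (X : V -> W) (u x : V) : W := ddv X u x + Gam Gt (F x) (T u x) (X x).

Definition hess (v w : V) (x : V) : W := covF (T w) v x.

Definition sff (x v w : V) : W := hess v w x - T (Gam G x v w) x.

Let sT v : smoothv U (T v). Proof. exact: smoothv_ddv. Qed.

Let sGF : smoothm U (fun x => Gt (F x)).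
Proof. by move=> i j; apply: (smooth_compose oU dF sF FU (sGt i j)). Qed.

Lemma dd_metricF X Y u x : smoothv U X -> smoothv U Y -> U x ->
  dd (fun y => bil (Gt (F y)) (X y) (Y y)) u x =
  gt x (covF X u x) (Y x) + gt x (X x) (covF Y u x).
Proof.
move=> sX sY Ux; rewrite (dd_bil oU _ sGF sX sY Ux).
rewrite (ddm_compose dF sF FU u sGt Ux).
rewrite (metric_compat oU' sGt tGt uGt _ _ _ (FU Ux)) /covF bilDl bilDr.
by ring.
Qed.

(** In each coordinate the ambient Christoffel map is a bilinear form with matrix [A], so this is
    the product rule for [bil] with the chain rule in the base point. *)
Lemma ddv_Gam_compose X Y u x : smoothv U X -> smoothv U Y -> U x ->
  ddv (fun y => Gam Gt (F y) (X y) (Y y)) u x =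
  ddv (fun z => Gam Gt z (X x) (Y x)) (T u x) (F x)
  + Gam Gt (F x) (ddv X u x) (Y x) + Gam Gt (F x) (X x) (ddv Y u x).
Proof.
move=> sX sY Ux; apply/rowP => k; rewrite ![in RHS]mxE [LHS]mxE.
pose A (z : W) : 'M[R]_p := \matrix_(i, j) Gam Gt z (delta_mx 0 i) (delta_mx 0 j) 0 k.
have sA : smoothm U' A.
  move=> i j; apply: (smooth_ext oU' _ (smooth_Gam oU' sGt uGt (delta_mx 0 i) (delta_mx 0 j) k)).
  by move=> z _; rewrite mxE.
have Gam_suml z (r : seq 'I_p) (f : 'I_p -> R) b : U' z ->
    Gam Gt z (\sum_(i <- r) f i *: delta_mx 0 i) b 0 k =
    \sum_(i <- r) f i * Gam Gt z (delta_mx 0 i) b 0 k.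
  move=> Uz; elim: r => [|i r IH].
    have := Gam_linear1 sGt uGt 0 0 0 0 b Uz.
    by rewrite !big_nil !scale0r addr0 => ->; rewrite mxE.
  have := Gam_linear1 sGt uGt (f i) 1 (delta_mx 0 i) (\sum_(j <- r) f j *: delta_mx 0 j) b Uz.
  by rewrite !big_cons !scale1r => ->; rewrite mxE IH mxE.
have GamA z a b : U' z -> Gam Gt z a b 0 k = bil (A z) a b.
  move=> Uz; rewrite {1}(row_sum_delta a) Gam_suml // /bil; apply: eq_bigr => i _.
  rewrite (Gam_sym oU' sGt tGt uGt) // {1}(row_sum_delta b) Gam_suml //.
  rewrite mulr_sumr; apply: eq_bigr => j _.
  by rewrite (Gam_sym oU' sGt tGt uGt) // mxE; ring.
rewrite (dd_ext oU (g := fun y => bil (A (F y)) (X y) (Y y))) //; last first.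
  by move=> y Uy; rewrite GamA //; exact: FU.
rewrite (dd_bil oU u (A := fun y => A (F y))) //; last first.
  by move=> i j; apply: (smooth_compose oU dF sF FU (sA i j)).
rewrite (ddm_compose dF sF FU u sA Ux) !GamA; try exact: FU.
rewrite -(dd_bil_cst oU' _ _ _ sA (FU Ux)); congr (_ + _ + _).
by apply: (dd_ext oU'); [move=> z Uz; rewrite GamA|exact: FU].
Qed.

Lemma hess_sym u v x : U x -> hess u v x = hess v u x.
Proof.
move=> Ux; rewrite /hess /covF (ddv_comm oU _ _ sF Ux).
by rewrite (Gam_sym oU' sGt tGt uGt _ _ (FU Ux)).
Qed.

Lemma smooth_covF X u : smoothv U X -> smoothv U (covF X u).
Proof.
move=> sX; apply: smoothvD => //; first exact: smoothv_ddv.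
move=> k.
have sI := smoothm_invmx oU' sGt uGt.
have sIF i j : smooth U (fun x => invmx (Gt (F x)) i j).
  by apply: (smooth_compose oU dF sF FU (sI i j)).
apply: (smooth_ext oU (f := fun x =>
   \sum_j chr Gt (F x) (T u x) (X x) (delta_mx 0 j) * invmx (Gt (F x)) j k)).
  by move=> x _; rewrite GamE [RHS]mxE; apply: eq_bigr => j _; rewrite [in RHS]mxE.
apply: smooth_sum => // j _; apply: smoothM => //.
have sD (a : V -> W) b c : smoothv U a -> smoothv U b -> smoothv U c ->
   smooth U (fun x => bil (ddm Gt (a x) (F x)) (b x) (c x)).
  move=> sa sb sc; apply: smooth_bil => // i l.
  apply: (smooth_ext oU (f := fun x => \sum_q a x 0 q *
    dd (fun y => Gt y i l) (delta_mx 0 q) (F x))).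
    by move=> x Ux; rewrite mxE -(dd_coord_sum _ (sGt i l) (FU Ux)).
  apply: smooth_sum => // q _; apply: smoothM => //.
  exact: (smooth_compose oU dF sF FU (smooth_dd (delta_mx 0 q) (sGt i l))).
have sE : smoothv U (fun=> delta_mx 0 j : W) by exact: smoothv_cst.
apply: smoothM => //; first exact: smooth_cst.
by apply: smoothB => //; [apply: smoothD => //|]; apply: sD.
Qed.

Let sS v w : smoothv U (hess v w). Proof. exact: smooth_covF. Qed.

Lemma T_lincomb a b u v x : U x -> T (a *: u + b *: v) x = a *: T u x + b *: T v x.
Proof. by move=> Ux; exact: ddv_linear sF Ux. Qed.

(** The metric is the product of the fields dF(v), whose derivatives are [hess]; by symmetry of
    [hess] Koszul's formula collapses to one term. Thus the tangential part of [hess] is the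
    Levi-Civita connection. *)
Lemma chr_pullback x u v w : U x -> chr G x u v w = gt x (hess u v x) (T w x).
Proof.
move=> Ux.
have E a b c : bil (ddm G a x) b c = gt x (hess a b x) (T c x) + gt x (T b x) (hess a c x).
  rewrite -(dd_bil_cst oU b c a sG Ux) -(dd_metricF a (sT b) (sT c) Ux).
  by apply: (dd_ext oU) => // y Uy; exact: isoF.
rewrite /chr !E (hess_sym v u Ux) (hess_sym w u Ux) (hess_sym w v Ux).
rewrite !(bil_sym tGt (T _ x)); try exact: FU.
by field.
Qed.

Lemma sff_normal x u v w : U x -> gt x (sff x u v) (T w x) = 0.
Proof.
by move=> Ux; rewrite /sff bilBl -chr_pullback // -isoF // (bil_Gam sG uG) // subrr.
Qed.

(** After expansion the second and third derivatives of [F] cancel because they commute, and the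
    ambient curvature on tangent vectors remains. *)
Lemma curvature_along u v w x : U x ->
  covF (hess v w) u x - covF (hess u w) v x =
  curv Gt (F x) (T u x) (T v x) (T w x).
Proof.
move=> Ux.
have E a b c : covF (hess b c) a x = ddv (ddv (T c) b) a x +
   (ddv (fun z => Gam Gt z (T b x) (T c x)) (T a x) (F x)
    + Gam Gt (F x) (ddv (T b) a x) (T c x) + Gam Gt (F x) (T b x) (ddv (T c) a x))
   + (Gam Gt (F x) (T a x) (ddv (T c) b x)
      + Gam Gt (F x) (T a x) (Gam Gt (F x) (T b x) (T c x))).
  rewrite /covF /hess; congr (_ + _); last first.
    have := Gam_linear2 oU' sGt tGt uGt 1 1 (T a x) (ddv (T c) b x)
      (Gam Gt (F x) (T b x) (T c x)) (FU Ux).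
    by rewrite !scale1r.
  rewrite -ddv_Gam_compose // -(ddvD oU) //; first exact: smoothv_ddv.
  have -> : (fun y => Gam Gt (F y) (T b y) (T c y)) = (fun y => covF (T c) b y - ddv (T c) b y).
    by apply/funext => y; rewrite /covF addrAC subrr add0r.
  by apply: smoothvB; [|exact: smooth_covF|exact: smoothv_ddv].
rewrite !E (ddv_comm oU v u (sT w) Ux) (ddv_comm oU v u sF Ux) /curv /cov.
set A := ddv (ddv _ _) _ _; set B := ddv _ _ _; set C := ddv _ _ _.
apply/rowP => k; rewrite !mxE; ring.
Qed.

(** Differentiate [chr_pullback]. Products of two [hess] split into a tangential part, which cancels
    the products of Christoffel terms in [riemE], and a product of second fundamental forms; the
    rest is [curvature_along]. *)
Lemma gauss_equation x u v w z : U x ->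
  riem G x u v w z = riem Gt (F x) (T u x) (T v x) (T w x) (T z x)
    + gt x (sff x v w) (sff x u z) - gt x (sff x u w) (sff x v z).
Proof.
move=> Ux; rewrite (riemE oU sG tG uG) //.
have E a b : dd (fun y => chr G y b w z) a x =
    gt x (covF (hess b w) a x) (T z x) + gt x (hess b w x) (hess a z x).
  rewrite -(dd_metricF a (sS b w) (sT z) Ux).
  by apply: (dd_ext oU) => // y Uy; exact: chr_pullback.
have SE a b c d : gt x (hess a b x) (hess c d x) =
    bil (G x) (Gam G x a b) (Gam G x c d) + gt x (sff x a b) (sff x c d).
  have hE e f : hess e f x = T (Gam G x e f) x + sff x e f by rewrite /sff addrC subrK.
  have n1 := sff_normal a b (Gam G x c d) Ux.
  have n2 := sff_normal c d (Gam G x a b) Ux.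
  rewrite !hE; move: (sff x a b) (sff x c d) n1 n2 => s1 s2 n1 n2.
  rewrite !bilDl !bilDr -isoF // n1 (bil_sym tGt (T _ x) s2 (FU Ux)) n2.
  by rewrite addr0 add0r.
rewrite !E !SE /riem -(curvature_along _ _ _ Ux) bilBl; ring.
Qed.

Section Umbilical.
Variables (k : R) (H : V -> W).
Hypothesis sH : smoothv U H.
Hypothesis umb : forall x u v, U x -> sff x u v = bil (G x) u v *: H x.
Hypothesis nH : forall x u, U x -> gt x (T u x) (H x) = 0.
Hypothesis ambient : forall y a b c d, U' y -> riem Gt y a b c d =
  k * (bil (Gt y) b c * bil (Gt y) a d - bil (Gt y) a c * bil (Gt y) b d).

Lemma umbilical_riem x u v w z : U x -> riem G x u v w z =
  (k + gt x (H x) (H x)) * (bil (G x) v w * bil (G x) u z - bil (G x) u w * bil (G x) v z).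
Proof.
move=> Ux; rewrite gauss_equation // ambient; last exact: FU.
by rewrite -!isoF // !umb // !bilZl !bilZr; ring.
Qed.

(** The component along [H] of [curvature_along]. In a space form the curvature of tangent vectors
    is tangent, so it is zero; on the other side, with sff = g H, the Christoffel terms cancel and
    the derivatives of |H|^2 remain. *)
Lemma codazzi_umbilical x u v w : U x ->
  bil (G x) v w * dd (fun y => gt y (H y) (H y)) u x =
  bil (G x) u w * dd (fun y => gt y (H y) (H y)) v x.
Proof.
move=> Ux.
pose N y := gt y (H y) (H y).
have sN : smooth U N by exact: smooth_bil.
have hE y e f : U y -> hess e f y = T (Gam G y e f) y + bil (G y) e f *: H y.
  by move=> Uy; rewrite -umb // /sff addrC subrK.
have SH y e f : U y -> gt y (hess e f y) (H y) = bil (G y) e f * N y.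
  by move=> Uy; rewrite hE // bilDl bilZl nH // add0r.
have NE a : dd N a x = 2 * gt x (H x) (covF H a x).
  by rewrite (dd_metricF a sH sH Ux) (bil_sym tGt (covF _ _ _) _ (FU Ux)); ring.
(* Obtained by differentiating the orthogonality of dF(b) and [H]. *)
have TH a b : gt x (T b x) (covF H a x) = - (bil (G x) a b * N x).
  apply/eqP; rewrite -addr_eq0 -SH // addrC -(dd_metricF a (sT b) sH Ux).
  rewrite (dd_ext oU (g := fun=> 0)) ?dd_cst // => y Uy.
  by rewrite nH.
have E a b : gt x (covF (hess b w) a x) (H x) =
   bil (ddm G a x) b w * N x + 2^-1 * (bil (G x) b w * dd N a x) + chr G x b w a * N x.
  have D : dd (fun y => bil (G y) b w * N y) a x =
      bil (ddm G a x) b w * N x + bil (G x) b w * dd N a x.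
    rewrite (ddM a (f := fun y => bil (G y) b w) _ sN Ux).
      by rewrite (dd_bil_cst oU).
    by apply: smooth_bil => //; exact: smoothv_cst.
  have := dd_metricF a (sS b w) sH Ux.
  rewrite (dd_ext oU _ (fun y Uy => SH y b w Uy) Ux) D (hE x b w Ux) bilDl bilZl TH.
  rewrite (bil_sym tG a _ Ux) (bil_Gam sG uG _ _ _ Ux) NE => h.
  move: h; set X := gt x (covF _ _ _) (H x); set Z := gt x (H x) (covF H a x).
  set B := bil (G x) b w; set D1 := bil _ b w; set c := chr _ _ _ _ _.
  by move: (N x) X Z B D1 c => N0 X Z B D1 c h; lra.
have tan : gt x (covF (hess v w) u x - covF (hess u w) v x) (H x) = 0.
  rewrite curvature_along //; have := @ambient (F x) (T u x) (T v x) (T w x) (H x) (FU Ux).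
  by rewrite /riem !nH // !mulr0 subrr mulr0.
move: tan; rewrite bilBl !E.
have mc a b c : bil (ddm G a x) b c = chr G x a b c + chr G x a c b.
  by rewrite (metric_compat oU sG tG uG _ _ _ Ux) (bil_sym tG b _ Ux) !(bil_Gam sG uG _ _ _ Ux).
rewrite !mc (chr_sym oU sG tG v u w Ux).
set a1 := dd N u x; set a2 := dd N v x; set b1 := bil _ _ _; set b2 := bil _ _ _.
rewrite (chr_sym oU sG tG u w v Ux) (chr_sym oU sG tG v w u Ux).
by rewrite -/N -/a1 -/a2 => h; lra.
Qed.

End Umbilical.

End Submanifold.

(** * The equation Hess f = - c f g on a space of constant curvature *)

(*%%B6*)
Lemma bil_coordr (R : realType) n (A : 'M[R]_n) (v w : 'rV[R]_n) :
  bil A v w = \sum_k w 0 k * bil A v (delta_mx 0 k).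
Proof.
rewrite {1}(row_sum_delta w) bil_sumr.
by apply: eq_bigr => k _; rewrite bilZr.
Qed.

Section HessianEquation.
Context {R : realType} {n : nat}.
Local Notation V := 'rV[R]_n.
Variables (U : set V) (G : V -> 'M[R]_n) (c : R) (x0 : V).
Hypothesis oU : open U.
Hypothesis sG : smoothm U G.
Hypothesis tG : forall x, U x -> (G x)^T = G x.
Hypothesis uG : forall x, U x -> G x \in unitmx.
Hypothesis curvG : forall x u v w, U x ->
  curv G x u v w = c *: (bil (G x) v w *: u - bil (G x) u w *: v).
Hypothesis Ux0 : U x0.

Local Notation e j := (delta_mx 0 j : V).

(* The connection on pairs (f, df) whose parallel sections are the solutions of
   Hess f = - c f g. *)
Definition tractor (v x : V) : 'M[R]_(1 + n) :=
  block_mx 0 (\row_j (- c * bil (G x) v (e j))) v^T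
           (\matrix_(k, j) Gam G x v (e j) 0 k).

Let Am (i : 'I_n) x := tractor (e i) x.

Lemma smooth_tractor i : smoothm U (Am i).
Proof.
have sg v j : smooth U (fun x => - c * bil (G x) v (e j)).
  apply: smoothM => //; first exact: smooth_cst.
  by apply: smooth_bil => //; exact: smoothv_cst.
move=> a b; rewrite -[a]fintype.splitK -[b]fintype.splitK.
case: (fintype.split a) => a'; case: (fintype.split b) => b' /=.
- apply: smooth_ext (smooth_cst U 0) => // x _.
  by rewrite /Am /tractor block_mxEul mxE.
- apply: smooth_ext (sg (e i) b') => // x _.
  by rewrite /Am /tractor block_mxEur mxE.
- apply: smooth_ext (smooth_cst U ((e i)^T a' b')) => // x _.
  by rewrite /Am /tractor block_mxEdl.
- apply: smooth_ext (smooth_Gam oU sG uG (e i) (e b') a') => // x _.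
  by rewrite /Am /tractor block_mxEdr mxE.
Qed.

Lemma Gam_row_sum x v w k : U x ->
  Gam G x v w 0 k = \sum_i v 0 i * Gam G x (e i) w 0 k.
Proof.
move=> Ux; rewrite {1}(row_sum_delta v).
elim: (index_enum _) => [|i l IH].
  have := Gam_linear1 sG uG 0 0 0 0 w Ux.
  by rewrite !big_nil !scale0r addr0 => ->; rewrite mxE.
have := Gam_linear1 sG uG (v 0 i) 1 (e i) (\sum_(j <- l) v 0 j *: e j) w Ux.
by rewrite !big_cons !scale1r => ->; rewrite mxE IH mxE.
Qed.

Lemma lincomb_tractor v x : U x -> lincomb_mx (Am^~ x) v = tractor v x.
Proof.
move=> Ux; apply/matrixP => a b; rewrite lincomb_mxE -[a]fintype.splitK -[b]fintype.splitK.
case: (fintype.split a) => a'; case: (fintype.split b) => b' /=.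
- rewrite [RHS]block_mxEul mxE big1 // => i _.
  by rewrite /Am /tractor block_mxEul mxE mulr0.
- rewrite [RHS]block_mxEur [RHS]mxE {2}(row_sum_delta v) bil_suml mulr_sumr.
  apply: eq_bigr => i _; rewrite /Am /tractor block_mxEur mxE bilZl; ring.
- rewrite [RHS]block_mxEdl ord1 mxE [v in RHS]row_sum_delta summxE.
  apply: eq_bigr => i _; rewrite /Am /tractor block_mxEdl.
  by rewrite !mxE.
- rewrite [RHS]block_mxEdr mxE Gam_row_sum //.
  by apply: eq_bigr => i _; rewrite /Am /tractor block_mxEdr mxE.
Qed.

Lemma lincomb_tractor_derivative v u x : U x ->
  lincomb_mx (fun i => ddm (Am i) u x) v =
  block_mx 0 (\row_j (- c * bil (ddm G u x) v (e j))) 0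
           (\matrix_(k, j) dd (fun y => Gam G y v (e j) 0 k) u x).
Proof.
move=> Ux; apply/matrixP => a b; rewrite lincomb_mxE -[a]fintype.splitK -[b]fintype.splitK.
case: (fintype.split a) => a'; case: (fintype.split b) => b' /=.
- rewrite [RHS]block_mxEul mxE big1 // => i _; rewrite mxE.
  rewrite (dd_ext oU (g := fun=> 0)) ?dd_cst ?mulr0 // => y _.
  by rewrite /Am /tractor block_mxEul mxE.
- rewrite [RHS]block_mxEur [RHS]mxE {2}(row_sum_delta v) bil_suml mulr_sumr.
  apply: eq_bigr => i _; rewrite bilZl mxE.
  rewrite (dd_ext oU (g := fun y => - c * bil (G y) (e i) (e b'))) //; last first.
    by move=> y _; rewrite /Am /tractor block_mxEur mxE.
  rewrite (ddZ _ _ _ Ux) ?(dd_bil_cst oU _ _ _ sG Ux); last by apply: smooth_bil => //; exact: smoothv_cst.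
  by ring.
- rewrite [RHS]block_mxEdl mxE big1 // => i _; rewrite mxE.
  rewrite (dd_ext oU (g := fun=> (e i)^T a' b')) ?dd_cst ?mulr0 // => y _.
  by rewrite /Am /tractor block_mxEdl.
- rewrite [RHS]block_mxEdr mxE.
  rewrite (dd_ext oU (g := fun y => \sum_i v 0 i * Gam G y (e i) (e b') 0 a')) //; last first.
    by move=> y Uy; exact: Gam_row_sum.
  have sg i : smooth U (fun y => Gam G y (e i) (e b') 0 a') by exact: smooth_Gam.
  rewrite (dd_sum _ _ Ux) => [|i]; last by apply: smoothM => //; exact: smooth_cst.
  apply: eq_bigr => i _; rewrite (ddZ _ _ (sg i) Ux) mxE; congr (_ * _).
  by apply: (dd_ext oU) => // y _; rewrite /Am /tractor block_mxEdr mxE.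
Qed.

(** Block by block: the symmetry of the metric, metric compatibility, the symmetry of the connection
    and, in the last block, the constant curvature hypothesis. *)
Lemma tractor_flat u v x : U x ->
  lincomb_mx (Am^~ x) u *m lincomb_mx (Am^~ x) v + lincomb_mx (fun i => ddm (Am i) u x) v =
  lincomb_mx (Am^~ x) v *m lincomb_mx (Am^~ x) u + lincomb_mx (fun i => ddm (Am i) v x) u.
Proof.
move=> Ux; rewrite !lincomb_tractor // !lincomb_tractor_derivative // /tractor.
rewrite !mulmx_block !add_block_mx !mul0mx !mulmx0 !add0r !addr0.
have rowG w z : (\row_j (- c * bil (G x) w (e j))) *m z^T = (- c * bil (G x) w z)%:M.
  rewrite [LHS]mx11_scalar; congr (_%:M); rewrite mxE {2}(row_sum_delta z) bil_sumr mulr_sumr.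
  by apply: eq_bigr => j _; rewrite !mxE bilZr; ring.
have GamM w z : (\matrix_(k, j) Gam G x w (e j) 0 k) *m z^T = (Gam G x w z)^T.
  apply/colP => k; rewrite !mxE (Gam_sym oU sG tG uG) // Gam_row_sum //.
  by apply: eq_bigr => j _; rewrite !mxE (Gam_sym oU sG tG uG) // mulrC.
congr block_mx.
- by rewrite !rowG (bil_sym tG).
- have E w z : (\row_j (- c * bil (G x) w (e j))) *m (\matrix_(k, j) Gam G x z (e j) 0 k)
     = \row_j (- c * chr G x z (e j) w).
    apply/rowP => j; rewrite !mxE -(bil_Gam sG uG _ _ _ Ux) (bil_sym tG _ _ Ux).
    rewrite bil_coordr mulr_sumr.
    by apply: eq_bigr => k _; rewrite !mxE; ring.
  rewrite !E; apply/rowP => j; rewrite !mxE.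
  rewrite !(metric_compat oU sG tG uG _ _ _ Ux) (bil_sym tG v _ Ux) (bil_sym tG u _ Ux).
  by rewrite !(bil_Gam sG uG _ _ _ Ux) (chr_sym oU sG tG u v) //; ring.
- by rewrite !GamM (Gam_sym oU sG tG uG).
- have E w z : (\matrix_(k, j) Gam G x w (e j) 0 k) *m (\matrix_(k, j) Gam G x z (e j) 0 k)
     = \matrix_(k, j) Gam G x w (Gam G x z (e j)) 0 k.
    apply/matrixP => k j; rewrite !mxE (Gam_sym oU sG tG uG) // Gam_row_sum //.
    by apply: eq_bigr => i _; rewrite !mxE (Gam_sym oU sG tG uG) // mulrC.
  rewrite !E; apply/matrixP => k j.
  have := congr1 (fun M : V => M 0 k) (curvG u v (e j) Ux).
  rewrite /curv /cov !mxE !big_ord1 !mxE.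
  set a1 := dd _ _ _; set a2 := dd _ _ _; set b1 := Gam _ _ _ _ _ _; set b2 := Gam _ _ _ _ _ _.
  by set g1 := bil _ _ _; set g2 := bil _ _ _ => h; lra.
Qed.

(** A parallel section from [frobenius], read back as the pair (f, df). The initial values 1/2 and 0
    give |df|^2 + c f^2 the value c / 4 needed for a flat conformal metric. *)
Lemma hessian_solution : exists (r : R) (f : V -> R),
  [/\ 0 < r, forall p, `|x0 - p| < r -> U p, smooth [set p | `|x0 - p| < r] f,
   f x0 = 2^-1 /\ (forall v, dd f v x0 = 0) &
   forall x v w, `|x0 - x| < r ->
     dd (dd f w) v x = dd f (Gam G x v w) x - c * f x * bil (G x) v w].
Proof.
have [r [Y [r0 rU Yx0 sY dY]]] := @frobenius R n (1 + n) U x0 Am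
  (row_mx (2^-1)%:M 0) oU Ux0 smooth_tractor tractor_flat.
pose B : set V := [set p | `|x0 - p| < r].
have oB : open B.
  have -> : B = ball x0 r by rewrite -ball_normE.
  exact: ball_open.
pose f x := Y x 0 (lshift n 0); pose p k x := Y x 0 (rshift 1 k).
have YE x : Y x = row_mx (f x)%:M (\row_k p k x).
  apply/rowP => a; rewrite -[a]fintype.splitK; case: (fintype.split a) => b /=.
    by rewrite row_mxEl ord1 !mxE /= mulr1n.
  by rewrite row_mxEr mxE.
have dYE x v : B x -> ddv Y v x =
    row_mx (\sum_k p k x * v 0 k)%:M
      (\row_j (- c * f x * bil (G x) v (e j) + \sum_k p k x * Gam G x v (e j) 0 k)).
  move=> Bx; rewrite dY // lincomb_tractor; last exact: rU.
  rewrite YE /tractor mul_row_block mulmx0 add0r; congr row_mx.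
    rewrite [LHS]mx11_scalar; congr (_%:M); rewrite mxE.
    by apply: eq_bigr => k _; rewrite !mxE.
  apply/rowP => j; rewrite mul_scalar_mx [LHS]mxE [RHS]mxE; congr (_ + _).
    by rewrite !mxE; ring.
  by rewrite mxE; apply: eq_bigr => k _; rewrite !mxE.
have df x v : B x -> dd f v x = \sum_k p k x * v 0 k.
  move=> Bx; have := congr1 (fun M : 'rV_(1 + n) => M 0 (lshift n 0)) (dYE x v Bx).
  by rewrite ddvE row_mxEl mxE eqxx mulr1n.
have dp x v j : B x -> dd (p j) v x =
    - c * f x * bil (G x) v (e j) + \sum_k p k x * Gam G x v (e j) 0 k.
  move=> Bx; have := congr1 (fun M : 'rV_(1 + n) => M 0 (rshift 1 j)) (dYE x v Bx).
  by rewrite ddvE row_mxEr mxE.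
have sf : smooth B f by exact: sY.
have sp k : smooth B (p k) by exact: sY.
have Bx0 : B x0 by rewrite /B /= subrr normr0.
exists r, f; split=> //.
  have Y0 : f x0 = 2^-1 by rewrite /f Yx0 row_mxEl mxE eqxx mulr1n.
  split=> // v; rewrite df // big1 // => k _.
  by rewrite /p Yx0 row_mxEr mxE mul0r.
move=> x v w Bx.
rewrite (dd_ext oB (g := fun y => \sum_k w 0 k * p k y)) //; last first.
  by move=> y By; rewrite df //; apply: eq_bigr => k _; rewrite mulrC.
rewrite (@dd_sum _ _ B _ (fun k y => w 0 k * p k y) v x _ Bx) => [|k]; last by apply: smoothM => //; exact: smooth_cst.
rewrite (df x _ Bx).
have -> : \sum_k p k x * Gam G x v w 0 k =
    \sum_j w 0 j * (\sum_k p k x * Gam G x v (e j) 0 k).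
  under [RHS]eq_bigr => j _ do rewrite mulr_sumr.
  rewrite exchange_big; apply: eq_bigr => k _ /=.
  rewrite (Gam_sym oU sG tG uG _ _ (rU x Bx)) (Gam_row_sum _ _ _ (rU x Bx)) mulr_sumr.
  apply: eq_bigr => j _; rewrite (Gam_sym oU sG tG uG _ _ (rU x Bx)); ring.
rewrite (bil_coordr _ v w) mulr_sumr -sumrB.
apply: eq_bigr => j _; rewrite (ddZ _ _ (sp j) Bx) dp //; ring.
Qed.

End HessianEquation.

(** * A flat metric conformal to one of constant curvature *)

(*%%B7*)
Section ConformalChange.
Context {R : realType} {n : nat}.
Local Notation V := 'rV[R]_n.
Variables (U : set V) (G : V -> 'M[R]_n) (c : R) (f : V -> R).
Hypothesis oU : open U.
Hypothesis sG : smoothm U G.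
Hypothesis tG : forall x, U x -> (G x)^T = G x.
Hypothesis uG : forall x, U x -> G x \in unitmx.
Hypothesis riemG : forall x u v w z, U x ->
  riem G x u v w z = c * (bil (G x) v w * bil (G x) u z - bil (G x) u w * bil (G x) v z).
Hypothesis sf : smooth U f.
Hypothesis hess_f : forall x v w, U x ->
  dd (dd f w) v x = dd f (Gam G x v w) x - c * f x * bil (G x) v w.

Definition grad (x : V) : V := (\row_k dd f (delta_mx 0 k) x) *m invmx (G x).

Lemma bil_grad x w : U x -> bil (G x) (grad x) w = dd f w x.
Proof.
move=> Ux; rewrite bil_mul /grad mulmxKV ?uG // (dd_coord_sum w sf Ux) mxE.
by apply: eq_bigr => k _; rewrite !mxE mulrC.
Qed.

Lemma smooth_grad : smoothv U grad.
Proof.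
move=> k; have sI := smoothm_invmx oU sG uG.
apply: (smooth_ext oU (f := fun x => \sum_j dd f (delta_mx 0 j) x * invmx (G x) j k)).
  by move=> x _; rewrite [RHS]mxE; apply: eq_bigr => j _; rewrite mxE.
by apply: smooth_sum => // j _; apply: smoothM => //; exact: smooth_dd.
Qed.

Lemma smooth_norm_grad : smooth U (fun x => bil (G x) (grad x) (grad x)).
Proof. by apply: smooth_bil => //; exact: smooth_grad. Qed.

(* The first integral |df|^2 + c f^2 of the equation Hess f = - c f g. *)
Lemma first_integral x v : U x ->
  dd (fun y => bil (G y) (grad y) (grad y) + c * (f y * f y)) v x = 0.
Proof.
move=> Ux; have sg := smooth_grad.
have sff' : smooth U (fun y => f y * f y) by exact: smoothM.
have scff : smooth U (fun y => c * (f y * f y)) by apply: smoothM => //; exact: smooth_cst.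
rewrite (ddD _ smooth_norm_grad scff Ux) (ddZ _ _ sff' Ux) (ddM _ sf sf Ux).
rewrite (dd_metric oU sG tG uG v sg sg Ux) (bil_sym tG (grad x) (cov _ _ _ _) Ux).
have -> : bil (G x) (cov G grad v x) (grad x) = - c * f x * dd f v x.
  have E w : bil (G x) (cov G grad v x) w = - c * f x * bil (G x) v w.
    have := dd_metric oU sG tG uG (Y := fun=> w) v sg (@smoothv_cst _ _ U _ w) Ux.
    rewrite (dd_ext oU (g := dd f w)) //; last by move=> y Uy; rewrite bil_grad.
    have -> : cov G (fun=> w) v x = Gam G x v w by rewrite /cov ddv_cst add0r.
    by rewrite hess_f // bil_grad // => h; apply/esym/(addIr (dd f (Gam G x v w) x)); rewrite -h; ring.
  by rewrite E (bil_sym tG) // bil_grad.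
by ring.
Qed.

Hypothesis pos : forall x, U x -> 0 < f x + 2^-1.
Hypothesis integral : forall x, U x -> bil (G x) (grad x) (grad x) + c * (f x * f x) = c / 4.

(** On the unit sphere f = cos(r) / 2 and s = cos(r/2)^2, so [phi] is the factor of stereographic
    projection. In general [a] is half the differential of log [phi], and [al] below is the dual
    vector. *)
Let s x := f x + 2^-1.
Let phi x := (s x)^-1 * (s x)^-1.
Let a (v x : V) := - (s x)^-1 * dd f v x.
Let G' x := phi x *: G x.

Let ss : smooth U s. Proof. by apply: smoothD => //; exact: smooth_cst. Qed.

Let s0 x : U x -> s x != 0. Proof. by move=> Ux; rewrite gt_eqF // pos. Qed.

Let sV : smooth U (fun x => (s x)^-1). Proof. by apply: smoothV. Qed.

Lemma conformal_smooth : smooth U phi. Proof. exact: smoothM. Qed.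

Lemma conformal_gt0 x : U x -> 0 < phi x.
Proof. by move=> Ux; rewrite mulr_gt0 // invr_gt0 pos. Qed.

Let dd_s v x : U x -> dd s v x = dd f v x.
Proof.
move=> Ux; rewrite (ddD _ sf (smooth_cst U 2^-1) Ux) dd_cst addr0 //.
Qed.

Let dd_sV v x : U x -> dd (fun y => (s y)^-1) v x = a v x * (s x)^-1.
Proof.
move=> Ux.
have : dd (fun y => s y * (s y)^-1) v x = 0.
  by rewrite (dd_ext oU (g := fun=> 1)) ?dd_cst // => y Uy; rewrite mulfV // s0.
rewrite (ddM _ ss sV Ux) dd_s // => h; apply: (mulfI (s0 Ux)).
move: h => /eqP; rewrite addrC addr_eq0 => /eqP ->.
by rewrite /a; move: (s x) (s0 Ux) (dd f v x) => t t0 y; field.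
Qed.

Let dd_phi v x : U x -> dd phi v x = 2 * a v x * phi x.
Proof. by move=> Ux; rewrite (ddM _ sV sV Ux) !dd_sV // /phi; ring. Qed.

Let sa v : smooth U (a v).
Proof. by apply: smoothM; [|exact: smoothN|exact: smooth_dd]. Qed.

Let kap x := c * f x * (s x)^-1.

(** The covariant derivative of [a] is kap g + a a: apart from the square of [a] it is pure trace,
    which is what the Hessian equation is for. *)
Let dd_a u v x : U x ->
  dd (a v) u x = a (Gam G x u v) x + kap x * bil (G x) u v + a u x * a v x.
Proof.
move=> Ux; have sN : smooth U (fun x => - (s x)^-1) by exact: smoothN.
rewrite (ddM _ sN (smooth_dd v sf) Ux) hess_f //.
have -> : dd (fun y => - (s y)^-1) u x = - (a u x * (s x)^-1).
  rewrite (dd_ext oU (g := fun y => -1 * (s y)^-1)) //; last by move=> y _; rewrite mulN1r.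
  by rewrite (ddZ _ _ sV Ux) dd_sV // mulN1r.
by rewrite /a /kap; ring.
Qed.

Let sG' : smoothm U G'.
Proof.
move=> i j; apply: smooth_ext (smoothM oU conformal_smooth (sG i j)) => // x _.
by rewrite !mxE.
Qed.

Let tG' x : U x -> (G' x)^T = G' x.
Proof. by move=> Ux; rewrite /G' linearZ /= tG. Qed.

Let uG' x : U x -> G' x \in unitmx.
Proof. by move=> Ux; rewrite /G' unitmxZ ?uG // unitfE gt_eqF ?conformal_gt0. Qed.

Let ddm_G' v x : U x -> ddm G' v x = (2 * a v x * phi x) *: G x + phi x *: ddm G v x.
Proof.
move=> Ux; apply/matrixP => i j; rewrite !mxE.
rewrite (dd_ext oU (g := fun y => phi y * G y i j)) //; last by move=> y _; rewrite mxE.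
by rewrite (ddM _ conformal_smooth (sG i j) Ux) dd_phi.
Qed.

Let chr_G' u v w x : U x -> chr G' x u v w = phi x *
  (chr G x u v w + a u x * bil (G x) v w + a v x * bil (G x) u w - a w x * bil (G x) u v).
Proof.
move=> Ux; by rewrite /chr !ddm_G' // !bil_addm !bil_scalem; move: (bil _ _ _) (bil _ _ _) (bil _ _ _) (bil _ _ _) (bil _ _ _) (bil _ _ _) (a _ _) (a _ _) (a _ _) (phi _) => *; field.
Qed.

Let al x := - (s x)^-1 *: grad x.

Let bil_al x w : U x -> bil (G x) (al x) w = a w x.
Proof. by move=> Ux; rewrite bilZl bil_grad. Qed.

Let a_lin x (p q : R) u v : U x -> a (p *: u + q *: v) x = p * a u x + q * a v x.
Proof. by move=> Ux; rewrite /a (dd_linear _ _ _ _ sf Ux); ring. Qed.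

Let Gam_G' u v x : U x -> Gam G' x u v =
  Gam G x u v + a u x *: v + a v x *: u - bil (G x) u v *: al x.
Proof.
move=> Ux; apply: (bil_nondegenerate uG' Ux) => w.
rewrite (bil_Gam sG' uG' _ _ _ Ux) chr_G' // /G' bil_scalem; congr (_ * _).
move: (al x) (bil_al w Ux) => b eb.
by rewrite bilBl !bilDl !bilZl eb (bil_Gam sG uG _ _ _ Ux); ring.
Qed.

(** The squared norm of [a]; here the value c / 4 of the first integral enters, through c (1/4 -
    f^2) / s^2 = c (1/2 - f) / s. *)
Let a_al x : U x -> a (al x) x = c - 2 * kap x.
Proof.
move=> Ux; rewrite -bil_al // /al bilZl bilZr.
have -> : bil (G x) (grad x) (grad x) = c / 4 - c * (f x * f x).
  by rewrite -(integral Ux); ring.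
rewrite /kap /s; have := s0 Ux; rewrite /s => h; field.
by apply: contra h => /eqP h; apply/eqP; lra.
Qed.

(** Half of [riemE] for the new metric, expanded in terms of the old one, so that the
    antisymmetrization in u and v becomes a ring identity. *)
Let term u v w z x : U x ->
  dd (fun y => chr G' y v w z) u x - bil (G' x) (Gam G' x v w) (Gam G' x u z) =
  phi x * (2 * a u x * (chr G x v w z + a v x * bil (G x) w z + a w x * bil (G x) v z
              - a z x * bil (G x) v w)
    + dd (fun y => chr G y v w z) u x
    + (a (Gam G x u v) x + kap x * bil (G x) u v + a u x * a v x) * bil (G x) w z
    + a v x * (chr G x u w z + chr G x u z w)
    + (a (Gam G x u w) x + kap x * bil (G x) u w + a u x * a w x) * bil (G x) v z
    + a w x * (chr G x u v z + chr G x u z v)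
    - (a (Gam G x u z) x + kap x * bil (G x) u z + a u x * a z x) * bil (G x) v w
    - a z x * (chr G x u v w + chr G x u w v)
    - (bil (G x) (Gam G x v w) (Gam G x u z)
       + a u x * chr G x v w z + a z x * chr G x v w u - bil (G x) u z * a (Gam G x v w) x
       + a v x * (chr G x u z w + a u x * bil (G x) w z + a z x * bil (G x) u w
                  - bil (G x) u z * a w x)
       + a w x * (chr G x u z v + a u x * bil (G x) v z + a z x * bil (G x) u v
                  - bil (G x) u z * a v x)
       - (a (Gam G x u z) x + 2 * a u x * a z x - bil (G x) u z * (c - 2 * kap x))
         * bil (G x) v w)).
Proof.
move=> Ux.
pose gg p q := fun y => bil (G y) p q.
have sg p q : smooth U (gg p q) by apply: smooth_bil => //; exact: smoothv_cst.
have sc p q t : smooth U (fun y => chr G y p q t) by exact: smooth_chr.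
have s1 p q t : smooth U (fun y => a p y * gg q t y) by exact: smoothM.
have s2 : smooth U (fun y => chr G y v w z + a v y * gg w z y) by exact: smoothD.
have s3 : smooth U (fun y => chr G y v w z + a v y * gg w z y + a w y * gg v z y).
  exact: smoothD.
have s4 : smooth U (fun y => chr G y v w z + a v y * gg w z y + a w y * gg v z y
   - a z y * gg v w y) by exact: smoothB.
have mc p q : dd (gg p q) u x = chr G x u p q + chr G x u q p.
  rewrite (dd_bil_cst oU _ _ _ sG Ux) (metric_compat oU sG tG uG _ _ _ Ux).
  by rewrite (bil_sym tG p _ Ux) !(bil_Gam sG uG _ _ _ Ux).
have -> : dd (fun y => chr G' y v w z) u x =
   dd (fun y => phi y * (chr G y v w z + a v y * gg w z y + a w y * gg v z y
   - a z y * gg v w y)) u x.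
  by apply: (dd_ext oU) => // y Uy; rewrite chr_G'.
rewrite (ddM _ conformal_smooth s4 Ux) dd_phi // (ddB _ s3 (s1 z v w) Ux).
rewrite (ddD _ s2 (s1 w v z) Ux) (ddD _ (sc v w z) (s1 v w z) Ux).
rewrite !(ddM _ (sa _) (sg _ _) Ux) !mc !dd_a //.
rewrite (bil_Gam sG' uG' _ _ _ Ux) chr_G' // /gg.
set X := Gam G' x u z.
have XE : X = Gam G x u z + a u x *: z + a z x *: u - bil (G x) u z *: al x by exact: Gam_G'.
have gX p : bil (G x) p X = chr G x u z p + a u x * bil (G x) p z + a z x * bil (G x) u p
     - bil (G x) u z * a p x.
  rewrite (bil_sym tG p X Ux) XE; move: (al x) (bil_al p Ux) => b eb.
  by rewrite bilBl !bilDl !bilZl eb (bil_Gam sG uG _ _ _ Ux) (bil_sym tG z p Ux).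
have aX : a X x = a (Gam G x u z) x + 2 * a u x * a z x - bil (G x) u z * (c - 2 * kap x).
  have := a_al Ux; rewrite -(bil_al X Ux) -(bil_al (al x) Ux) XE.
  move: (al x) (bil_al (Gam G x u z) Ux) (bil_al u Ux) (bil_al z Ux) => b e1 e2 e3 e4.
  by rewrite bilBr !bilDr !bilZr e1 e2 e3 e4; ring.
have cX : chr G x v w X = bil (G x) (Gam G x v w) (Gam G x u z)
       + a u x * chr G x v w z + a z x * chr G x v w u - bil (G x) u z * a (Gam G x v w) x.
  rewrite -(bil_Gam sG uG _ _ _ Ux) XE.
  have := bil_al (Gam G x v w) Ux; rewrite (bil_sym tG (al x) _ Ux); move: (al x) => b eb.
  by rewrite bilBr !bilDr !bilZr eb !(bil_Gam sG uG v w _ Ux).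
by rewrite !gX aX cX; ring.
Qed.

(** The curvature of a conformal metric is phi times R minus the Kulkarni-Nomizu product of g with
    (nabla a - a a + |a|^2 g / 2). Here the bracket is kap g + (c / 2 - kap) g = (c / 2) g, and the
    product cancels the curvature c. *)
Lemma conformal_riem x u v w z : U x -> riem G' x u v w z = 0.
Proof.
move=> Ux; rewrite (riemE oU sG' tG' uG') //.
have := term u v w z Ux; have := term v u w z Ux.
set L1 := dd _ _ _ - bil _ _ _; set L2 := dd _ _ _ - bil _ _ _ => E1 E2.
have -> : dd (fun y => chr G' y v w z) u x - dd (fun y => chr G' y u w z) v x
  - bil (G' x) (Gam G' x v w) (Gam G' x u z) + bil (G' x) (Gam G' x u w) (Gam G' x v z)
  = L2 - L1 by rewrite /L1 /L2; ring.
rewrite E1 E2 -mulrBr; apply/eqP; rewrite mulf_eq0; apply/orP; right; apply/eqP.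
have := riemE oU sG tG uG u v w z Ux; rewrite riemG //.
set d1 := dd _ u x; set d2 := dd _ v x; set b1 := bil _ (Gam G x v w) _.
set b2 := bil _ (Gam G x u w) _ => h.
have -> : d1 = c * (bil (G x) v w * bil (G x) u z - bil (G x) u w * bil (G x) v z)
   + d2 + b1 - b2 by rewrite h; ring.
rewrite (bil_sym tG v u Ux) (Gam_sym oU sG tG uG v u Ux).
rewrite (chr_sym oU sG tG v u _ Ux) (chr_sym oU sG tG v u _ Ux).
rewrite (chr_sym oU sG tG v w _ Ux) (chr_sym oU sG tG v z _ Ux).
rewrite (chr_sym oU sG tG u w _ Ux) (chr_sym oU sG tG u z _ Ux).
by ring.
Qed.

Lemma conformal_curv x u v w : U x -> curv G' x u v w = 0.
Proof.
move=> Ux; apply: (bil_nondegenerate uG' Ux) => z.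
by rewrite bil0l; exact: conformal_riem.
Qed.

End ConformalChange.

(*%%B8*)
Lemma ball_openN (R : realType) n (x0 : 'rV[R]_n) (r : R) : open [set p : 'rV[R]_n | `|x0 - p| < r].
Proof.
have -> : [set p : 'rV[R]_n | `|x0 - p| < r] = ball x0 r by rewrite -ball_normE.
exact: ball_open.
Qed.

(** The solution of [hessian_solution] on a ball where f + 1/2 stays positive; the first integral
    has zero derivative there and equals its value c / 4 at the centre. *)
Lemma constant_curvature_conformally_flat (R : realType) n (U : set 'rV[R]_n) (G : 'rV[R]_n -> 'M[R]_n)
    (c : R) (x0 : 'rV[R]_n) :
  open U -> smoothm U G -> (forall x, U x -> (G x)^T = G x) -> (forall x, U x -> G x \in unitmx) ->
  (forall x u v w z, U x ->
    riem G x u v w z = c * (bil (G x) v w * bil (G x) u z - bil (G x) u w * bil (G x) v z)) ->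
  U x0 ->
  exists (B : set 'rV[R]_n) (phi : 'rV[R]_n -> R),
    [/\ open B, B x0, B `<=` U, smooth B phi &
        forall x, B x -> 0 < phi x /\ forall u v w, curv (fun y => phi y *: G y) x u v w = 0].
Proof.
move=> oU sG tG uG riemG Ux0.
have curvG x u v w : U x -> curv G x u v w = c *: (bil (G x) v w *: u - bil (G x) u w *: v).
  move=> Ux; apply: (bil_nondegenerate uG Ux) => z.
  rewrite -[LHS]/(riem G x u v w z) riemG //; apply: etrans (esym (bilZl _ _ _ _)); rewrite bilBl; congr (_ * _).
  by rewrite (bilZl (G x) _ u z) (bilZl (G x) _ v z).
have [r [f [r0 rU sf [f0 df0] hess_f]]] := hessian_solution oU sG tG uG curvG Ux0.
have B0 : [set p : 'rV[R]_n | `|x0 - p| < r] x0 by rewrite /= subrr normr0.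
have /nbhs_radius[r' r'0 near_f0] := smooth_continuous_at sf B0 (ltr01 : (0 : R) < 1).
pose d := Num.min r r'; pose B := [set p : 'rV[R]_n | `|x0 - p| < d].
have d0 : 0 < d by rewrite lt_min r0.
have BU : B `<=` U by move=> p; rewrite /B /= lt_min => /andP[/rU].
have Bx0 : B x0 by rewrite /B /= subrr normr0.
have Br p : B p -> `|x0 - p| < r by rewrite /B /= lt_min => /andP[].
have oB : open B by exact: ball_openN.
have sGB : smoothm B G by move=> i j; exact: smooth_subset (sG i j).
have tGB x : B x -> (G x)^T = G x by move=> /BU; exact: tG.
have uGB x : B x -> G x \in unitmx by move=> /BU; exact: uG.
have sfB : smooth B f by apply: smooth_subset sf => p; exact: Br.
have hB x v w : B x -> dd (dd f w) v x = dd f (Gam G x v w) x - c * f x * bil (G x) v w.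
  by move=> /Br; exact: hess_f.
have rB x u v w z : B x ->
    riem G x u v w z = c * (bil (G x) v w * bil (G x) u z - bil (G x) u w * bil (G x) v z).
  by move=> /BU; exact: riemG.
(* On [B] the value of f differs by less than 1 from 1/2. *)
have pos x : B x -> 0 < f x + 2^-1.
  rewrite /B /= lt_min => /andP[_ /near_f0]; rewrite f0 ltr_norml => /andP[_ h].
  by lra.
have grad0 : bil (G x0) (grad G f x0) (grad G f x0) = 0.
  by rewrite (bil_grad uGB sfB _ Bx0) df0.
pose Q y := bil (G y) (grad G f y) (grad G f y) + c * (f y * f y).
have sQ : smooth B Q.
  apply: smoothD => //; first exact: smooth_norm_grad.
  by apply: smoothM => //; [exact: smooth_cst | exact: smoothM].
have int x : B x -> Q x = c / 4.
  have -> : c / 4 = Q x0 by rewrite /Q grad0 f0 add0r; congr (_ * _); lra.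
  move=> Bx; apply: (zero_derivative_const (r := d) (f := Q)) Bx => y.
    by move=> By; exact: (smooth_differentiable sQ (By : B y)).
  move=> v By; rewrite -ddE; exact: (first_integral oB sGB tGB uGB sfB hB v (By : B y)).
exists B, (fun x => (f x + 2^-1)^-1 * (f x + 2^-1)^-1); split => //.
  exact: conformal_smooth.
move=> x Bx; split; first exact: (conformal_gt0 (U := B) pos Bx).
by move=> u v w; exact: (conformal_curv oB sGB tGB uGB rB sfB hB pos int).
Qed.

(** * The coordinate definitions rewritten with the smooth calculus *)

(*%%D1*)
Lemma innerE (R : realType) n (G : 'rV[R]_n -> 'M[R]_n) x u v : inner G x u v = bil (G x) u v.
Proof. by rewrite /inner -bil_mul. Qed.

Section Coordinates.
Context {R : realType} {n : nat}.
Local Notation V := 'rV[R]_n.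
Variables (U : set V) (G : V -> 'M[R]_n).
Hypothesis oU : open U.
Hypothesis sG : smoothm U G.
Hypothesis tG : forall x, U x -> (G x)^T = G x.
Hypothesis uG : forall x, U x -> G x \in unitmx.

Lemma derive_inner u v w x : U x -> 'D_u (fun y => inner G y v w : R^o) x = bil (ddm G u x) v w.
Proof.
move=> Ux; rewrite -(dd_bil_cst oU _ _ _ sG Ux) ddE.
by congr ('D_u _ x); apply/funext => y; exact: innerE.
Qed.

Lemma christoffelE x u v : U x -> christoffel G x u v = Gam G x u v.
Proof.
move=> Ux; rewrite GamE /christoffel /sharp; congr (_ *m _); apply/rowP => k.
by rewrite !mxE !derive_inner.
Qed.

Lemma nabla_cst u Y x : smoothv U Y -> U x -> nabla G (fun=> u) Y x = cov G Y u x.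
Proof. by move=> sY Ux; rewrite /nabla /cov christoffelE // (derive_ddv _ sY Ux). Qed.

Lemma nabla_ext u X Y x : (forall y, U y -> X y = Y y) -> U x ->
  nabla G (fun=> u) X x = nabla G (fun=> u) Y x.
Proof.
move=> XY Ux; rewrite /nabla XY //; congr (_ + _); apply: near_eq_derive.
by near=> y; apply: XY; near: y; exact: near_open.
Unshelve. all: by end_near. Qed.

Lemma smoothv_Gam u v : smoothv U (fun y => Gam G y u v).
Proof. by move=> k; exact: smooth_Gam. Qed.

Lemma curv_opE x u v w : U x -> curv_op G x u v w = curv G x u v w.
Proof.
move=> Ux; rewrite /curv_op /curvature.
have E p y : U y -> nabla G (fun=> p) (fun=> w) y = Gam G y p w.
  by move=> Uy; rewrite nabla_cst //; [rewrite /cov ddv_cst add0r | exact: smoothv_cst].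
rewrite !(nabla_ext _ (E _) Ux) !(nabla_cst _ (smoothv_Gam _ _) Ux) /curv.
have -> : lie_bracket (fun=> u) (fun=> v) = fun=> 0.
  by apply/funext => y; rewrite /lie_bracket !derive_cst subrr.
rewrite E // -[0 : V](scale0r (0 : V)) -[_ *: _]addr0 -{2}[0 : V](scale0r (0 : V)).
by rewrite (Gam_linear1 sG uG _ _ _ _ _ Ux) !scale0r addr0 subr0.
Qed.

Lemma RiemE x u v w z : U x -> Riem G x u v w z = riem G x u v w z.
Proof. by move=> Ux; rewrite /Riem innerE curv_opE. Qed.
End Coordinates.

Section SubmanifoldCoordinates.
Context {R : realType} {n p : nat}.
Variables (U : set 'rV[R]_n) (U' : set 'rV[R]_(n + p)).
Variables (G : 'rV[R]_n -> 'M[R]_n) (Gt : 'rV[R]_(n + p) -> 'M[R]_(n + p)) (F : 'rV[R]_n -> 'rV[R]_(n + p)).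
Hypotheses (oU : open U) (oU' : open U') (sG : smoothm U G) (uG : forall x, U x -> G x \in unitmx).
Hypotheses (sGt : smoothm U' Gt) (uGt : forall x, U' x -> Gt x \in unitmx).
Hypotheses (sF : smoothv U F) (FU : forall x, U x -> U' (F x)).

Lemma second_ffE x u v : U x -> second_ff G Gt F x u v = sff G Gt F x u v.
Proof.
move=> Ux; rewrite /second_ff (christoffelE oU sG _ _ Ux) (christoffelE oU' sGt _ _ (FU Ux)).
rewrite !(derive_ddv _ sF Ux) /sff /hess /covF; congr (_ + _ - _).
rewrite -(derive_ddv _ (smoothv_ddv oU v sF) Ux); apply: near_eq_derive.
by near=> y; apply: (derive_ddv _ sF); near: y; exact: near_open.
Unshelve. all: by end_near. Qed.
End SubmanifoldCoordinates.

(** * Charts, sectional curvature and the immersion in charts *)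

(*%%D2*)
Definition posdef (R : realType) n (U : set 'rV[R]_n) (G : 'rV[R]_n -> 'M[R]_n) : Prop :=
  forall x u, U x -> u != 0 -> 0 < bil (G x) u u.

Lemma posdef_unitmx (R : realType) n (U : set 'rV[R]_n) (G : 'rV[R]_n -> 'M[R]_n) x :
  posdef U G -> U x -> G x \in unitmx.
Proof.
move=> pG Ux; rewrite -row_free_unit; apply: inj_row_free => v vG.
apply/eqP; apply: contraT => v0; have := pG x v Ux v0.
by rewrite bil_mul vG mul0mx mxE ltxx.
Qed.

(** The hypothesis says nothing when the Gram determinant is zero. There u = 0 or v is a multiple of
    u, so both sides vanish, and [riem_constant] applies to all pairs. *)
Lemma riem_of_sectional (R : realType) n (U : set 'rV[R]_n) (G : 'rV[R]_n -> 'M[R]_n) (k : R) x :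
  open U -> smoothm U G -> (forall x, U x -> (G x)^T = G x) -> posdef U G -> U x ->
  (forall u v, area2 G x u v != 0 -> sectional_curvature G x u v = k) ->
  forall u v w z,
    riem G x u v w z = k * (bil (G x) v w * bil (G x) u z - bil (G x) u w * bil (G x) v z).
Proof.
move=> oU sG tG pG Ux h; have uG y (Uy : U y) := posdef_unitmx pG Uy.
apply: (riem_constant oU sG tG uG Ux) => u v.
have -> : bil (G x) u u * bil (G x) v v - bil (G x) u v ^+ 2 = area2 G x u v.
  by rewrite /area2 !innerE.
have [a0|a0] := eqVneq (area2 G x u v) 0; last first.
  have := h u v a0; rewrite /sectional_curvature (RiemE oU sG uG) // => <-.
  by rewrite mulfVK.
rewrite a0 mulr0; have [->|u0] := eqVneq u 0; first by rewrite /riem bil0r.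
have gu := pG x u Ux u0; pose t := bil (G x) u v / bil (G x) u u.
(* The part of v orthogonal to u has squared length area2 / g(u, u) = 0. The summand 0 brings v into
   the shape of [curv_linear1]. *)
have vE : v = t *: u + 0 *: 0.
  rewrite scale0r addr0; apply/eqP; rewrite -subr_eq0; apply: contraT => w0.
  have := pG x _ Ux w0; rewrite bilBl !bilBr !bilZl !bilZr (bil_sym tG v u Ux). rewrite ?mulrBr.
  suff -> : bil (G x) v v - t * bil (G x) u v - (t * bil (G x) u v - t * (t * bil (G x) u u))
     = area2 G x u v / bil (G x) u u by rewrite a0 mul0r ltxx.
  by rewrite /t /area2 !innerE; field; rewrite gt_eqF.
have E w z : riem G x u u w z = 0.
  by have := riem_skew12 G x u u w z; lra.
rewrite riem_skew12 {1}vE /riem (curv_linear1 oU sG tG uG _ _ _ _ _ _ Ux) scale0r addr0 bilZl.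
by rewrite -/(riem G x u u v u) E mulr0 oppr0.
Qed.

Section Charts.
Context {R : realType} {n : nat} (M : riemannian_manifold R n).

Lemma smoothm_metric (i : atlas_index M) : smoothm (chart_codom (atlas i)) (metric i).
Proof.
move=> a b; apply: smooth_ext (@metric_smooth R n M i (delta_mx 0 a) (delta_mx 0 b)).
  exact: chart_codom_open.
by move=> x _ /=; rewrite innerE bil_delta.
Qed.

Lemma metric_tr (i : atlas_index M) x : chart_codom (atlas i) x -> (metric i x)^T = metric i x.
Proof.
move=> Ux; apply/matrixP => a b; rewrite mxE.
by rewrite -(bil_delta (metric i x)) -innerE (Defs.metric_sym _ _ Ux) innerE bil_delta.
Qed.

Lemma posdef_metric (i : atlas_index M) : posdef (chart_codom (atlas i)) (metric i).
Proof. by move=> x u Ux u0; rewrite -innerE; exact: metric_pos. Qed.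

Lemma riem_constant_curvature (k : R) (i : atlas_index M) x : constant_curvature M k ->
  chart_codom (atlas i) x -> forall u v w z, riem (metric i) x u v w z =
    k * (bil (metric i x) v w * bil (metric i x) u z - bil (metric i x) u w * bil (metric i x) v z).
Proof.
move=> hM Ux; apply: (riem_of_sectional _ (@smoothm_metric i) (@metric_tr i) (@posdef_metric i) Ux).
  exact: chart_codom_open.
by case: Ux => q dq <-; exact: hM dq.
Qed.
End Charts.

Section LocalExpression.
Context {R : realType} {n m : nat}.
Variables (M : riemannian_manifold R n) (N : riemannian_manifold R (n + m)) (f : M -> N).
Hypothesis hf : isometric_immersion f.
Variables (i : atlas_index M) (j : atlas_index N).

Definition overlap : set 'rV[R]_n :=
  chart_fun (atlas i) @` (chart_dom (atlas i) `&` f @^-1` chart_dom (atlas j)).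

Lemma open_overlap : open overlap.
Proof.
case: hf => -[cf _] _; rewrite openE => x [p [di dj] <-].
have oD : open (chart_dom (atlas i) `&` f @^-1` chart_dom (atlas j)).
  apply: openI; first exact: chart_dom_open.
  by apply: open_comp => [q _|]; [exact: cf | exact: chart_dom_open].
have Np : nbhs p (chart_dom (atlas i) `&` f @^-1` chart_dom (atlas j)).
  by apply: open_nbhs_nbhs.
have Nx : nbhs (chart_fun (atlas i) p) (chart_codom (atlas i)).
  apply: open_nbhs_nbhs; split; first exact: chart_codom_open.
  by exists p.
have Np' : nbhs (chart_inv (atlas i) (chart_fun (atlas i) p))
    (chart_dom (atlas i) `&` f @^-1` chart_dom (atlas j)) by rewrite chart_funK.
have Ny := chart_inv_continuous di Np'.
apply: filterS (filterI Nx Ny) => y [[q dq <-]] /=.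
by rewrite (chart_funK dq) => -[_ dj']; exists q.
Qed.

Lemma overlap_codom : overlap `<=` chart_codom (atlas i).
Proof. by move=> x [p [di _] <-]; exists p. Qed.

Lemma local_expr_codom x : overlap x -> chart_codom (atlas j) (local_expr f i j x).
Proof.
by move=> [p [di dj] <-]; exists (f p) => //; rewrite /local_expr /= (chart_funK di).
Qed.

Lemma smoothv_local_expr : smoothv overlap (local_expr f i j).
Proof. by case: hf => -[_ h] _; exact: smooth_on_smoothv open_overlap (h i j). Qed.

Lemma differentiable_local_expr x : overlap x -> differentiable (local_expr f i j) x.
Proof. by case: hf => -[_ h] _; case: (h i j 1%N) => + _; exact. Qed.

Lemma local_expr_isometric x u v : overlap x -> bil (metric i x) u v =
  bil (metric j (local_expr f i j x)) (ddv (local_expr f i j) u x) (ddv (local_expr f i j) v x).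
Proof.
move=> Ux; rewrite -!(derive_ddv _ smoothv_local_expr Ux) -!innerE.
by case: Ux => p [di dj] <-; case: hf => _ /(_ p i j di dj)[_]; exact.
Qed.
End LocalExpression.

(** * Orthonormal bases and complements *)

(*%%D3*)
Section Frames.
Context {R : realType}.

Lemma bil_row N p q (A : 'M[R]_N) (P : 'M[R]_(p, N)) (Q : 'M[R]_(q, N)) i j :
  bil A (row i P) (row j Q) = (P *m A *m Q^T) i j.
Proof. by rewrite bil_mul tr_row -!row_mul !mxE; apply: eq_bigr => k _; rewrite !mxE. Qed.

Section Basis.
Variables (N : nat) (A : 'M[R]_N).
Hypotheses (tA : A^T = A) (pA : forall v : 'rV[R]_N, v != 0 -> 0 < bil A v v).

(** Diagonalize the Gram matrix of the rows of [K]. Its eigenvalues are squared lengths of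
    independent vectors, hence positive, and the rows can be rescaled. *)
Lemma orthonormal_basis m (K : 'M[R]_(m, N)) : row_free K ->
  exists P : 'M[R]_(m, N), P *m A *m P^T = 1%:M /\ (P :=: K)%MS.
Proof.
move=> fK; have tB : (K *m A *m K^T)^T = K *m A *m K^T.
  by rewrite !trmx_mul trmxK tA mulmxA.
have [Q [d [QQ QB]]] := symmetric_diagonalization tB.
have uQ : Q \in unitmx by exact: (mulmx1_unit QQ).1.
have QK : row_free (Q *m K) by rewrite /row_free mxrankMfree // -/(row_free Q) row_free_unit.
have d0 i : 0 < d 0 i.
  have -> : d 0 i = bil A (row i (Q *m K)) (row i (Q *m K)).
    by rewrite bil_row trmx_mul !mulmxA -(mulmxA Q) -(mulmxA Q) QB mxE eqxx.
  apply: pA; apply/eqP => r0; have /row_freeP[Z ZE] := QK.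
  have : row i (Q *m K *m Z) = 0 by rewrite row_mul r0 mul0mx.
  by rewrite ZE => /rowP/(_ i); rewrite !mxE eqxx => /eqP; rewrite oner_eq0.
pose D : 'rV[R]_m := \row_i (Num.sqrt (d 0 i))^-1.
have uD : diag_mx D \in unitmx.
  rewrite unitmxE det_diag unitfE; apply/prodf_neq0 => i _.
  by rewrite mxE invr_eq0 gt_eqF // sqrtr_gt0.
exists (diag_mx D *m (Q *m K)); split; last first.
  apply/eqmxP; rewrite !(eqmxMfull _ _) ?row_full_unit //.
  by apply/andP.
have -> : diag_mx D *m (Q *m K) *m A *m (diag_mx D *m (Q *m K))^T
   = diag_mx D *m (Q *m (K *m A *m K^T) *m Q^T) *m diag_mx D.
  by rewrite !trmx_mul tr_diag_mx !mulmxA.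
rewrite QB mul_mx_diag mul_diag_mx; apply/matrixP => i k; rewrite !mxE.
have [->|ik] := eqVneq i k; last by rewrite !mulr0n mulr0 mul0r.
have s0 : Num.sqrt (d 0 k) != 0 by rewrite gt_eqF // sqrtr_gt0.
rewrite !mulr1n -{2}(sqr_sqrtr (ltW (d0 k))) expr2.
by rewrite mulrA mulVf // mul1r mulfV.
Qed.

(** An orthonormal basis of the kernel of A T^T, of rank r by counting. It serves both for normal
    frames and for tangent vectors orthogonal to f1 and f2. *)
Lemma orthonormal_complement q r (T : 'M[R]_(q, N)) : (q + r)%N = N -> row_free T ->
  exists P : 'M[R]_(r, N), [/\ P *m A *m P^T = 1%:M, P *m A *m T^T = 0 &
    forall w : 'rV[R]_N, w *m A *m T^T = 0 -> w = (w *m A *m P^T) *m P].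
Proof.
move=> qr fT; have uA : A \in unitmx.
  rewrite -row_free_unit; apply: inj_row_free => v vA.
  apply/eqP; apply: contraT => v0; have := pA v0.
  by rewrite bil_mul vA mul0mx mxE ltxx.
have rK : \rank (kermx (A *m T^T)) = r.
  have -> : r = (N - q)%N by rewrite -[in LHS](addKn q r) qr.
  rewrite mxrank_ker; congr (_ - _)%N.
  by rewrite (eqmxMfull _ _) ?row_full_unit // mxrank_tr; exact/eqP.
have [K fK KE] : exists2 K : 'M[R]_(r, N), row_free K & (K :=: kermx (A *m T^T))%MS.
  case: _ / rK; exists (row_base (kermx (A *m T^T))); first exact: row_base_free.
  exact: eq_row_base.
have [P [PP PK]] := orthonormal_basis fK; exists P; split => //.
  by rewrite -mulmxA; apply/sub_kermxP; rewrite PK KE.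
move=> w; rewrite -mulmxA => /sub_kermxP wK.
have /submxP[c wE] : (w <= P)%MS by rewrite PK KE.
by rewrite [in RHS]wE -2!(mulmxA c) PP mulmx1.
Qed.
End Basis.
End Frames.

(** * Curvature of the extremal shape: C.R against Q(g,C) *)

(*%%D4*)
Section PointwiseCurvature.
Context {R : realType} {n : nat}.
Local Notation V := 'rV[R]_n.
Variables (G : V -> 'M[R]_n) (x : V) (c mu p q : R) (f1 f2 : V).
Local Notation g := (bil (G x)).
Hypothesis tG : (G x)^T = G x.
Hypothesis uG : G x \in unitmx.
Hypotheses (g11 : g f1 f1 = 1) (g22 : g f2 f2 = 1) (g12 : g f1 f2 = 0).

Let gC u v : g u v = g v u. Proof. by rewrite -{1}tG bil_tr. Qed.

Let s1 := p *: f1 + q *: f2.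
Let s2 := q *: f1 - p *: f2.
Let S u := g u f1 *: s1 + g u f2 *: s2.

Definition wedgev (a b w : V) : V := g b w *: a - g a w *: b.

(** What the Gauss equation yields for the shape found in [wintgen_shape], with c = k + |H|^2. Here
    p and q are the components of the mean curvature vector along the two normal directions, and mu
    [S] is the traceless part of the shape operator along that vector. *)
Definition wintgen_curv (u v w : V) : V :=
  c *: wedgev u v w + mu *: (wedgev (S u) v w + wedgev u (S v) w)
  - (2 * mu ^+ 2 * (g u f1 * g v f2 - g u f2 * g v f1)) *: wedgev f1 f2 w.

Hypothesis curvE : forall u v w, curv_op G x u v w = wintgen_curv u v w.

(** Reads a trace off a decomposition into a multiple of the identity and rank-one maps, listed in
    [s] as pairs of a dual vector and a value. *)
Lemma trace_lin1 (f : V -> V) (a : R) (s : seq (V * V)) :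
  (forall u, f u = a *: u + \sum_(t <- s) g u t.1 *: t.2) ->
  \tr (lin1_mx f) = a * n%:R + \sum_(t <- s) g t.2 t.1.
Proof.
move=> fE; rewrite /mxtrace.
under eq_bigr => k _ do rewrite mxE fE mxE summxE.
rewrite big_split /=; congr (_ + _).
  under eq_bigr => k _ do rewrite !mxE !eqxx mulr1.
  by rewrite sumr_const card_ord mulr_natr.
rewrite exchange_big; apply: eq_bigr => t _.
rewrite {2}(row_sum_delta t.2) bil_suml; apply: eq_bigr => k _.
by rewrite bilZl !mxE mulrC.
Qed.

Lemma sharpE (w : V -> R) (v : V) : (forall u, w u = g v u) -> sharp G x w = v.
Proof.
move=> wE; rewrite /sharp -[RHS](mulmxK uG); congr (_ *m _); apply/rowP => k.
by rewrite mxE wE bil_mul trmx_delta -colE mxE.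
Qed.

Lemma wintgen_Ricc v w : Ricc G x v w =
  c * (n%:R - 1) * g v w + (n%:R - 2) * mu * g (S v) w
  - 2 * mu ^+ 2 * (g v f1 * g w f1 + g v f2 * g w f2).
Proof.
(* The list collects the rank-one parts of the map sending z to R(z, v) w. *)
rewrite /Ricc (@trace_lin1 _ (c * g v w + mu * g (S v) w)
  [:: (f1, (mu * g v w) *: s1 - (2 * mu ^+ 2 * g v f2) *: (g f2 w *: f1 - g f1 w *: f2));
      (f2, (mu * g v w) *: s2 + (2 * mu ^+ 2 * g v f1) *: (g f2 w *: f1 - g f1 w *: f2));
      (w, - (c *: v + mu *: S v));
      (g w f1 *: s1 + g w f2 *: s2, - (mu *: v))]); last first.
  move=> u; rewrite curvE /wintgen_curv /wedgev !big_cons big_nil /=.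
  rewrite /S /s1 /s2 !(bilDl, bilDr, bilNl, bilNr, bilZl, bilZr) (gC f1 w) (gC f2 w).
  apply/rowP => k; rewrite !mxE.
  ring.
rewrite !big_cons big_nil /= /S /s1 /s2.
rewrite !(bilDl, bilDr, bilNl, bilNr, bilZl, bilZr) g11 g22 (gC f2 f1) g12.
rewrite (gC f1 w) (gC f2 w); ring.
Qed.

Lemma wintgen_ricci_op v : ricci_op G x v = (c * (n%:R - 1)) *: v + ((n%:R - 2) * mu) *: S v
  - (2 * mu ^+ 2) *: (g v f1 *: f1 + g v f2 *: f2).
Proof.
apply: sharpE => w; rewrite wintgen_Ricc.
rewrite !(bilDl, bilNl, bilZl) (gC f1 w) (gC f2 w); ring.
Qed.

Lemma wintgen_scal : scal G x = c * n%:R * (n%:R - 1) - 4 * mu ^+ 2.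
Proof.
rewrite /scal (@trace_lin1 _ (c * (n%:R - 1))
  [:: (f1, ((n%:R - 2) * mu) *: s1 - (2 * mu ^+ 2) *: f1);
      (f2, ((n%:R - 2) * mu) *: s2 - (2 * mu ^+ 2) *: f2)]); last first.
  move=> u; rewrite wintgen_ricci_op !big_cons big_nil /= /S.
  by apply/rowP => k; rewrite !mxE; ring.
rewrite !big_cons big_nil /= /s1 /s2 !(bilDl, bilNl, bilZl) g11 g22 (gC f2 f1) g12.
by ring.
Qed.

Lemma wedgeE a b w : wedge (inner G x) a b w = wedgev a b w.
Proof. by rewrite /wedge !innerE. Qed.

Lemma RiemE_wintgen u v w z : Riem G x u v w z = g (wintgen_curv u v w) z.
Proof. by rewrite /Riem innerE curvE. Qed.

(** [S] is traceless, so the part of the curvature linear in it is pure Ricci and drops out: the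
    Weyl tensor depends on mu and on the plane of f1, f2, but not on c, p, q. *)
Lemma wintgen_weyl_op u v w : (2 < n)%N -> weyl_op G x u v w =
  (4 * mu ^+ 2 / ((n%:R - 1) * (n%:R - 2))) *: - wedgev u v w
  - (2 * mu ^+ 2 * (g u f1 * g v f2 - g u f2 * g v f1)) *: wedgev f1 f2 w
  + (2 * mu ^+ 2 / (n%:R - 2)) *: (wedgev u (g v f1 *: f1 + g v f2 *: f2) w
                                 + wedgev (g u f1 *: f1 + g u f2 *: f2) v w).
Proof.
move=> n2; have n1 : n%:R - 1 != 0 :> R.
  by rewrite subr_eq0 (eqr_nat R n 1) neq_ltn (ltn_trans _ n2) ?orbT.
have nn2 : n%:R - 2 != 0 :> R by rewrite subr_eq0 (eqr_nat R n 2) neq_ltn n2 orbT.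
rewrite /weyl_op curvE !wintgen_ricci_op wintgen_scal !wedgeE /wintgen_curv /wedgev.
rewrite !(bilDl, bilDr, bilNl, bilNr, bilZl, bilZr).
move: (n%:R : R) n1 nn2 => N n1 nn2.
apply/rowP => k; rewrite !mxE; move: (S u) (S v) => Su Sv.
by field; rewrite n1 nn2.
Qed.

Lemma umbilical_C_dot_R x1 x2 x3 x4 u v : (2 < n)%N -> mu = 0 ->
  C_dot_R G x x1 x2 x3 x4 u v = 0.
Proof.
move=> n2 mu0; have W a b w : weyl_op G x a b w = 0.
  by rewrite wintgen_weyl_op // mu0 expr0n /= !mulr0 !mul0r !scale0r subrr addr0.
rewrite /C_dot_R /act4 !W !RiemE_wintgen bil0r /wintgen_curv /wedgev /S.
rewrite !(bil0l, bil0r, mul0r, mulr0, scale0r, scaler0, mu0, subrr, addr0, add0r).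
by rewrite !(oppr0, scaler0, mulr0, scale0r, bil0l, addr0).
Qed.

Let sg u v := g u f1 * (p * g v f1 + q * g v f2) + g u f2 * (q * g v f1 - p * g v f2).

Lemma wintgen_Riem u v w z : Riem G x u v w z =
  c * (g v w * g u z - g u w * g v z)
  + mu * (g v w * sg u z - sg u w * g v z + sg v w * g u z - g u w * sg v z)
  - 2 * mu ^+ 2 * (g u f1 * g v f2 - g u f2 * g v f1) * (g w f2 * g z f1 - g w f1 * g z f2).
Proof.
rewrite RiemE_wintgen /wintgen_curv /wedgev /S /s1 /s2.
rewrite !(bilDl, bilNl, bilZl) /sg !(gC f1) !(gC f2); ring.
Qed.

Lemma wintgen_Weyl u v w z : (2 < n)%N -> Weyl G x u v w z =
  - (4 * mu ^+ 2 / ((n%:R - 1) * (n%:R - 2))) * (g v w * g u z - g u w * g v z)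
  - 2 * mu ^+ 2 * (g u f1 * g v f2 - g u f2 * g v f1) * (g w f2 * g z f1 - g w f1 * g z f2)
  + 2 * mu ^+ 2 / (n%:R - 2) *
    ((g v f1 * g w f1 + g v f2 * g w f2) * g u z - g u w * (g v f1 * g z f1 + g v f2 * g z f2)
     + g v w * (g u f1 * g z f1 + g u f2 * g z f2) - (g u f1 * g w f1 + g u f2 * g w f2) * g v z).
Proof.
move=> n2; rewrite /Weyl innerE wintgen_weyl_op // /wedgev.
rewrite !(bilDl, bilNl, bilZl) !(gC f1) !(gC f2).
by move: (_ / _) (_ / _) => k1 k2; ring.
Qed.

(** On the planes (f1, f3) and (f2, f3) the Weyl operator is om times the wedge, which makes both
    tensors easy to evaluate. The unknown p enters [E1] and [E3] with opposite signs, so their sum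
    gives b = 0; adding [E2] and [E3] then gives a = 0, since om is nonzero for n > 3. *)
Lemma wintgen_independent (f3 f4 : V) : (3 < n)%N -> mu != 0 ->
  g f3 f3 = 1 -> g f4 f4 = 1 -> g f3 f4 = 0 ->
  g f3 f1 = 0 -> g f3 f2 = 0 -> g f4 f1 = 0 -> g f4 f2 = 0 ->
  ~ lin_dep6 (C_dot_R G x) (Q_g_C G x).
Proof.
move=> n3 mu0 g33 g44 g34 g31 g32 g41 g42 [a [b [ab0 dep]]].
have n2 : (2 < n)%N by exact: ltnW.
have nn1 : n%:R - 1 != 0 :> R.
  by rewrite subr_eq0 (eqr_nat R n 1) neq_ltn (ltn_trans _ n2) ?orbT.
have nn2 : n%:R - 2 != 0 :> R by rewrite subr_eq0 (eqr_nat R n 2) neq_ltn n2 orbT.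
have nn3 : n%:R - 3 != 0 :> R by rewrite subr_eq0 (eqr_nat R n 3) neq_ltn n3 orbT.
have gE := (g11, g22, g33, g44, g12, g34, g31, g32, g41, g42,
  (etrans (gC f2 f1) g12), (etrans (gC f4 f3) g34), (etrans (gC f1 f3) g31),
  (etrans (gC f2 f3) g32), (etrans (gC f1 f4) g41), (etrans (gC f2 f4) g42)).
pose om : R := 2 * mu ^+ 2 * (n%:R - 3) / ((n%:R - 1) * (n%:R - 2)).
have W i w : weyl_op G x (if i then f1 else f2) f3 w = om *: wedgev (if i then f1 else f2) f3 w.
  rewrite wintgen_weyl_op // /om /wedgev; move: (n%:R : R) nn1 nn2 => N n1 n2'; case: i;
  rewrite !(gE, bilDl, bilDr, bilZl, bilZr);
  by apply/rowP => k; rewrite !mxE; field; rewrite n1 n2'.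
have w11 : wedgev f1 f3 f1 = - f3 by rewrite /wedgev !gE scale0r scale1r add0r.
have w13 : wedgev f1 f3 f3 = f1 by rewrite /wedgev !gE scale0r scale1r subr0.
have w12 : wedgev f1 f3 f2 = 0 by rewrite /wedgev !gE !scale0r subrr.
have w14 : wedgev f1 f3 f4 = 0 by rewrite /wedgev !gE !scale0r subrr.
have w22 : wedgev f2 f3 f2 = - f3 by rewrite /wedgev !gE scale0r scale1r add0r.
have w23 : wedgev f2 f3 f3 = f2 by rewrite /wedgev !gE scale0r scale1r subr0.
have w24 : wedgev f2 f3 f4 = 0 by rewrite /wedgev !gE !scale0r subrr.
have E1 : a * (- om * mu * p) + b * (- 2 * mu ^+ 2 / (n%:R - 2)) = 0.
  have := dep f1 f4 f4 f3 f1 f3; rewrite /C_dot_R /Q_g_C /act4.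
  rewrite !(W true) !wedgeE w11 w13 w14 !wintgen_Riem !wintgen_Weyl // /sg !(bilNl, bilNr, bilZl, bilZr, bil0l, bil0r).
  rewrite !gE => <-.
  by rewrite /om; move: (n%:R : R) nn1 nn2 => N n1 n2'; field; rewrite n1 n2'.
have E2 : a * (om * (2 * mu ^+ 2 - mu * p)) + b * (2 * mu ^+ 2 * (n%:R - 3) / (n%:R - 2)) = 0.
  have := dep f1 f2 f2 f3 f1 f3; rewrite /C_dot_R /Q_g_C /act4.
  rewrite !(W true) !wedgeE w11 w13 w12 !wintgen_Riem !wintgen_Weyl // /sg !(bilNl, bilNr, bilZl, bilZr, bil0l, bil0r).
  rewrite !gE => <-.
  by rewrite /om; move: (n%:R : R) nn1 nn2 => N n1 n2'; field; rewrite n1 n2'.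
have E3 : a * (om * mu * p) + b * (- 2 * mu ^+ 2 / (n%:R - 2)) = 0.
  have := dep f2 f4 f4 f3 f2 f3; rewrite /C_dot_R /Q_g_C /act4.
  rewrite !(W false) !wedgeE w22 w23 w24 !wintgen_Riem !wintgen_Weyl // /sg !(bilNl, bilNr, bilZl, bilZr, bil0l, bil0r).
  rewrite !gE => <-.
  by rewrite /om; move: (n%:R : R) nn1 nn2 => N n1 n2'; field; rewrite n1 n2'.
have om0 : om != 0 by rewrite /om !mulf_neq0 ?invr_eq0 ?mulf_neq0 ?expf_neq0 ?pnatr_eq0.
have b0 : b = 0.
  have : b * (4 * mu ^+ 2 / (n%:R - 2)) = 0 by lra.
  move/eqP; rewrite mulf_eq0 => /orP[/eqP //|].
  by rewrite !mulf_eq0 invr_eq0 (negbTE nn2) pnatr_eq0 (negbTE mu0).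
have a0 : a = 0.
  have : a * (om * (2 * mu ^+ 2)) = 0 by move: E2 E3; rewrite b0 !mul0r !addr0 => E2 E3; lra.
  move/eqP; rewrite mulf_eq0 => /orP[/eqP //|].
  by rewrite mulf_eq0 (negbTE om0) !mulf_eq0 pnatr_eq0 (negbTE mu0).
by move: ab0; rewrite a0 b0 eqxx.
Qed.
End PointwiseCurvature.

(** * The Wintgen equality as equality for the traceless shape matrices *)

(*%%D5*)
Section PairSums.
Variables (R : realType) (n : nat) (f : 'I_n -> 'I_n -> R).
Hypotheses (fC : forall i j, f i j = f j i) (f0 : forall i, f i i = 0).

Lemma sum_pairs : \sum_i \sum_j f i j = 2 * \sum_(i < n) \sum_(j < n | (i < j)%N) f i j.
Proof.
transitivity (\sum_(i < n) \sum_(j < n | (i < j)%N) f i j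
            + \sum_(i < n) \sum_(j < n | ~~ (i < j)%N) f i j).
  by rewrite -big_split; apply: eq_bigr => i _; rewrite (bigID (fun j : 'I_n => (i < j)%N)).
rewrite mulr_natl mulr2n; congr (_ + _).
rewrite (exchange_big_dep xpredT) //=; apply: eq_bigr => j _.
under eq_bigl => i do rewrite -leqNgt.
rewrite (bigD1 j) //= f0 add0r; apply: eq_big => i; last by move=> _; exact: fC.
by rewrite ltn_neqAle eq_sym andbC.
Qed.
End PairSums.

Lemma bil_sharp (R : realType) n (G : 'rV[R]_n -> 'M[R]_n) x (w : 'rV[R]_n -> R) v :
  G x \in unitmx -> (forall a b u u', w (a *: u + b *: u') = a * w u + b * w u') ->
  bil (G x) (sharp G x w) v = w v.
Proof.
move=> uG wl; rewrite bil_mul /sharp mulmxKV // mxE.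
have w0 : w 0 = 0.
  by have := wl 0 0 0 0; rewrite !scale0r addr0 !mul0r addr0.
have wS (I : finType) (c : I -> R) (X : I -> 'rV[R]_n) :
    w (\sum_i c i *: X i) = \sum_i c i * w (X i).
  elim/big_rec2: _ => [//|i y z _ <-].
  by rewrite -[z in LHS]scale1r wl mul1r.
rewrite {2}(row_sum_delta v) wS; apply: eq_bigr => k _.
by rewrite !mxE mulrC.
Qed.

(*%%D6*)
Section Wintgen.
Context {R : realType} {n m : nat}.
Local Notation V := 'rV[R]_n.
Local Notation W := 'rV[R]_(n + m).
Variables (G : V -> 'M[R]_n) (Gt : W -> 'M[R]_(n + m)) (F : V -> W) (x : V) (k : R).
Local Notation g := (bil (G x)).
Local Notation gt := (bil (Gt (F x))).
Variable h : V -> V -> W.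
Hypothesis hE : forall u v, second_ff G Gt F x u v = h u v.
Hypotheses (tG : (G x)^T = G x) (uG : G x \in unitmx).
Hypothesis tGt : (Gt (F x))^T = Gt (F x).
Hypothesis hC : forall u v, h u v = h v u.
Hypothesis h_linear : forall a b u u' v, h (a *: u + b *: u') v = a *: h u v + b *: h u' v.
Hypothesis gauss : forall u v w z, Riem G x u v w z =
  k * (g v w * g u z - g u w * g v z) + gt (h v w) (h u z) - gt (h u w) (h v z).
Variables (E : 'I_n -> V) (xi : 'I_m -> W).
Hypothesis oE : orthonormal_frame G x E.
Hypothesis oxi : forall a b, gt (xi a) (xi b) = (a == b)%:R.
Hypothesis h_normal : forall u v, h u v = \sum_a gt (h u v) (xi a) *: xi a.
Hypothesis n2 : (1 < n)%N.

Let gC u v : g u v = g v u. Proof. by rewrite -{1}tG bil_tr. Qed.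
Let gtC u v : gt u v = gt v u. Proof. by rewrite -{1}tGt bil_tr. Qed.

Let gE i j : g (E i) (E j) = (i == j)%:R. Proof. by rewrite -innerE. Qed.

Lemma frame_expansion v : v = \sum_i g v (E i) *: E i.
Proof.
pose P : 'M[R]_n := \matrix_i E i.
have PP : P *m (G x *m P^T) = 1%:M.
  apply/matrixP => i j; rewrite mulmxA -bil_row !rowK gE mxE //.
rewrite -[LHS]mulmx1 -(mulmx1C PP) mulmxA (mulmx_sum_row _ P).
apply: eq_bigr => i _; rewrite rowK; congr (_ *: _).
by rewrite bil_mul mulmxA !mxE; apply: eq_bigr => l _; rewrite !mxE.
Qed.

Lemma bilinear_sum (X Y : 'I_n -> R) :
  h (\sum_i X i *: E i) (\sum_j Y j *: E j) = \sum_i \sum_j (X i * Y j) *: h (E i) (E j).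
Proof.
have h0 v : h 0 v = 0.
  by have := h_linear 0 0 0 0 v; rewrite !scale0r addr0 => ->; rewrite addr0.
have hS (Z : 'I_n -> R) v : h (\sum_i Z i *: E i) v = \sum_i Z i *: h (E i) v.
  elim/big_rec2: _ => [//|i y z _ <-].
  by rewrite -[z in LHS]scale1r h_linear scale1r.
rewrite hS; apply: eq_bigr => i _; rewrite hC hS scaler_sumr.
by apply: eq_bigr => j _; rewrite scalerA hC.
Qed.

Definition sff_matrix (a : 'I_m) : 'M[R]_n := \matrix_(i, j) gt (h (E i) (E j)) (xi a).
Local Notation L := sff_matrix.

Definition mean_coord (a : 'I_m) : R := n%:R^-1 * \tr (L a).

Definition traceless (a : 'I_m) : 'M[R]_n := L a - (mean_coord a)%:M.
Local Notation B := traceless.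

Lemma sff_matrixC a i j : L a i j = L a j i.
Proof. by rewrite !mxE hC. Qed.

Lemma sff_matrix_tr a : (L a)^T = L a.
Proof. by apply/matrixP => i j; rewrite !mxE hC. Qed.

Lemma traceless_tr a : (B a)^T = B a.
Proof. by rewrite /traceless linearB /= sff_matrix_tr tr_scalar_mx. Qed.

Lemma normal_product (c d : 'I_m -> R) :
  gt (\sum_a c a *: xi a) (\sum_a d a *: xi a) = \sum_a c a * d a.
Proof.
rewrite bil_suml; apply: eq_bigr => a _; rewrite bil_sumr (bigD1 a) //= big1 ?addr0.
  by rewrite bilZl bilZr oxi eqxx mulr1.
by move=> b ba; rewrite bilZl bilZr oxi eq_sym (negbTE ba) !mulr0.
Qed.

Lemma sff_product i j l q : gt (h (E i) (E j)) (h (E l) (E q)) = \sum_a L a i j * L a l q.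
Proof.
rewrite (h_normal (E i)) (h_normal (E l)) normal_product.
by apply: eq_bigr => a _; rewrite !mxE.
Qed.

Let n0 : n%:R != 0 :> R. Proof. by rewrite pnatr_eq0 -lt0n ltnW. Qed.
Let n1 : n%:R - 1 != 0 :> R.
Proof. by rewrite subr_eq0 (eqr_nat R n 1) neq_ltn n2 orbT. Qed.

Lemma mean_curvature_vectorE :
  mean_curvature_vector G Gt F x E = \sum_a mean_coord a *: xi a.
Proof.
rewrite /mean_curvature_vector.
under eq_bigr => i _ do rewrite hE h_normal.
rewrite exchange_big scaler_sumr; apply: eq_bigr => a _ /=.
rewrite -scaler_suml scalerA; congr (_ * _ *: _); apply: eq_bigr => i _; by rewrite mxE.
Qed.

Lemma mean_curvature_sqr :
  mean_curvature G Gt F x E ^+ 2 = \sum_a mean_coord a ^+ 2.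
Proof.
rewrite /mean_curvature innerE mean_curvature_vectorE normal_product sqr_sqrtr.
  by apply: eq_bigr => a _; rewrite expr2.
by apply: sumr_ge0 => a _; rewrite -expr2 sqr_ge0.
Qed.

Lemma trace_sff a : \tr (L a) = n%:R * mean_coord a.
Proof. by rewrite /mean_coord mulrA mulfV // mul1r. Qed.

Lemma dotm_sff a : dotm (L a) (L a) = dotm (B a) (B a) + n%:R * mean_coord a ^+ 2.
Proof.
set H := mean_coord a.
have BE i j : B a i j = L a i j - H *+ (i == j) by rewrite /traceless !mxE.
have -> : dotm (B a) (B a) = dotm (L a) (L a) - 2 * H * \tr (L a) + n%:R * H ^+ 2.
  have -> : n%:R * H ^+ 2 = \sum_(i < n) H ^+ 2 by rewrite sumr_const card_ord mulr_natl.
  rewrite /dotm /mxtrace mulr_sumr -sumrB -big_split; apply: eq_bigr => i _ /=.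
  rewrite (bigD1 i) //= [in RHS](bigD1 i) //= BE eqxx mulr1n.
  have -> : \sum_(j < n | j != i) B a i j * B a i j = \sum_(j < n | j != i) L a i j * L a i j.
    by apply: eq_bigr => j ji; rewrite BE eq_sym (negbTE ji) mulr0n subr0.
  by ring.
by rewrite trace_sff -/H; ring.
Qed.

(** Over ordered pairs the Gauss equation sums to n (n - 1) k plus the terms (tr L_a)^2 - |L_a|^2.
    Splitting off the trace of each L_a separates H^2 from the traceless part. *)
Lemma normalized_scalE : normalized_scal G x E =
  k + \sum_a mean_coord a ^+ 2 - (n%:R * (n%:R - 1))^-1 * \sum_a dotm (B a) (B a).
Proof.
pose f i j := k * (1 - (i == j)%:R) + \sum_a (L a i i * L a j j - L a i j ^+ 2).
have RE i j : Riem G x (E i) (E j) (E j) (E i) = f i j.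
  rewrite gauss. rewrite (gE j j) (gE i i) (gE i j) (gE j i). rewrite !eqxx. rewrite !sff_product. rewrite /f. rewrite sumrB. rewrite (eq_sym j i). rewrite mulr1. rewrite -natrM. rewrite mulnb andbb. rewrite addrA.
  congr (_ + _ - _); apply: eq_bigr => a _; first by rewrite mulrC.
  by rewrite (sff_matrixC a j i) expr2.
have fC i j : f i j = f j i.
  rewrite /f (eq_sym j); congr (_ + _); apply: eq_bigr => a _.
  by rewrite (sff_matrixC a j i); ring.
have f0 i : f i i = 0.
  by rewrite /f eqxx subrr mulr0 add0r big1 // => a _; rewrite expr2 subrr.
have -> : normalized_scal G x E = (n%:R * (n%:R - 1))^-1 * \sum_i \sum_j f i j.
  rewrite (sum_pairs fC f0) mulrA [_^-1 * 2]mulrC; congr (_ * _).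
  by apply: eq_bigr => i _; apply: eq_bigr => j _; exact: RE.
have -> : \sum_i \sum_j f i j = k * (n%:R * (n%:R - 1))
    + \sum_a (\tr (L a) ^+ 2 - dotm (L a) (L a)).
  have -> : k * (n%:R * (n%:R - 1)) = \sum_(i < n) \sum_(j < n) k * (1 - (i == j)%:R).
    have E1 (i : 'I_n) : \sum_(j < n) k * (1 - (i == j)%:R) = k * (n%:R - 1).
      rewrite -mulr_sumr sumrB sumr_const card_ord; congr (_ * (_ - _)).
      rewrite (bigD1 i) //= eqxx big1 ?addr0 // => j ji.
      by rewrite eq_sym (negbTE ji).
    under eq_bigr => i _ do rewrite E1.
    by rewrite sumr_const card_ord -mulr_natl; ring.
  rewrite /f; under eq_bigr => i _ do rewrite big_split /=.
  rewrite big_split /=; congr (_ + _).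
  under eq_bigr => i _ do rewrite exchange_big /=.
  rewrite exchange_big /=; apply: eq_bigr => a _.
  under eq_bigr => i _ do rewrite sumrB.
  rewrite sumrB; congr (_ - _).
  by rewrite /mxtrace expr2 mulr_suml; apply: eq_bigr => i _; rewrite mulr_sumr.
under eq_bigr => a _ do rewrite dotm_sff trace_sff.
have -> : \sum_a ((n%:R * mean_coord a) ^+ 2
     - (dotm (B a) (B a) + n%:R * mean_coord a ^+ 2))
   = (n%:R * (n%:R - 1)) * \sum_a mean_coord a ^+ 2 - \sum_a dotm (B a) (B a).
  by rewrite mulr_sumr -sumrB; apply: eq_bigr => a _; ring.
move: (\sum_a dotm _ _) (\sum_a _ ^+ 2) (n%:R : R) n0 n1 => D S N N0 N1.
by field; rewrite N0 N1.
Qed.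

Lemma bil_shape_op a u v : bil (G x) (shape_op G Gt F x (xi a) u) v = gt (h u v) (xi a).
Proof.
have -> : shape_op G Gt F x (xi a) u = sharp G x (fun w => gt (xi a) (h u w)).
  by congr sharp; apply/funext => w; rewrite innerE hE.
rewrite bil_sharp //. 
by move=> c d w w'; rewrite (hC u) h_linear bilDr !bilZr (hC w) (hC w').
Qed.

Lemma commutator_traceless a b : commutator (B a) (B b) = commutator (L a) (L b).
Proof.
rewrite /commutator /traceless !mulmxBl !mulmxBr !mul_scalar_mx !mul_mx_scalar.
set X := L a *m L b; set Y := L b *m L a; set A := L a; set C := L b.
by apply/matrixP => i j; rewrite !mxE; ring.
Qed.

Lemma normal_curvatureE a b i j :
  normal_curvature G Gt F x (E i) (E j) (xi a) (xi b) = - commutator (L a) (L b) i j.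
Proof.
have key c d : bil (G x) (shape_op G Gt F x (xi c) (shape_op G Gt F x (xi d) (E i))) (E j)
    = (L d *m L c) i j.
  rewrite bil_shape_op (frame_expansion (shape_op _ _ _ _ (xi d) _)).
  rewrite -[E j]scale1r.
  have -> : 1 *: E j = \sum_q (q == j)%:R *: E q.
    rewrite (bigD1 j) //= eqxx big1 ?addr0 // => q qj.
    by rewrite (negbTE qj) scale0r.
  rewrite bilinear_sum bil_suml mxE; apply: eq_bigr => l _.
  rewrite bil_suml (bigD1 j) //= big1 => [|q qj]; last first.
    by rewrite (negbTE qj) mulr0 scale0r bil0l.
  by rewrite eqxx mulr1 addr0 bilZl bil_shape_op !mxE.
rewrite /normal_curvature innerE bilBl; apply: etrans (congr2 (fun s t => s - t) (key a b) (key b a)) _.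
by rewrite [in RHS]/commutator !mxE opprB.
Qed.

(** Traceless parts have the same commutators. The sum over i < j and a < b is a quarter of the full
    sum, and the square root of 4 accounts for the factor 2. *)
Lemma normalized_normal_curvatureE : normalized_normal_curvature G Gt F x E xi =
  (n%:R * (n%:R - 1))^-1 * Num.sqrt (\sum_a \sum_b comm_norm B a b).
Proof.
pose c a b i j := commutator (B a) (B b) i j ^+ 2.
have cC a b i j : c a b j i = c a b i j.
  rewrite /c; have : (commutator (B a) (B b))^T = - commutator (B a) (B b).
    by rewrite /commutator linearB /= !trmx_mul !traceless_tr opprB.
  by move/matrixP/(_ i j); rewrite !mxE => ->; rewrite sqrrN.
have c0 a b i : c a b i i = 0.
  have : (commutator (B a) (B b))^T = - commutator (B a) (B b).
    by rewrite /commutator linearB /= !trmx_mul !traceless_tr opprB.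
  move/matrixP/(_ i i); rewrite mxE [X in _ = X]mxE /c => h0.
  suff -> : commutator (B a) (B b) i i = 0 by rewrite expr0n.
  by move: h0; move: (commutator _ _ i i) => t; lra.
have cM a b : comm_norm B a b = \sum_i \sum_j c a b i j.
  by apply: eq_bigr => i _; apply: eq_bigr => j _; rewrite /c expr2.
pose S := \sum_(i < n) \sum_(j < n | (i < j)%N) \sum_(a < m) \sum_(b < m | (a < b)%N) c a b i j.
have SE : \sum_a \sum_b comm_norm B a b = 4 * S.
  have mC a b : comm_norm B a b = comm_norm B b a.
    rewrite !cM; apply: eq_bigr => i _; apply: eq_bigr => j _; rewrite /c.
    by rewrite -sqrrN; congr (_ ^+ 2); rewrite /commutator !mxE opprB.
  have m0 a : comm_norm B a a = 0.
    rewrite cM big1 // => i _; rewrite big1 // => j _.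
    by rewrite /c /commutator subrr mxE expr0n.
  rewrite (sum_pairs mC m0) (_ : 4 = 2 * 2); last by rewrite -natrM.
  rewrite -mulrA; congr (_ * _); rewrite /S.
  pose f i j := \sum_(a < m) \sum_(b < m | (a < b)%N) c a b i j.
  have fC i j : f i j = f j i by apply: eq_bigr => a _; apply: eq_bigr => b _; exact: cC.
  have f0 i : f i i = 0 by rewrite /f big1 // => a _; rewrite big1.
  rewrite -(sum_pairs fC f0) /f; apply: esym.
  under [LHS]eq_bigr => i _ do rewrite exchange_big /=.
  rewrite exchange_big /=; apply: eq_bigr => a _.
  under [LHS]eq_bigr => i _ do rewrite exchange_big /=.
  rewrite exchange_big /=; apply: eq_bigr => b _; exact: esym (cM a b).
have S0 : 0 <= S.
  by do 4 (apply: sumr_ge0 => ? _); exact: sqr_ge0.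
have -> : normalized_normal_curvature G Gt F x E xi = 2 / (n%:R * (n%:R - 1)) * Num.sqrt S.
  congr (_ * Num.sqrt _); do 4 (apply: eq_bigr => ? _).
  by rewrite /c commutator_traceless -[RHS]sqrrN; congr (_ ^+ 2); exact: normal_curvatureE.
rewrite SE sqrtrM // (_ : 4 = 2 ^+ 2); last by rewrite expr2 -natrM.
by rewrite sqrtr_sqr ger0_norm // mulrA (mulrC 2).
Qed.

Hypothesis normal_xi : forall a u, gt (xi a) ('D_u F x) = 0.
Hypothesis wintgen : wintgen_ideal_at G Gt F k x.

(** Once k and H^2 cancel, the Wintgen equality equates the sum of the |B_a|^2 with the square root
    of the commutator sum. *)
Lemma ddvv_equality :
  \sum_a \sum_b comm_norm B a b = (\sum_a dotm (B a) (B a)) ^+ 2.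
Proof.
have on : orthonormal_normal_frame Gt F x xi.
  split=> [a b|a u]; first by rewrite innerE.
  by apply: etrans (normal_xi a u); exact: innerE.
have := wintgen oE on; rewrite normalized_scalE mean_curvature_sqr normalized_normal_curvatureE.
have C0 : 0 <= \sum_a \sum_b comm_norm B a b.
  by do 4 (apply: sumr_ge0 => ? _); rewrite -expr2 sqr_ge0.
move: (\sum_a _ ^+ 2) (\sum_a dotm _ _) => S D e.
have : (n%:R * (n%:R - 1))^-1 * D
   = (n%:R * (n%:R - 1))^-1 * Num.sqrt (\sum_a \sum_b comm_norm B a b) by lra.
move/mulfI => -> //; first by rewrite sqr_sqrtr.
by rewrite invr_eq0 mulf_neq0.
Qed.

Lemma sff_coord u v a : gt (h u v) (xi a) =
  bil (L a) (\row_i g u (E i)) (\row_i g v (E i)).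
Proof.
rewrite {1}(frame_expansion u) {1}(frame_expansion v) bilinear_sum bil_suml.
apply: eq_bigr => i _; rewrite bil_suml; apply: eq_bigr => j _.
by rewrite bilZl !mxE mulrAC.
Qed.

Local Notation Hm := (mean_curvature_vector G Gt F x E).

Lemma dot_frame u v : g u v = \sum_i g u (E i) * g v (E i).
Proof.
rewrite {1}(frame_expansion u) bil_suml; apply: eq_bigr => i _.
by rewrite bilZl (gC (E i)).
Qed.

(** [commutator_equality] carried from matrices to vectors: e1, e2 are the coordinates of f1, f2 in
    the frame [E], and q1, q2 those of eta1, eta2 in [xi]. *)
Lemma wintgen_shape : (forall u v, h u v = g u v *: Hm) \/
  exists (mu : R) (f1 f2 : V) (eta1 eta2 : W), [/\ mu != 0,
    [/\ g f1 f1 = 1, g f2 f2 = 1 & g f1 f2 = 0],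
    [/\ gt eta1 eta1 = 1, gt eta2 eta2 = 1 & gt eta1 eta2 = 0] &
    forall u v, h u v = g u v *: Hm
      + mu *: ((g u f1 * g v f1 - g u f2 * g v f2) *: eta1
             + (g u f1 * g v f2 + g u f2 * g v f1) *: eta2)].
Proof.
have LB a : L a = (mean_coord a)%:M + B a by rewrite /traceless addrC subrK.
have dM u v a : bil (mean_coord a)%:M (\row_i g u (E i)) (\row_i g v (E i))
    = g u v * mean_coord a.
  rewrite bil_mul mul_mx_scalar -scalemxAl mxE mulrC dot_frame mxE; congr (_ * _).
  by apply: eq_bigr => i _; rewrite !mxE.
have hM u v : h u v = g u v *: Hm
    + \sum_a bil (B a) (\row_i g u (E i)) (\row_i g v (E i)) *: xi a.
  rewrite h_normal mean_curvature_vectorE scaler_sumr -big_split; apply: eq_bigr => a _ /=.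
  by rewrite sff_coord LB bil_addm dM scalerDl scalerA.
have [B0|] := commutator_equality traceless_tr ddvv_equality.
  left=> u v; rewrite hM big1 ?addr0 // => a _.
  by rewrite B0 bil_mul mulmx0 mul0mx mxE scale0r.
move=> [e1 [e2 [q1 [q2 [mu [mu0 [e11 e22 e12] [q11 q22 q12] BE]]]]]]; right.
pose fr (e : V) := \sum_i e 0 i *: E i.
pose nr (q : 'rV[R]_m) := \sum_a q 0 a *: xi a.
have frE u e : g u (fr e) = dotv (\row_i g u (E i)) e.
  rewrite dotvE bil_sumr; apply: eq_bigr => i _.
  by rewrite bilZr mxE mulrC.
have frf e e' : g (fr e) (fr e') = dotv e e'.
  rewrite frE; congr dotv; apply/rowP => i; rewrite mxE bil_suml (bigD1 i) //= big1.
    by rewrite bilZl gE eqxx mulr1 addr0.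
  by move=> j ji; rewrite bilZl gE (negbTE ji) mulr0.
have nrn q q' : gt (nr q) (nr q') = dotv q q' by rewrite dotvE normal_product.
exists mu, (fr e1), (fr e2), (nr q1), (nr q2); split=> //; rewrite ?frf ?nrn //.
move=> u v; rewrite hM; congr (_ + _).
rewrite !frE /nr !scaler_sumr -big_split scaler_sumr; apply: eq_bigr => a _ /=.
rewrite !scalerA -scalerDl scalerA; congr (_ *: _); rewrite BE.
have bT (s t : V) : bil (s^T *m t) (\row_i g u (E i)) (\row_i g v (E i))
    = dotv (\row_i g u (E i)) s * dotv (\row_i g v (E i)) t.
  by rewrite bil_mul !mulmxA -mulmxA mxE big_ord1 -!/(dotv _ _) (dotvC t).
rewrite bil_scalem bil_addm !bil_scalem bil_addm -scaleN1r bil_scalem bil_addm !bT; ring.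
Qed.
End Wintgen.

(** * The equivalence at a point *)

(*%%D7*)
Lemma mulmx_row_entry (R : realType) N q (A : 'M[R]_N) (Q : 'M[R]_(q, N)) (w : 'rV[R]_N) i :
  (w *m A *m Q^T) 0 i = bil A w (row i Q).
Proof.
rewrite bil_mul [LHS]mxE [RHS]mxE; apply: eq_bigr => l _; congr (_ * _).
by rewrite !mxE.
Qed.

Section PointwiseSubmanifold.
Context {R : realType} {n m : nat}.
Local Notation V := 'rV[R]_n.
Local Notation W := 'rV[R]_(n + m).
Variables (U : set V) (U' : set W) (G : V -> 'M[R]_n) (Gt : W -> 'M[R]_(n + m)) (F : V -> W) (k : R).
Hypotheses (oU : open U) (oU' : open U').
Hypotheses (sG : smoothm U G) (tG : forall x, U x -> (G x)^T = G x) (pG : posdef U G).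
Hypotheses (sGt : smoothm U' Gt) (tGt : forall x, U' x -> (Gt x)^T = Gt x) (pGt : posdef U' Gt).
Hypotheses (dF : forall x, U x -> differentiable F x) (sF : smoothv U F).
Hypothesis FU : forall x, U x -> U' (F x).
Hypothesis isoF : forall x u v, U x ->
  bil (G x) u v = bil (Gt (F x)) (ddv F u x) (ddv F v x).
Hypothesis ambient : forall y a b c d, U' y -> riem Gt y a b c d =
  k * (bil (Gt y) b c * bil (Gt y) a d - bil (Gt y) a c * bil (Gt y) b d).

Let uG x : U x -> G x \in unitmx. Proof. exact: posdef_unitmx. Qed.
Let uGt x : U' x -> Gt x \in unitmx. Proof. exact: posdef_unitmx. Qed.

Lemma sff_sym x u v : U x -> sff G Gt F x u v = sff G Gt F x v u.
Proof.
move=> Ux; rewrite /sff (hess_sym oU oU' sGt tGt uGt sF FU _ _ Ux).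
by rewrite (Gam_sym oU sG tG uG u v Ux).
Qed.

Lemma sff_linear x a b u u' v : U x ->
  sff G Gt F x (a *: u + b *: u') v = a *: sff G Gt F x u v + b *: sff G Gt F x u' v.
Proof.
move=> Ux; rewrite /sff /hess /covF (Gam_linear1 sG uG _ _ _ _ _ Ux).
rewrite !(ddv_linear _ _ _ _ sF Ux) (ddv_linear _ _ _ _ (smoothv_ddv oU v sF) Ux).
rewrite (Gam_linear1 sGt uGt _ _ _ _ _ (FU Ux)).
by apply/rowP => l; rewrite !mxE; ring.
Qed.

Lemma smooth_sff u v : smoothv U (fun y => sff G Gt F y u v).
Proof.
apply: smoothvB => //; first exact: (smooth_covF oU oU' sGt uGt dF sF FU _ (smoothv_ddv oU v sF)).
move=> l; apply: (smooth_ext oU (f := fun y =>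
    \sum_i Gam G y u v 0 i * dd (fun y => F y 0 l) (delta_mx 0 i) y)).
  by move=> y Uy; rewrite mxE (dd_coord_sum _ (sF l) Uy).
apply: smooth_sum => // i _; apply: smoothM => //; last exact: smooth_dd (sF l).
exact: (smooth_Gam oU sG uG u v i).
Qed.

Lemma gauss x u v w z : U x -> Riem G x u v w z =
  k * (bil (G x) v w * bil (G x) u z - bil (G x) u w * bil (G x) v z)
  + bil (Gt (F x)) (sff G Gt F x v w) (sff G Gt F x u z)
  - bil (Gt (F x)) (sff G Gt F x u w) (sff G Gt F x v z).
Proof.
move=> Ux; rewrite (RiemE oU sG uG) //.
rewrite (gauss_equation oU oU' sG tG uG sGt tGt uGt dF sF FU isoF) //.
by rewrite (ambient _ _ _ _ (FU Ux)) !(isoF _ _ Ux).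
Qed.

Definition tangent_mx x : 'M[R]_(n, n + m) := \matrix_i ddv F (delta_mx 0 i) x.

Lemma tangent_mxE x v : U x -> ddv F v x = v *m tangent_mx x.
Proof.
move=> Ux; rewrite mulmx_sum_row; apply/rowP => l.
rewrite ddvE (dd_coord_sum _ (sF l) Ux) summxE; apply: eq_bigr => i _.
by rewrite rowK mxE ddvE.
Qed.

(** The Wintgen condition quantifies over frames, so a frame must be exhibited before it says
    anything. The rows of [tangent_mx] are independent because the immersion is isometric, and their
    orthonormal complement is the frame. *)
Lemma normal_frame x : U x -> exists xi : 'I_m -> W, [/\
  forall a b, bil (Gt (F x)) (xi a) (xi b) = (a == b)%:R,
  forall a u, bil (Gt (F x)) (xi a) (ddv F u x) = 0 &
  forall w, (forall u, bil (Gt (F x)) w (ddv F u x) = 0) ->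
    w = \sum_a bil (Gt (F x)) w (xi a) *: xi a].
Proof.
move=> Ux; have fT : row_free (tangent_mx x).
  apply: inj_row_free => v; rewrite -tangent_mxE // => v0.
  apply/eqP; apply: contraT => vn0; have := pG Ux vn0.
  by rewrite isoF // v0 bil0l ltxx.
have pF v : v != 0 -> 0 < bil (Gt (F x)) v v by apply: pGt; exact: FU.
have [P [PP PT Pc]] := orthonormal_complement (tGt (FU Ux)) pF (erefl (n + m)%N) fT.
exists (fun a => row a P); split.
- by move=> a b; rewrite bil_row PP mxE.
- move=> a u; rewrite tangent_mxE // bil_mul -row_mul trmx_mul -!row_mul !mulmxA.
  by rewrite PT mul0mx !mxE.
move=> w hw; rewrite {1}(Pc w); last first.
  apply/rowP => i; rewrite mulmx_row_entry mxE.
  by rewrite -(hw (delta_mx 0 i)) /tangent_mx rowK.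
rewrite mulmx_sum_row; apply: eq_bigr => a _; congr (_ *: _).
by rewrite mulmx_row_entry.
Qed.

Lemma tangent_frame x : U x -> exists E, orthonormal_frame G x E.
Proof.
move=> Ux; have pGx v : v != 0 -> 0 < bil (G x) v v by exact: pG.
have f1 : row_free (1%:M : 'M[R]_n) by rewrite row_free_unit unitmx1.
have [P [PP _]] := orthonormal_basis (tG Ux) pGx f1.
by exists (fun i => row i P) => i j; rewrite innerE bil_row PP mxE.
Qed.

Let hE x u v : U x -> second_ff G Gt F x u v = sff G Gt F x u v.
Proof. by move=> Ux; exact: (second_ffE oU oU' sG sGt sF FU). Qed.

Lemma shape_curv x mu f1 f2 (H eta1 eta2 : W) : U x ->
  bil (Gt (F x)) eta1 eta1 = 1 -> bil (Gt (F x)) eta2 eta2 = 1 -> bil (Gt (F x)) eta1 eta2 = 0 ->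
  (forall u v, sff G Gt F x u v = bil (G x) u v *: H
      + mu *: ((bil (G x) u f1 * bil (G x) v f1 - bil (G x) u f2 * bil (G x) v f2) *: eta1
             + (bil (G x) u f1 * bil (G x) v f2 + bil (G x) u f2 * bil (G x) v f1) *: eta2)) ->
  forall u v w, curv_op G x u v w = wintgen_curv G x (k + bil (Gt (F x)) H H) mu
    (bil (Gt (F x)) H eta1) (bil (Gt (F x)) H eta2) f1 f2 u v w.
Proof.
move=> Ux e11 e22 e12 shape u v w; apply: (bil_nondegenerate uG Ux) => z.
have gC a b : bil (G x) a b = bil (G x) b a by exact: (bil_sym tG _ _ Ux).
have gtC a b : bil (Gt (F x)) a b = bil (Gt (F x)) b a by exact: (bil_sym tGt _ _ (FU Ux)).
have gen (p0 p1 p2 q0 q1 q2 : R) :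
    bil (Gt (F x)) (p0 *: H + mu *: (p1 *: eta1 + p2 *: eta2))
                   (q0 *: H + mu *: (q1 *: eta1 + q2 *: eta2)) =
    p0 * q0 * bil (Gt (F x)) H H
    + mu * p0 * (q1 * bil (Gt (F x)) H eta1 + q2 * bil (Gt (F x)) H eta2)
    + mu * q0 * (p1 * bil (Gt (F x)) H eta1 + p2 * bil (Gt (F x)) H eta2)
    + mu ^+ 2 * (p1 * q1 + p2 * q2).
  rewrite !(bilDl, bilDr, bilZl, bilZr) (gtC eta1 H) (gtC eta2 H) (gtC eta2 eta1) e11 e22 e12.
  by ring.
have hh a b c d : bil (Gt (F x)) (sff G Gt F x a b) (sff G Gt F x c d) =
    bil (G x) a b * bil (G x) c d * bil (Gt (F x)) H H
  + mu * bil (G x) a b *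
     ((bil (G x) c f1 * bil (G x) d f1 - bil (G x) c f2 * bil (G x) d f2) * bil (Gt (F x)) H eta1
    + (bil (G x) c f1 * bil (G x) d f2 + bil (G x) c f2 * bil (G x) d f1) * bil (Gt (F x)) H eta2)
  + mu * bil (G x) c d *
     ((bil (G x) a f1 * bil (G x) b f1 - bil (G x) a f2 * bil (G x) b f2) * bil (Gt (F x)) H eta1
    + (bil (G x) a f1 * bil (G x) b f2 + bil (G x) a f2 * bil (G x) b f1) * bil (Gt (F x)) H eta2)
  + mu ^+ 2 *
     ((bil (G x) a f1 * bil (G x) b f1 - bil (G x) a f2 * bil (G x) b f2)
        * (bil (G x) c f1 * bil (G x) d f1 - bil (G x) c f2 * bil (G x) d f2)
    + (bil (G x) a f1 * bil (G x) b f2 + bil (G x) a f2 * bil (G x) b f1)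
        * (bil (G x) c f1 * bil (G x) d f2 + bil (G x) c f2 * bil (G x) d f1)).
  by rewrite !shape gen.
have := gauss u v w z Ux; rewrite /Riem innerE => ->; rewrite !hh /wintgen_curv /wedgev.
rewrite !(bilDl, bilNl, bilZl) !(gC f1) !(gC f2).
by ring.
Qed.

Lemma umbilical_of_dependence x : U x -> (3 < n)%N ->
  wintgen_ideal_at G Gt F k x -> lin_dep6 (C_dot_R G x) (Q_g_C G x) -> umbilical_at G Gt F x.
Proof.
move=> Ux n3 hW dep E oE.
have n2 : (1 < n)%N by exact: ltn_trans n3.
have [xi [oxi nxi xic]] := normal_frame Ux.
have nxi' a u : bil (Gt (F x)) (xi a) ('D_u F x) = 0 by rewrite (derive_ddv u sF Ux).
have hn u v : sff G Gt F x u v = \sum_a bil (Gt (F x)) (sff G Gt F x u v) (xi a) *: xi a.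
  apply: xic => w.
  exact: (sff_normal oU oU' sG uG sGt tGt uGt dF sF FU isoF).
have [umb|] := wintgen_shape (fun u v => hE u v Ux) (tG Ux) (uG Ux) (tGt (FU Ux))
  (fun u v => sff_sym u v Ux) (fun a b u u' v => sff_linear a b u u' v Ux)
  (fun u v w z => gauss u v w z Ux) oE oxi hn n2 nxi' hW.
  by move=> u v; apply: etrans (hE u v Ux) _; rewrite innerE; exact: umb.
move=> [mu [f1 [f2 [eta1 [eta2 [mu0 [g11 g22 g12] [e11 e22 e12] shape]]]]]].
have curvE := shape_curv Ux e11 e22 e12 shape.
have pGx v : v != 0 -> 0 < bil (G x) v v by exact: pG.
(* Since n >= 4, the orthogonal complement of f1 and f2 contains the two orthonormal vectors needed
   by [wintgen_independent]. *)
pose T : 'M[R]_(2, n) := \matrix_i (if i == 0 then f1 else f2).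
have gC a b : bil (G x) a b = bil (G x) b a by exact: (bil_sym tG _ _ Ux).
have fT : row_free T.
  apply/row_freeP; exists (G x *m T^T); apply/matrixP => i j.
  rewrite mulmxA -bil_row !rowK mxE.
  by case: i j => [[|[|//]] hi] [[|[|//]] hj] /=; rewrite ?g11 ?g22 ?g12 // gC g12.
have n22 : (2 + (n - 2))%N = n by exact: subnKC.
have [P [PP PT _]] := orthonormal_complement (tG Ux) pGx n22 fT.
have i0 : (0 < n - 2)%N by rewrite subn_gt0 ltnW.
have i1 : (1 < n - 2)%N by rewrite ltn_subRL.
pose f3 := row (Ordinal i0) P; pose f4 := row (Ordinal i1) P.
have PTE i j : bil (G x) (row i P) (if j == 0 :> 'I_2 then f1 else f2) = 0.
  by have := bil_row (G x) P T i j; rewrite PT rowK mxE.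
exfalso; apply: (wintgen_independent (tG Ux) (uG Ux) g11 g22 g12 curvE
  (f3 := f3) (f4 := f4) n3 mu0) dep.
- by rewrite bil_row PP mxE.
- by rewrite bil_row PP mxE.
- by rewrite bil_row PP mxE.
- exact: (PTE _ 0).
- exact: (PTE _ 1).
- exact: (PTE _ 0).
- exact: (PTE _ 1).
Qed.

Lemma umbilical_shape x : U x -> umbilical_at G Gt F x ->
  exists H, forall u v, sff G Gt F x u v = bil (G x) u v *: H.
Proof.
move=> Ux umb; have [E oE] := tangent_frame Ux.
exists (mean_curvature_vector G Gt F x E) => u v.
by rewrite -innerE; apply: etrans (umb E oE u v); apply: esym; exact: hE.
Qed.

(** The curvature has the form [wintgen_curv] with mu = 0, for which any orthonormal pair may play
    f1, f2. Then C.R = 0, and the coefficients 1 and 0 witness dependence. *)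
Lemma dependence_of_umbilical x : U x -> (2 < n)%N ->
  umbilical_at G Gt F x -> lin_dep6 (C_dot_R G x) (Q_g_C G x).
Proof.
move=> Ux n2 umb; have [E oE] := tangent_frame Ux; have [H shape] := umbilical_shape Ux umb.
have i0 : (0 < n)%N by exact: ltn_trans n2.
have i1 : (1 < n)%N by exact: ltn_trans n2.
have EE i j : bil (G x) (E i) (E j) = (i == j)%:R by rewrite -innerE.
pose c := k + bil (Gt (F x)) H H.
have curvE u v w : curv_op G x u v w =
    wintgen_curv G x c 0 0 0 (E (Ordinal i0)) (E (Ordinal i1)) u v w.
  apply: (bil_nondegenerate uG Ux) => z.
  have := gauss u v w z Ux; rewrite /Riem innerE => ->; rewrite !shape !(bilZl, bilZr).
  by rewrite /wintgen_curv /wedgev !(bilDl, bilNl, bilZl) /c; ring.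
exists 1, 0; split; first by rewrite oner_neq0.
move=> *; rewrite (umbilical_C_dot_R (tG Ux) (uG Ux) _ _ _ curvE) ?EE //.
by rewrite mulr0 mul0r addr0.
Qed.
End PointwiseSubmanifold.

(** * Umbilical submanifolds are conformally flat *)

(*%%D8*)
Section UmbilicalConformal.
Context {R : realType} {n m : nat}.
Local Notation V := 'rV[R]_n.
Local Notation W := 'rV[R]_(n + m).
Variables (U : set V) (U' : set W) (G : V -> 'M[R]_n) (Gt : W -> 'M[R]_(n + m)) (F : V -> W) (k : R).
Hypotheses (oU : open U) (oU' : open U').
Hypotheses (sG : smoothm U G) (tG : forall x, U x -> (G x)^T = G x) (pG : posdef U G).
Hypotheses (sGt : smoothm U' Gt) (tGt : forall x, U' x -> (Gt x)^T = Gt x) (pGt : posdef U' Gt).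
Hypotheses (dF : forall x, U x -> differentiable F x) (sF : smoothv U F).
Hypothesis FU : forall x, U x -> U' (F x).
Hypothesis isoF : forall x u v, U x ->
  bil (G x) u v = bil (Gt (F x)) (ddv F u x) (ddv F v x).
Hypothesis ambient : forall y a b c d, U' y -> riem Gt y a b c d =
  k * (bil (Gt y) b c * bil (Gt y) a d - bil (Gt y) a c * bil (Gt y) b d).

Let uG x : U x -> G x \in unitmx. Proof. exact: posdef_unitmx. Qed.
Let uGt x : U' x -> Gt x \in unitmx. Proof. exact: posdef_unitmx. Qed.


Hypothesis n2 : (1 < n)%N.
Hypothesis umb : forall x, U x -> umbilical_at G Gt F x.

Let e0 : V := delta_mx 0 (Ordinal (ltnW n2)).
Let e1 : V := delta_mx 0 (Ordinal n2).

Let e0_neq0 : e0 != 0.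
Proof.
apply/eqP => /matrixP/(_ 0 (Ordinal (ltnW n2))); rewrite !mxE !eqxx => /eqP.
by rewrite oner_eq0.
Qed.

(** Under umbilicity this is the mean curvature vector, computed from one constant field: its
    smoothness is visible and no orthonormal frame has to be chosen smoothly. *)
Definition mean_field (y : V) : W := (bil (G y) e0 e0)^-1 *: sff G Gt F y e0 e0.

Lemma mean_field_umbilical x u v : U x -> sff G Gt F x u v = bil (G x) u v *: mean_field x.
Proof.
move=> Ux; have [H HE] := umbilical_shape oU oU' sG tG pG sGt sF FU Ux (umb Ux).
rewrite /mean_field !HE !scalerA -mulrA mulVf ?mulr1 // gt_eqF //.
exact: pG Ux e0_neq0.
Qed.

Lemma smooth_mean_field : smoothv U mean_field.
Proof.
apply: smoothvZ => //; last exact: (smooth_sff oU oU' sG pG sGt pGt dF sF FU).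
apply: smoothV => //.
  by move=> y Uy; rewrite gt_eqF //; exact: pG Uy e0_neq0.
by apply: smooth_bil => //; exact: smoothv_cst.
Qed.

Lemma mean_field_normal x u : U x -> bil (Gt (F x)) (ddv F u x) (mean_field x) = 0.
Proof.
move=> Ux; rewrite bilZr (bil_sym tGt _ _ (FU Ux)).
by rewrite (sff_normal oU oU' sG uG sGt tGt uGt dF sF FU isoF) // mulr0.
Qed.

Local Notation normH := (fun y => bil (Gt (F y)) (mean_field y) (mean_field y)).

Lemma smooth_normH : smooth U normH.
Proof.
apply: smooth_bil => //; [|exact: smooth_mean_field|exact: smooth_mean_field].
by move=> a b; exact: (smooth_compose oU dF sF FU (sGt a b)).
Qed.

Lemma orthogonal_vector x u : U x -> exists2 v, v != 0 & bil (G x) u v = 0.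
Proof.
move=> Ux; have [ue0|ue0] := eqVneq (bil (G x) u e0) 0; first by exists e0.
exists (bil (G x) u e1 *: e0 - bil (G x) u e0 *: e1); last first.
  by rewrite bilBr !bilZr; ring.
apply: contraNneq ue0 => /matrixP/(_ 0 (Ordinal n2)); rewrite !mxE !eqxx /=.
by rewrite mulr0 mulr1 add0r => /eqP; rewrite oppr_eq0.
Qed.

(* Schur's lemma for the mean curvature: this uses only the Codazzi equation. *)
Lemma dd_normH x u : U x -> dd normH u x = 0.
Proof.
move=> Ux; have [v v0 uv] := orthogonal_vector u Ux.
have := codazzi_umbilical oU oU' sG tG uG sGt tGt uGt dF sF FU smooth_mean_field
  (fun x u v Ux => mean_field_umbilical u v Ux)
  (fun x u Ux => mean_field_normal u Ux) ambient u v v Ux.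
rewrite uv mul0r => /eqP; rewrite mulf_eq0 gt_eqF //=; first by move/eqP.
exact: pG Ux v0.
Qed.

(** On a ball |H|^2 is constant by [dd_normH], so the Gauss equation gives constant curvature k +
    |H|^2 there. *)
Lemma umbilical_conformally_flat x0 : U x0 ->
  exists (B : set V) (phi : V -> R),
    [/\ open B, B x0, B `<=` U, smooth B phi &
        forall x, B x -> 0 < phi x /\
          forall u v w, curv_op (fun y => phi y *: G y) x u v w = 0].
Proof.
move=> Ux0; have /nbhs_radius[r r0 rU] := near_open oU Ux0.
pose B0 := [set p : V | `|x0 - p| < r].
have B0U : B0 `<=` U by move=> p; exact: rU.
have B0x : B0 x0 by rewrite /B0 /= subrr normr0.
have cst y : B0 y -> normH y = normH x0.
  move=> By; apply: (zero_derivative_const (r := r) (f := normH)) By => y'.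
    by move=> /rU Uy; exact: (smooth_differentiable smooth_normH Uy).
  by move=> v /rU Uy; rewrite -ddE dd_normH.
have sGB : smoothm B0 G by move=> i j; exact: smooth_subset (sG i j).
have riemB x u v w z : B0 x -> riem G x u v w z = (k + normH x0) *
    (bil (G x) v w * bil (G x) u z - bil (G x) u w * bil (G x) v z).
  move=> Bx; rewrite -(cst x Bx).
  apply: (umbilical_riem oU oU' sG tG uG sGt tGt uGt dF sF FU isoF (H := mean_field)
    _ ambient) => //; last exact: B0U.
  by move=> *; exact: mean_field_umbilical.
have tGB x : B0 x -> (G x)^T = G x by move=> /B0U; exact: tG.
have uGB x : B0 x -> G x \in unitmx by move=> /B0U; exact: uG.
have [B [phi [oB Bx BB sphi flat]]] :=
  constant_curvature_conformally_flat (@ball_openN R n x0 r) sGB tGB uGB riemB B0x.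
exists B, phi; split => //; first by move=> y /BB/B0U.
move=> x Bx'; have [phi0 fl] := flat x Bx'; split => // u v w.
have sB : smoothm B (fun y => phi y *: G y).
  move=> i j; apply: smooth_ext (smoothM oB sphi (smooth_subset BB (sGB i j))) => // y _.
  by rewrite mxE.
rewrite (curv_opE oB sB _ _ _ _ Bx') ?fl // => y By.
have [phiy _] := flat y By.
by rewrite unitmxZ ?uGB ?unitfE ?gt_eqF //; exact: BB.
Qed.
End UmbilicalConformal.

(** * From charts to manifolds *)

Theorem theorem11 (R : realType) (n m : nat) (k : R)
    (M : riemannian_manifold R n) (N : riemannian_manifold R (n + m))
    (f : M -> N)
    (hn : (4 <= n)%N) (hm : (1 <= m)%N)
    (hN : constant_curvature N k)
    (hf : isometric_immersion f)
    (hW : wintgen_ideal f k) :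
  (CR_QgC_linearly_dependent M <-> totally_umbilical f) /\
  (totally_umbilical f -> conformally_flat M).
Proof.
have n3 : (2 < n)%N by exact: ltnW.
have sG i j : smoothm (overlap f i j) (metric i).
  by move=> a b; apply: smooth_subset (@smoothm_metric _ _ M i a b); exact: overlap_codom.
have tG i j x : overlap f i j x -> (metric i x)^T = metric i x.
  by move=> /overlap_codom; exact: metric_tr.
have pG i j : posdef (overlap f i j) (metric i).
  by move=> x u /overlap_codom; exact: posdef_metric.
have sGt j : smoothm (chart_codom (atlas j)) (metric j) := @smoothm_metric _ _ N j.
have pGt j : posdef (chart_codom (atlas j)) (metric j) := @posdef_metric _ _ N j.
have tGt j x : chart_codom (atlas j) x -> (metric j x)^T = metric j x := @metric_tr _ _ N j x.
have oO i j := open_overlap hf (i := i) (j := j).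
have oC j : open (chart_codom (@atlas _ _ N j)) by exact: chart_codom_open.
have dF i j x (Ux : overlap f i j x) := differentiable_local_expr hf Ux.
have sF i j := smoothv_local_expr hf i j.
have FU i j x (Ux : overlap f i j x) := local_expr_codom Ux.
have isoF i j x u v (Ux : overlap f i j x) := local_expr_isometric hf u v Ux.
have amb j y a b c d (Uy : chart_codom (atlas j) y) := riem_constant_curvature hN Uy a b c d.
have mem p i j : chart_dom (atlas i) p -> chart_dom (atlas j) (f p) ->
  overlap f i j (chart_fun (atlas i) p) by move=> di dj; exists p.
split; first split.
- move=> dep p i j di dj.
  apply: (umbilical_of_dependence (U' := chart_codom (atlas j)) (k := k) (oO i j) (oC j)
    (sG i j) (tG i j) (pG i j) (sGt j) (tGt j) (pGt j) (dF i j) (sF i j) (FU i j) (isoF i j)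
    (amb j) (mem _ _ _ di dj) hn (hW p i j di dj)).
  exact: dep.
(* Dependence is intrinsic; some chart of the ambient space around f p has to be chosen to use
   umbilicity. *)
- move=> umb p i di /=; have [j dj] := atlas_cover (f p).
  exact: (dependence_of_umbilical (U' := chart_codom (atlas j)) (k := k) (oO i j) (oC j)
    (sG i j) (tG i j) (pG i j) (sGt j) (tGt j) (pGt j) (dF i j) (sF i j) (FU i j) (isoF i j)
    (amb j) (mem _ _ _ di dj) n3 (umb p i j di dj)).
move=> umb p i di; have [j dj] := atlas_cover (f p).
(* Umbilicity is needed on the whole chart overlap, because the Codazzi equation differentiates
   it. *)
have umb' x : overlap f i j x -> umbilical_at (metric i) (metric j) (local_expr f i j) x.
  by case=> q [qi qj] <-; exact: umb.
have [B [phi [oB Bp BU sphi flat]]] := umbilical_conformally_flat (oO i j) (oC j)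
    (sG i j) (tG i j) (pG i j) (sGt j) (tGt j) (pGt j) (dF i j) (sF i j) (FU i j) (isoF i j)
    (amb j) (ltnW n3) umb' (mem _ _ _ di dj).
exists B, phi; split => //.
by move=> x /BU /overlap_codom.
Qed.
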